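(* Let $E\subseteq\Omega_0$ be a $2$-rectifiable set such that (a) $\mathcal H^2(E)<\infty$ and $0\in E$; (b) $E$ is $(\Omega_0,L_0,h)$ locally sliding almost minimal at $0$; (c) $E$ is locally $C^0$-equivalent at $0$ to a sliding minimal cone of type $\mathbb P_+$ or $\mathbb Y_+$. Let $\lambda,\mu,\mathfrak r_1$ be the constants described in the context, and $\lambda_0=\lambda/(1-\lambda)$. If the gauge function satisfies $$h(t)\le C_ht^{\alpha},\quad 0<t\le\mathfrak r_1,\ \text{ for some } C_h>0,\ \alpha>0,$$ then for any $0<\beta<\min\{\alpha,2\lambda_0\}$ there is a constant $C=C(\lambda_0,\alpha,\beta,\mathfrak r_1,C_h)>0$ such that $$|\Theta(0,\rho)-\Theta(0)|\le C\rho^{\beta}\quad\text{for all }0<\rho\le\mathfrak r_1,$$ where $\Theta(0,\rho)=\rho^{-2}\mathcal H^2(E\cap B(0,\rho))$ and $\Theta(0)=\lim_{\rho\to0^+}\Theta(0,\rho)$.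
   Context: $\Omega_0=\{x\in\mathbb{R}^3:x_3\ge0\}$, $L_0=\partial\Omega_0$; $B(x,r)$ is the open ball and $B_r=B(0,r)$. A gauge function is a nondecreasing $h:[0,\infty)\to[0,\infty]$ with $\lim_{t\to0}h(t)=0$; it is assumed that $\int_0^{r_h}h(2t)t^{-1}dt<\infty$ for some $r_h>0$. A sliding deformation of $E\subseteq\Omega_0$ in an open set $U$ is a family $\varphi_t:E\to\Omega_0$, $0\le t\le1$, with $\varphi_t(x)=x$ for $x\in E\setminus U$, $\varphi_t(x)\in U$ for $x\in E\cap U$, $\varphi_t(x)\in L_0$ for $x\in E\cap L_0$, $(t,x)\mapsto\varphi_t(x)$ continuous, $\varphi_1$ Lipschitz, $\varphi_0=\mathrm{id}_E$. $E$ is $(\Omega_0,L_0,h)$ locally sliding almost minimal at $x\in E$ if $\mathcal H^2$ restricted to $E$ is locally finite and $\mathcal H^2(E\cap B(x,r))\le\mathcal H^2(\varphi_1(E)\cap B(x,r))+h(r)r^2$ for every sliding deformation of $E$ in $B(x,r)$. A cone of type $\mathbb P_+$ is a half plane in $\Omega_0$ (bounded by a line through $0$ in $L_0$) perpendicular to $L_0$; a cone of type $\mathbb Y_+$ is $\Omega_0\cap Y$, where $Y$ is a union of three half planes meeting at $120^\circ$ angles along a common boundary line through $0$ perpendicular to $L_0$. $E$ is locally $C^0$-equivalent at $0$ to a cone of type $\mathbb P_+$ (resp. $\mathbb Y_+$) if there are $\varrho_0>0$, $\tau_0>0$ such that for every $\tau\in(0,\tau_0)$ there are $\varrho\in(0,\varrho_0)$,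 a cone $Z$ of that type and a map $\Phi:\Omega_0\cap B(0,2\varrho)\to\Omega_0$, a homeomorphism onto its image, with $\Phi(0)=0$, $\Phi(L_0\cap B(0,2\varrho))\subseteq L_0$, $\|\Phi-\mathrm{id}\|_\infty\le\varrho\tau$ and $E\cap B(0,\varrho)\subseteq\Phi(Z\cap B(0,2\varrho))\subseteq E\cap B(0,3\varrho)$. Fixing $\tau$, put $\mathfrak r=\varrho$. The cone $X=X(r)$. Let $d_{0,r}(A,B)=\frac1r\sup\{\mathrm{dist}(a,B):a\in A\cap B(0,r)\}+\frac1r\sup\{\mathrm{dist}(b,A):b\in B\cap B(0,r)\}$ and let $\varepsilon(r)$ be the infimum of $d_{0,r}(E,Z)$ over cones $Z$ of type $\mathbb P_+$ (resp. $\mathbb Y_+$). For $r\in(0,\mathfrak r)$ one chooses, for some $\varepsilon>\varepsilon(r)$ (arbitrarily close to $\varepsilon(r)$), a point $y_r\in E\cap\partial B_r\setminus L_0$ and a set $\mathcal X_r\subseteq E\cap L_0\cap\partial B_r$ of two (type $\mathbb P_+$) or three (type $\mathbb Y_+$) points, together with simple curves in $E\cap\partial B_r$ joining $y_r$ to the points of $\mathcal X_r$, pairwise disjoint except at $y_r$; in the $\mathbb P_+$ case $|y_r-(0,0,r)|\le\varepsilon r$ and the two points of $\mathcal X_r$ are at distance at least $(2-2\varepsilon)r$; in the $\mathbb Y_+$ case $|y_r-(0,0,r)|\le\pi r/6$ and the curves lie within $\varepsilon r$ of some cone of type $\mathbb Y_+$. $X(r)$ is the cone centered at $0$ which is the union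 over $x\in\mathcal X_r$ of the planar sectors with vertex $0$ spanned by $x$ and $y_r$. The constants. $\lambda,\mu\in(0,10^{-3})$ and $\mathfrak r_1\in(0,\mathfrak r)$ are constants (whose existence is established in the paper) such that for all $0<r<\mathfrak r_1$, $\mathcal H^2(E\cap B_r)\le(1-\mu-\lambda)\frac r2\mathcal H^1(E\cap\partial B_r)+\mu\frac{r^2}2\mathcal H^1(X(r)\cap\partial B_1)+\lambda\Theta(0)r^2+4r^2h(2r)$. *)

(* Defs.v *)
From mathcomp Require Import all_boot all_order all_algebra.
From mathcomp Require Import all_classical all_reals all_analysis.

Set Implicit Arguments.
Unset Strict Implicit.
Unset Printing Implicit Defensive.
Import Order.TTheory GRing.Theory Num.Theory.
Import numFieldNormedType.Exports.

Local Open Scope classical_set_scope.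
Local Open Scope ring_scope.

Section Euclidean.
Context {R : realType} {n : nat}.
Implicit Types (x y : 'rV[R]_n) (A B : set 'rV[R]_n) (r : R).

Definition dotp x y : R := \sum_i x ord0 i * y ord0 i.

(* The library norm on 'rV[R]_n is the sup norm (with the same topology); all
   metric notions below are Euclidean. *)
Definition enorm x : R := Num.sqrt (dotp x x).
Definition edist x y : R := enorm (x - y).

Definition eball x r : set 'rV[R]_n := [set y | edist x y < r].
Definition esphere x r : set 'rV[R]_n := [set y | edist x y = r].

Definition pt_dist x A : R := inf [set edist x a | a in A].

(* For a bounded set; by the conventions of [sup], the diameter of the empty
   set is 0. *)
Definition diam A : R := sup [set edist p.1 p.2 | p in A `*` A].

(* The sups and infs are finite, hence have their usual meaning, as soon as
   both sets contain 0, which is the only case used. *)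
Definition scaled_dist r A B : R :=
  r^-1 * sup [set pt_dist a B | a in A `&` eball 0 r] +
  r^-1 * sup [set pt_dist b A | b in B `&` eball 0 r].

End Euclidean.

Definition lipschitz_within {R : realType} {m n : nat} (A : set 'rV[R]_m)
    (f : 'rV[R]_m -> 'rV[R]_n) : Prop :=
  exists K : R, forall x y, A x -> A y -> edist (f x) (f y) <= K * edist x y.

Section Hausdorff.
Context {R : realType} {n : nat}.

(* Lebesgue measure of the unit ball of R^d. *)
Fixpoint unit_ball_volume (d : nat) : R :=
  match d with
  | 0 => 1
  | 1 => 2
  | d'.+2 => 2 * pi / d%:R * unit_ball_volume d'
  end.

Definition hausdorff_content (d : nat) (delta : R) (A : set 'rV[R]_n) :
    \bar R :=
  ereal_inf [set s | exists U : nat -> set 'rV[R]_n,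
    [/\ A `<=` \bigcup_k U k,
        forall k x y, U k x -> U k y -> edist x y <= delta &
        s = (\sum_(0 <= k <oo)
               (unit_ball_volume d * (diam (U k) / 2) ^+ d)%:E)%E]].

(* Normalized so that it is Lebesgue measure when d = n. Meant for d >= 1:
   when d = 0 the empty sets of a covering would be counted. *)
Definition hausdorff (d : nat) (A : set 'rV[R]_n) : \bar R :=
  ereal_sup [set hausdorff_content d delta A | delta in [set e : R | 0 < e]].

Definition rectifiable (d : nat) (E : set 'rV[R]_n) : Prop :=
  exists f : nat -> 'rV[R]_d -> 'rV[R]_n,
    (forall k, lipschitz_within setT (f k)) /\
    hausdorff d (E `\` \bigcup_k range (f k)) = 0%E.

End Hausdorff.

Section HalfSpace.
Context {R : realType}.
Local Notation V := 'rV[R]_3.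
Implicit Types (E Z : set V) (r : R).

Definition Omega0 : set V := [set x | 0 <= x ord0 ord_max].
Definition L0 : set V := [set x | x ord0 ord_max = 0].
Definition e3 : V := delta_mx ord0 ord_max.

(* Only the restriction of h to [0, +oo[ matters. *)
Definition gauge_function (h : R -> \bar R) : Prop :=
  [/\ forall t, 0 <= t -> (0 <= h t)%E,
      forall s t, 0 <= s -> s <= t -> (h s <= h t)%E &
      h t @[t --> 0^'+] --> 0%E].

Definition dini (h : R -> \bar R) : Prop :=
  exists2 rh : R, 0 < rh &
    (\int[lebesgue_measure]_(t in `]0%R, rh[) (h (2 * t)%R * (t^-1)%:E) < +oo)%E.

(* Only the values phi t x with 0 <= t <= 1 and x in E matter. *)
Definition sliding_deformation (E U : set V) (phi : R -> V -> V) : Prop :=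
  [/\ forall t x, `[0, 1]%classic t -> E x ->
        [/\ Omega0 (phi t x),
            ~ U x -> phi t x = x,
            U x -> U (phi t x) &
            L0 x -> L0 (phi t x)],
      {within `[0, 1]%classic `*` E, continuous (fun p => phi p.1 p.2)},
      lipschitz_within E (phi 1) &
      forall x, E x -> phi 0 x = x].

Definition locally_sliding_almost_minimal (h : R -> \bar R) (E : set V)
    (x : V) : Prop :=
  (forall z : V, exists2 r, 0 < r & (hausdorff 2 (E `&` eball z r) < +oo)%E) /\
  (forall r (phi : R -> V -> V), 0 < r ->
    sliding_deformation E (eball x r) phi ->
    (hausdorff 2 (E `&` eball x r) <=
     hausdorff 2 ((phi 1%R @` E) `&` eball x r) + h r * (r ^+ 2)%:E)%E).

Inductive cone_type := Pplus | Yplus.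

Definition Pplus_cone Z : Prop :=
  exists u : V, [/\ L0 u, enorm u = 1 &
    Z = [set x | exists s t : R, 0 <= t /\ x = s *: u + t *: e3]].

Definition Yplus_cone Z : Prop :=
  exists u : 'I_3 -> V,
    [/\ forall i, L0 (u i) /\ enorm (u i) = 1,
        forall i j, i != j -> dotp (u i) (u j) = cos (2 * pi / 3) &
        Z = Omega0 `&`
            \bigcup_i [set x | exists s t : R, 0 <= s /\ x = s *: u i + t *: e3]].

Definition cone_of_type (ct : cone_type) : set V -> Prop :=
  match ct with Pplus => Pplus_cone | Yplus => Yplus_cone end.

Definition homeo_onto_image (D : set V) (Phi : V -> V) : Prop :=
  {within D, continuous Phi} /\
  exists2 Psi : V -> V, {within Phi @` D, continuous Psi} &
    forall x, D x -> Psi (Phi x) = x.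

Definition C0_equivalent_at_scale (ct : cone_type) E (tau rho : R) : Prop :=
  exists (Z : set V) (Phi : V -> V),
    let D := Omega0 `&` eball 0 (2 * rho) in
    [/\ cone_of_type ct Z /\ homeo_onto_image D Phi,
        Phi 0 = 0,
        Phi @` (L0 `&` eball 0 (2 * rho)) `<=` L0,
        forall x, D x -> Omega0 (Phi x) /\ edist (Phi x) x <= rho * tau &
        E `&` eball 0 rho `<=` Phi @` (Z `&` eball 0 (2 * rho)) /\
        Phi @` (Z `&` eball 0 (2 * rho)) `<=` E `&` eball 0 (3 * rho)].

(* rho0 and tau0 witness that E is locally C^0-equivalent at 0 to a cone of
   type ct. *)
Definition C0_equivalent_below (ct : cone_type) E (rho0 tau0 : R) : Prop :=
  [/\ 0 < rho0, 0 < tau0 &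
      forall tau, 0 < tau < tau0 ->
        exists2 rho, 0 < rho < rho0 & C0_equivalent_at_scale ct E tau rho].

Definition locally_C0_equivalent (ct : cone_type) E : Prop :=
  exists rho0 tau0, C0_equivalent_below ct E rho0 tau0.

(* The scales rr that may be obtained by fixing tau in the definition of local
   C^0-equivalence. *)
Definition C0_scale (ct : cone_type) E (rr : R) : Prop :=
  exists rho0 tau0 tau,
    [/\ C0_equivalent_below ct E rho0 tau0, 0 < tau < tau0, 0 < rr < rho0 &
        C0_equivalent_at_scale ct E tau rr].

Definition cone_distance (ct : cone_type) E r : R :=
  inf [set scaled_dist r E Z | Z in cone_of_type ct].

(* gam x is the simple curve joining y to the point x of Xs. *)
Definition selection (ct : cone_type) E (eps r : R) (y : V) (Xs : set V) :
    Prop :=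
  let S := E `&` esphere 0 r in
  let I := `[0, 1]%classic : set R in
  [/\ S y /\ ~ L0 y,
      Xs `<=` S `&` L0,
      (Xs #= `I_(if ct is Pplus then 2 else 3))%card &
      exists gam : V -> R -> V,
        [/\ forall x, Xs x ->
              [/\ {within I, continuous (gam x)},
                  {in I &, injective (gam x)},
                  gam x 0 = y, gam x 1 = x & gam x @` I `<=` S],
            forall x x', Xs x -> Xs x' -> x <> x' ->
              (gam x @` I) `&` (gam x' @` I) = [set y] &
            match ct with
            | Pplus =>
                edist y (r *: e3) <= eps * r /\
                forall x x', Xs x -> Xs x' -> x <> x' ->
                  (2 - 2 * eps) * r <= edist x x'
            | Yplus =>
                edist y (r *: e3) <= pi * r / 6 /\
                exists2 Z, Yplus_cone Z &
                  forall x t, Xs x -> I t -> pt_dist (gam x t) Z <= eps * r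
            end]].

Definition sector_cone (y : V) (Xs : set V) : set V :=
  \bigcup_(x in Xs)
    [set z | exists s t : R, [/\ 0 <= s, 0 <= t & z = s *: x + t *: y]].

(* Density ratio at 0, for E of finite measure. *)
Definition Theta E (rho : R) : R :=
  fine (hausdorff 2 (E `&` eball 0 rho)) / rho ^+ 2.

Definition Theta0 E : R := lim (Theta E rho @[rho --> 0^'+]).

End HalfSpace.

(* Main.v *)
From HB Require Import structures.
From mathcomp Require Import all_boot all_order all_algebra.
From mathcomp Require Import all_classical all_reals all_analysis measurable_realfun.
From mathcomp Require Import ring lra zify.
Require Import Defs.

Set Implicit Arguments.
Unset Strict Implicit.
Unset Printing Implicit Defensive.
Import Order.TTheory GRing.Theory Num.Theory.
Import numFieldNormedType.Exports.

Local Open Scope classical_set_scope.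
Local Open Scope ring_scope.

(** Let f(r) be the area of E in the open ball of radius r ([mass]), T(r) = f(r)/r^2, and T0 the
    limit of T at 0.

    Upper bound for T - T0. The curves of E on the sphere of radius r that join y_r to the points of
    X_r meet only at y_r, and each is at least as long as the great circle arc with the same ends.
    Hence the length of X(r) on the unit sphere is at most H^1(E on the sphere)/r
    ([hausdorff_sector]). Put into the assumed inequality, this makes mu cancel: f(r) <= (1 -
    lambda) (r/2) H^1(E on the sphere) + lambda T0 r^2 + 4 r^2 h(2r). By the coarea inequality
    ([coarea_majorant], [coarea_slice]) the H^1 term is on average at most f', and in terms of T
    this reads r T' >= 2 lambda0 (T - T0) - C r^alpha. For beta < min(alpha, 2 lambda0) it follows
    that r^(-beta) max(0, T - T0) + C r^(alpha - beta) is nondecreasing ([ratio_decay]), hence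
    bounded by its value at r1/2.

    Lower bound. Collapsing a smaller ball to the origin and stretching a thin shell over it
    compares E with the cone over its slice; almost minimality then gives f <= (r/2) f' + r^2 h(r)
    ([cone_monotonicity]), so that T + C r^alpha is nondecreasing ([ratio_mono]). This yields both
    the existence of T0 and T0 - T(r) <= C r^alpha ([ratio_cvg]).

    Uniformity. The constant may not depend on E, so T must be bounded on [r1/2, r1] in terms of r1,
    alpha and C_h alone. [mass_bound] does this by pushing E onto the boundary of a half ball, from
    a point near which E has little area.

    Since f is only monotone, f' is never formed: differential inequalities become inequalities
    between s < t with an error of order (1 - s/t)^2, which vanishes when summed over finer and
    finer subdivisions ([mono_of_quadratic]).

    The geometric measure theory behind this is an area bound for radial maps
    ([hausdorff_radial_map]) and the coarea inequality. Both come from cutting a rectifiable set, up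
    to a null set, into small nearly planar pieces ([rectifiable_decomposition]). That in turn rests
    on the almost everywhere derivability of Lipschitz functions and on the comparison of H^2 with
    Lebesgue measure in the plane, by translation invariance and the isodiametric inequality. *)

(** * Euclidean geometry of row vectors *)

Section Euclid.
Context {R : realType} {n : nat}.
Implicit Types (x y z : 'rV[R]_n) (a b c : R).

Lemma dotpC x y : dotp x y = dotp y x.
Proof. by apply: eq_bigr => i _; rewrite mulrC. Qed.

Lemma dotpDl x y z : dotp (x + y) z = dotp x z + dotp y z.
Proof.
by rewrite /dotp -big_split; apply: eq_bigr => i _; rewrite mxE mulrDl.
Qed.

Lemma dotpZl a x y : dotp (a *: x) y = a * dotp x y.
Proof.
by rewrite /dotp mulr_sumr; apply: eq_bigr => i _; rewrite mxE mulrA.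
Qed.

Lemma dotpNl x y : dotp (- x) y = - dotp x y.
Proof. by rewrite -scaleN1r dotpZl mulN1r. Qed.

Lemma dotpBl x y z : dotp (x - y) z = dotp x z - dotp y z.
Proof. by rewrite dotpDl dotpNl. Qed.

Lemma dotpDr x y z : dotp x (y + z) = dotp x y + dotp x z.
Proof. by rewrite dotpC dotpDl !(dotpC x). Qed.

Lemma dotpZr a x y : dotp x (a *: y) = a * dotp x y.
Proof. by rewrite dotpC dotpZl (dotpC x). Qed.

Lemma dotpNr x y : dotp x (- y) = - dotp x y.
Proof. by rewrite dotpC dotpNl (dotpC x). Qed.

Lemma dotpBr x y z : dotp x (y - z) = dotp x y - dotp x z.
Proof. by rewrite dotpDr dotpNr. Qed.

Lemma dotp0l x : dotp 0 x = 0.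
Proof. by rewrite -(scale0r x) dotpZl mul0r. Qed.

Lemma dotp0r x : dotp x 0 = 0.
Proof. by rewrite dotpC dotp0l. Qed.

Definition dotpE := (dotpDl, dotpDr, dotpBl, dotpBr, dotpNl, dotpNr, dotpZl,
  dotpZr, dotp0l, dotp0r).

Lemma dotp_ge0 x : 0 <= dotp x x.
Proof. by apply: sumr_ge0 => i _; rewrite -expr2 sqr_ge0. Qed.

Lemma dotp_eq0 x : dotp x x = 0 -> x = 0.
Proof.
move=> /eqP; rewrite psumr_eq0 => [|i _]; last by rewrite -expr2 sqr_ge0.
move=> /allP h; apply/rowP => i; rewrite mxE.
by have := h i (mem_index_enum _); rewrite mulf_eq0 orbb => /eqP.
Qed.

Lemma enorm_ge0 x : 0 <= enorm x. Proof. exact: sqrtr_ge0. Qed.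

Lemma sqr_enorm x : enorm x ^+ 2 = dotp x x.
Proof. by rewrite sqr_sqrtr // dotp_ge0. Qed.

Lemma enorm0 : enorm (0 : 'rV[R]_n) = 0.
Proof. by rewrite /enorm dotp0l sqrtr0. Qed.

Lemma enorm_eq0 x : (enorm x == 0) = (x == 0).
Proof.
apply/eqP/eqP => [h|->]; last exact: enorm0.
by apply: dotp_eq0; rewrite -sqr_enorm h expr0n.
Qed.

Lemma enorm_gt0 x : (0 < enorm x) = (x != 0).
Proof. by rewrite lt_def enorm_ge0 andbT enorm_eq0. Qed.

Lemma CauchySchwarz x y : dotp x y ^+ 2 <= dotp x x * dotp y y.
Proof.
have [->|y0] := eqVneq y 0; first by rewrite !dotpE expr0n mulr0.
have yy : 0 < dotp y y by rewrite -sqr_enorm exprn_gt0 // enorm_gt0.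
have := dotp_ge0 (dotp y y *: x - dotp x y *: y).
rewrite !dotpE (dotpC y x) => h.
rewrite -subr_ge0 -(pmulr_rge0 _ yy); move: h; congr (0 <= _); ring.
Qed.

Lemma dotp_norm_le x y : `|dotp x y| <= enorm x * enorm y.
Proof.
rewrite -ler_sqr ?nnegrE ?mulr_ge0 ?enorm_ge0 //.
by rewrite real_normK ?num_real // exprMn !sqr_enorm CauchySchwarz.
Qed.

Lemma dotp_le x y : dotp x y <= enorm x * enorm y.
Proof. exact: le_trans (ler_norm _) (dotp_norm_le x y). Qed.

Lemma enormD x y : enorm (x + y) <= enorm x + enorm y.
Proof.
rewrite -ler_sqr ?nnegrE ?addr_ge0 ?enorm_ge0 //.
rewrite sqrrD !sqr_enorm !dotpE (dotpC y x).
by have := dotp_le x y; lra.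
Qed.

Lemma enormN x : enorm (- x) = enorm x.
Proof. by rewrite /enorm !dotpE opprK. Qed.

Lemma enormZ a x : enorm (a *: x) = `|a| * enorm x.
Proof.
by rewrite /enorm !dotpE mulrA -expr2 sqrtrM ?sqr_ge0 // sqrtr_sqr.
Qed.

Lemma enormB_ge x y : `|enorm x - enorm y| <= enorm (x - y).
Proof.
have := enormD (x - y) y; have := enormD (y - x) x.
rewrite !subrK -(opprB x y) enormN => h1 h2.
by rewrite ler_norml; apply/andP; split; lra.
Qed.

Lemma edistC x y : edist x y = edist y x.
Proof. by rewrite /edist -enormN opprB. Qed.

Lemma edist_ge0 x y : 0 <= edist x y. Proof. exact: enorm_ge0. Qed.

Lemma edistxx x : edist x x = 0.
Proof. by rewrite /edist subrr enorm0. Qed.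

Lemma edist_triangle y x z : edist x z <= edist x y + edist y z.
Proof.
by rewrite /edist (_ : x - z = (x - y) + (y - z)) ?enormD // addrA subrK.
Qed.

Lemma edist_eq0 x y : edist x y = 0 -> x = y.
Proof. by move=> /eqP; rewrite enorm_eq0 subr_eq0 => /eqP. Qed.

Lemma edist_enorm x y : edist x y = enorm (x - y). Proof. by []. Qed.

Lemma edist0l x : edist 0 x = enorm x.
Proof. by rewrite /edist sub0r enormN. Qed.

Lemma enorm_lip x y : `|enorm x - enorm y| <= edist x y.
Proof. exact: enormB_ge. Qed.

Lemma coord_le_enorm x i : `|x ord0 i| <= enorm x.
Proof.
rewrite -(sqrtr_sqr (x ord0 i)) ler_sqrt ?dotp_ge0 // /dotp (bigD1 i) //= -expr2.
by rewrite lerDl sumr_ge0 // => j _; rewrite -expr2 sqr_ge0.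
Qed.

Lemma enorm_le_sum x : enorm x <= \sum_i `|x ord0 i|.
Proof.
rewrite -ler_sqr ?nnegrE ?enorm_ge0 ?sumr_ge0 // sqr_enorm expr2 /dotp mulr_suml.
apply: ler_sum => i _.
apply: (@le_trans _ _ (`|x ord0 i| * `|x ord0 i|)).
  by rewrite -normrM ler_norm.
apply: ler_wpM2l => //; rewrite (bigD1 i) //= lerDl; exact: sumr_ge0.
Qed.

Lemma sqr_enormD x y :
  enorm (x + y) ^+ 2 = enorm x ^+ 2 + 2 * dotp x y + enorm y ^+ 2.
Proof. by rewrite !sqr_enorm !dotpE (dotpC y x); ring. Qed.

Lemma sqr_enormB x y :
  enorm (x - y) ^+ 2 = enorm x ^+ 2 - 2 * dotp x y + enorm y ^+ 2.
Proof. by rewrite !sqr_enorm !dotpE (dotpC y x); ring. Qed.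

(** The library topology comes from the sup norm, which [coord_le_enorm] and [enorm_le_sum] show
    equivalent to the Euclidean one; from here on neighbourhoods are handled with Euclidean
    balls. *)
Lemma nbhs_eball x (A : set 'rV[R]_n) :
  nbhs x A <-> exists2 e, 0 < e & eball x e `<=` A.
Proof.
split.
- move=> /nbhs_ballP[e /= e0 h]; exists e => // y xy; apply: h; split => // i j.
  rewrite (ord1 i) -ball_normE /ball_ /=; apply: le_lt_trans xy.
  by have := coord_le_enorm (x - y) j; rewrite !mxE.
(* Dividing by n + 1 instead of n makes the sum of n coordinate bounds strictly less than e, and
   covers n = 0. *)
- move=> [e e0 h]; apply/nbhs_ballP; exists (e / n.+1%:R) => /=.
    by rewrite divr_gt0 // ltr0n.
  move=> y [_ xy]; apply: h; rewrite /eball /=.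
  apply: (le_lt_trans (enorm_le_sum _)).
  apply: (@le_lt_trans _ _ (\sum_(i < n) e / n.+1%:R)).
    apply: ler_sum => i _; have := xy ord0 i.
    by rewrite -ball_normE /ball_ /= !mxE => /ltW.
  rewrite sumr_const card_ord -[_ *+ _]mulr_natl mulrCA -[ltRHS]mulr1 ltr_pM2l //.
  by rewrite ltr_pdivrMr ?ltr0n // mul1r ltr_nat.
Qed.

End Euclid.

Lemma edistBB {R : realType} {n : nat} (x y z : 'rV[R]_n) :
  edist (x - z) (y - z) = edist x y.
Proof. by rewrite /edist opprB addrA subrK. Qed.

Lemma edistDD {R : realType} {n : nat} (x y z : 'rV[R]_n) :
  edist (x + z) (y + z) = edist x y.
Proof. by rewrite /edist opprD addrACA subrr addr0. Qed.

Lemma edistZZ {R : realType} {n : nat} a (x y : 'rV[R]_n) :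
  edist (a *: x) (a *: y) = `|a| * edist x y.
Proof. by rewrite /edist -scalerBr enormZ. Qed.

Lemma unit_ball_volume_gt0 {R : realType} d : 0 < unit_ball_volume d :> R.
Proof.
suff : (0 < unit_ball_volume d :> R) /\ (0 < unit_ball_volume d.+1 :> R) by case.
elim: d => [|d [h1 h2]] //; split => //.
by rewrite [unit_ball_volume _]/= mulr_gt0 // divr_gt0 ?mulr_gt0 ?pi_gt0 ?ltr0n.
Qed.

Lemma unit_ball_volume_ge0 {R : realType} d : 0 <= unit_ball_volume d :> R.
Proof. exact/ltW/unit_ball_volume_gt0. Qed.

(** * Hausdorff contents and Hausdorff measures *)

Section Diam.
Context {R : realType} {n : nat}.
Implicit Types (x y : 'rV[R]_n) (A B : set 'rV[R]_n).

(** [diam] is a [sup], whose value on an unbounded set is a default; a bound on the distances is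
    therefore carried along separately. *)
Definition diam_bounded A c := forall x y, A x -> A y -> edist x y <= c.

Lemma diam_le A c : 0 <= c -> diam_bounded A c -> diam A <= c.
Proof.
move=> c0 Ac; rewrite /diam.
have [->|/set0P ne] := eqVneq [set edist p.1 p.2 | p in A `*` A] set0.
  by rewrite sup0.
by apply: ge_sup => // _ [[x y] [/= Ax Ay] <-]; exact: Ac.
Qed.

Lemma le_diam A c x y : diam_bounded A c -> A x -> A y -> edist x y <= diam A.
Proof.
move=> Ac Ax Ay; apply: ub_le_sup; last by exists (x, y).
by exists c => _ [[x' y'] [/= Ax' Ay'] <-]; exact: Ac.
Qed.

Lemma diam_ge0 A : 0 <= diam A.
Proof.
rewrite /diam.
have [[h1 [c h2]]|h] := pselect (has_sup [set edist p.1 p.2 | p in A `*` A]).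
  case: h1 => z [p Ap _]; apply: le_trans (edist_ge0 p.1 p.2) _.
  by apply: ub_le_sup; [exists c|exists p].
by rewrite sup_out.
Qed.

Lemma diam_set0 : diam (set0 : set 'rV[R]_n) = 0.
Proof. by apply/eqP; rewrite eq_le diam_ge0 andbT; apply: diam_le. Qed.

Lemma diamS A B c : diam_bounded B c -> A `<=` B -> diam A <= diam B.
Proof.
move=> Bc AB; apply: diam_le; first exact: diam_ge0.
by move=> x y Ax Ay; apply: le_diam Bc _ _; exact: AB.
Qed.

End Diam.

Section Content.
Context {R : realType} {n : nat}.
Local Notation V := 'rV[R]_n.
Implicit Types (x y : V) (A B : set V) (d : nat) (delta : R).

Definition ball_volume d A : R := unit_ball_volume d * (diam A / 2) ^+ d.

Lemma ball_volume_ge0 d A : 0 <= ball_volume d A.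
Proof.
by rewrite mulr_ge0 ?unit_ball_volume_ge0 // exprn_ge0 // divr_ge0 // diam_ge0.
Qed.

Lemma ball_volume_set0 d : ball_volume d.+1 set0 = 0.
Proof. by rewrite /ball_volume diam_set0 mul0r expr0n mulr0. Qed.

Definition delta_cover delta A (U : nat -> set V) :=
  A `<=` \bigcup_k U k /\ forall k, diam_bounded (U k) delta.

Lemma content_le d delta A U : delta_cover delta A U ->
  (hausdorff_content d delta A <= \sum_(0 <= k <oo) (ball_volume d (U k))%:E)%E.
Proof. by move=> [AU Ud]; apply: ereal_inf_lbound; exists U; split. Qed.

Lemma content_ge d delta A m :
  (forall U, delta_cover delta A U ->
    (m <= \sum_(0 <= k <oo) (ball_volume d (U k))%:E)%E) ->
  (m <= hausdorff_content d delta A)%E.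
Proof.
move=> h; apply: le_ereal_inf_tmp => _ [U [AU Ud ->]].
by apply: h; split => // k; exact: Ud.
Qed.

(* The content is the outer measure generated by [gauge_cost] on all subsets,
   so the library's [mu_ext] supplies countable subadditivity. *)
Definition gauge_cost d delta (A : set V) : \bar R :=
  if `[< diam_bounded A delta >] then (ball_volume d A)%:E else +oo%E.

Definition all_sets := g_sigma_algebraType [set: set V].

Lemma measurable_all_sets (A : set V) : measurable (A : set all_sets).
Proof. exact: sub_sigma_algebra. Qed.

Lemma gauge_cost_ge0 d delta (A : set V) : (0 <= gauge_cost d delta A)%E.
Proof.
by rewrite /gauge_cost; case: ifPn => // _; rewrite lee_fin ball_volume_ge0.
Qed.

Lemma contentE d delta A : hausdorff_content d delta A =
  mu_ext (gauge_cost d delta : set all_sets -> \bar R) A.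
Proof.
apply/eqP; rewrite eq_le; apply/andP; split.
- apply: le_ereal_inf_tmp => _ [U [_ AU] <-].
  have [h|] := pselect (forall k, diam_bounded (U k) delta); last first.
    move=> /existsNP[k nk]; rewrite (@eseries_pinfty _ _ _ k) ?leey //.
      by move=> j _; rewrite gt_eqF // (lt_le_trans _ (gauge_cost_ge0 _ _ _)).
    by rewrite /gauge_cost asboolF.
  apply: (le_trans (content_le d (conj AU h))).
  apply: lee_nneseries => [k _ _|k _]; first by rewrite lee_fin ball_volume_ge0.
  by rewrite /gauge_cost asboolT.
- apply: content_ge => U [AU Ud]; apply: ereal_inf_lbound; exists U.
    by split => // k; exact: measurable_all_sets.
  by apply: eq_eseriesr => k _; rewrite /gauge_cost asboolT.
Qed.

Lemma content_ge0 d delta A : (0 <= hausdorff_content d delta A)%E.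
Proof. by rewrite contentE; apply: mu_ext_ge0 => U; exact: gauge_cost_ge0. Qed.

Lemma contentS d delta A B : A `<=` B ->
  (hausdorff_content d delta A <= hausdorff_content d delta B)%E.
Proof. by move=> AB; rewrite !contentE; exact: le_mu_ext. Qed.

Lemma content_subadd d delta (F : (set V)^nat) :
  (hausdorff_content d delta (\bigcup_k F k) <=
   \sum_(0 <= k <oo) hausdorff_content d delta (F k))%E.
Proof.
rewrite contentE; under eq_eseriesr do rewrite contentE.
by apply: mu_ext_sigma_subadditive => U; exact: gauge_cost_ge0.
Qed.

Lemma content_set0 d delta : 0 <= delta ->
  hausdorff_content d.+1 delta (set0 : set V) = 0%E.
Proof.
move=> d0; apply/eqP; rewrite eq_le content_ge0 andbT.
apply: (le_trans (@content_le _ _ _ (fun=> set0) _)).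
  by split => // k x y [].
by rewrite eseries0 // => k _ _; rewrite ball_volume_set0.
Qed.

Lemma content_antitone d delta delta' A : delta <= delta' ->
  (hausdorff_content d delta' A <= hausdorff_content d delta A)%E.
Proof.
move=> dd; apply: content_ge => U [AU Ud]; apply: content_le; split => // k x y Ux Uy.
exact: le_trans (Ud k x y Ux Uy) dd.
Qed.

Lemma content_le_hausdorff d delta A : 0 < delta ->
  (hausdorff_content d delta A <= hausdorff d A)%E.
Proof. by move=> d0; apply: ereal_sup_ubound; exists delta. Qed.

Lemma hausdorff_le d A m :
  (forall delta, 0 < delta -> (hausdorff_content d delta A <= m)%E) ->
  (hausdorff d A <= m)%E.
Proof. by move=> h; apply: ge_ereal_sup => _ [delta d0 <-]; exact: h. Qed.

Lemma hausdorff_set0 d : hausdorff d.+1 (set0 : set V) = 0%E.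
Proof.
apply/eqP; rewrite eq_le; apply/andP; split.
  by apply: hausdorff_le => delta d0; rewrite content_set0 // ltW.
exact: le_trans (content_ge0 _ 1 _) (content_le_hausdorff _ _ ltr01).
Qed.

Lemma hausdorff_ge0 d A : (0 <= hausdorff d A)%E.
Proof. exact: le_trans (content_ge0 _ 1 _) (content_le_hausdorff _ _ ltr01). Qed.

Lemma hausdorffS d A B : A `<=` B -> (hausdorff d A <= hausdorff d B)%E.
Proof.
move=> AB; apply: hausdorff_le => delta d0.
exact: le_trans (contentS _ _ AB) (content_le_hausdorff _ _ d0).
Qed.

Lemma hausdorff_subadd d (F : (set V)^nat) :
  (hausdorff d (\bigcup_k F k) <= \sum_(0 <= k <oo) hausdorff d (F k))%E.
Proof.
apply: hausdorff_le => delta d0; apply: (le_trans (content_subadd _ _ _)).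
apply: lee_nneseries => [k _ _|k _]; first exact: content_ge0.
exact: content_le_hausdorff.
Qed.

HB.instance Definition _ d := isOuterMeasure.Build R V (@hausdorff R n d.+1)
  (hausdorff_set0 d) (@hausdorff_ge0 d.+1) (@hausdorffS d.+1)
  (@hausdorff_subadd d.+1).

End Content.

Lemma ball_volume_le {R : realType} {n m : nat} d (A : set 'rV[R]_n)
    (B : set 'rV[R]_m) c : 0 <= c -> diam A <= c * diam B ->
  ball_volume d A <= c ^+ d * ball_volume d B.
Proof.
move=> c0 h; rewrite /ball_volume mulrCA -exprMn.
rewrite ler_wpM2l ?unit_ball_volume_ge0 //.
rewrite lerXn2r ?nnegrE ?mulr_ge0 ?diam_ge0 ?invr_ge0 //.
by rewrite mulrA ler_wpM2r // invr_ge0.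
Qed.

(** A covering of g(A) by sets U_k pulls back to the covering of f(A) by f(A [&] g^-1(U_k)), whose
    diameters are at most c times larger. With two maps from a common index type, no map from g(A)
    to f(A) has to be written down. *)
Lemma hausdorff_map {R : realType} {n m : nat} {T : Type} d (c : R) (A : set T)
    (f : T -> 'rV[R]_n) (g : T -> 'rV[R]_m) : 0 < c ->
  (forall x y, A x -> A y -> edist (f x) (f y) <= c * edist (g x) (g y)) ->
  (hausdorff d.+1 (f @` A) <= (c ^+ d.+1)%:E * hausdorff d.+1 (g @` A))%E.
Proof.
move=> c0 fg; apply: hausdorff_le => delta d0.
have cd0 : 0 < c ^+ d.+1 by exact: exprn_gt0.
apply: (@le_trans _ _ ((c ^+ d.+1)%:E * hausdorff_content d.+1 (delta / c) (g @` A))%E);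
  last first.
  by rewrite lee_pmul2l ?lte_fin // content_le_hausdorff // divr_gt0.
rewrite -lee_pdivrMl //; apply: content_ge => U [AU Ud]; rewrite lee_pdivrMl //.
pose W k : set _ := f @` (A `&` g @^-1` U k).
have WU k x y : W k x -> W k y -> edist x y <= c * diam (U k).
  move=> [a [Aa Ua] <-] [b [Ab Ub] <-]; apply: le_trans (fg _ _ Aa Ab) _.
  by rewrite ler_pM2l //; apply: le_diam (Ud k) _ _.
apply: (le_trans (@content_le _ _ _ _ _ W _)).
  split.
    move=> _ [a Aa <-]; have [k _ Uk] := AU _ (imageP g Aa).
    by exists k => //; exists a.
  move=> k x y Wx Wy; apply: le_trans (WU k x y Wx Wy) _.
  rewrite mulrC -ler_pdivlMr //; apply: diam_le; last exact: Ud.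
  by rewrite divr_ge0 ?ltW.
rewrite -nneseriesZl //; last by move=> k _; rewrite lee_fin ball_volume_ge0.
apply: lee_nneseries => [k _ _|k _]; first by rewrite lee_fin ball_volume_ge0.
rewrite -EFinM lee_fin ball_volume_le ?(ltW c0) //.
by apply: diam_le; [rewrite mulr_ge0 ?(ltW c0) ?diam_ge0|exact: WU].
Qed.

Section PointDistance.
Context {R : realType} {n : nat}.
Implicit Types (x y : 'rV[R]_n) (A : set 'rV[R]_n).

Let dist_lb x A : has_lbound [set edist x a | a in A].
Proof. by exists 0 => _ [a _ <-]; exact: edist_ge0. Qed.

Lemma pt_dist_le x A a : A a -> pt_dist x A <= edist x a.
Proof. by move=> Aa; apply: ge_inf; [exact: dist_lb|exists a]. Qed.

Lemma pt_dist_lt x A e : A !=set0 -> pt_dist x A < e ->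
  exists2 a, A a & edist x a < e.
Proof.
move=> [a0 Aa0] h.
have ne : [set edist x a | a in A] !=set0 by exists (edist x a0), a0.
by have [_ [a Aa <-] ae] := inf_lt ne h; exists a.
Qed.

Lemma pt_dist_lip x y A : A !=set0 -> `|pt_dist x A - pt_dist y A| <= edist x y.
Proof.
move=> A0; wlog h : x y / pt_dist y A <= pt_dist x A.
  move=> w; have [h|/ltW h] := leP (pt_dist y A) (pt_dist x A); first exact: w.
  by rewrite distrC edistC; exact: w.
rewrite ger0_norm ?subr_ge0 //; apply/ler_addgt0Pl => e e0; rewrite lerBlDr.
have [|a Aa ae] := @pt_dist_lt y A (pt_dist y A + e) A0; first by rewrite ltrDl.
have := pt_dist_le x Aa; have := edist_triangle y x a; lra.
Qed.

Lemma pt_dist_closed A x : closed A -> A !=set0 -> pt_dist x A <= 0 -> A x.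
Proof.
move=> cA A0 h; apply: cA => B /nbhs_eball[e e0 eB].
have [|a Aa ae] := @pt_dist_lt x A e A0; first exact: le_lt_trans h e0.
by exists a; split => //; apply: eB.
Qed.

End PointDistance.

(** * Carathéodory measurability for Hausdorff measures *)

Section Caratheodory.
Context {R : realType} {n : nat}.
Local Notation V := 'rV[R]_n.
Implicit Types (x y : V) (A B X : set V) (d : nat).

(** A covering set of diameter less than s cannot meet both A and B, so a fine covering of the union
    splits into a covering of A and one of B. *)
Lemma hausdorff_separated d A B (s : R) : 0 < s ->
  (forall x y, A x -> B y -> s <= edist x y) ->
  (hausdorff d.+1 A + hausdorff d.+1 B <= hausdorff d.+1 (A `|` B))%E.
Proof.
move=> s0 AB; set M := hausdorff d.+1 (A `|` B).
have [->|Mfin] := eqVneq M +oo%E; first exact: leey.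
have Mf : M \is a fin_num by rewrite ge0_fin_numE ?hausdorff_ge0 // ltey.
have h1 (delta : R) : 0 < delta -> delta < s -> (hausdorff_content d.+1 delta A +
    hausdorff_content d.+1 delta B <= M)%E.
  move=> d0 ds; apply: le_trans _ (content_le_hausdorff _ _ d0).
  apply: content_ge => U [ABU Ud].
  pose W (C : set V) k := if `[< U k `&` C !=set0 >] then U k else set0.
  have covW C : C `<=` A `|` B -> delta_cover delta C (W C).
    move=> CAB; split.
      move=> x Cx; have [k _ Uk] := ABU x (CAB x Cx); exists k => //.
      by rewrite /W asboolT //; exists x.
    by move=> k x y; rewrite /W; case: ifPn => // _; exact: Ud.
  apply: (le_trans (leeD (content_le _ (covW A _)) (content_le _ (covW B _)))).
  - by move=> x; left.
  - by move=> x; right.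
  rewrite -nneseriesD; try by move=> k _ _; rewrite lee_fin ball_volume_ge0.
  apply: lee_nneseries => [k _ _|k _].
    by rewrite -EFinD lee_fin addr_ge0 // ball_volume_ge0.
  rewrite -EFinD lee_fin /W.
  case: ifPn => [/asboolP[a [Ua Aa]]|_]; case: ifPn => [/asboolP[b [Ub Bb]]|_];
    rewrite ?ball_volume_set0 ?addr0 ?add0r ?ball_volume_ge0 //.
  by have := AB a b Aa Bb; have := Ud k a b Ua Ub; lra.
(* The two scales are decoupled so that the suprema over them can be taken one after the other. *)
have h2 (d1 d2 : R) : 0 < d1 -> 0 < d2 -> (hausdorff_content d.+1 d1 A +
    hausdorff_content d.+1 d2 B <= M)%E.
  move=> d10 d20; pose e := Num.min (Num.min d1 d2) (s / 2).
  have e0 : 0 < e by rewrite !lt_min d10 d20 divr_gt0.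
  have es : e < s by rewrite gt_min; apply/orP; right; lra.
  apply: le_trans (h1 e e0 es); apply: leeD; apply: content_antitone.
    by rewrite !ge_min lexx.
  by rewrite !ge_min lexx orbT.
have fB (d2 : R) : 0 < d2 -> hausdorff_content d.+1 d2 B \is a fin_num.
  move=> d20; rewrite ge0_fin_numE ?content_ge0 //.
  apply: le_lt_trans (_ : M < +oo)%E; last by rewrite ltey.
  by apply: le_trans (h2 1 d2 ltr01 d20); rewrite leeDr // content_ge0.
have fA : hausdorff d.+1 A \is a fin_num.
  rewrite ge0_fin_numE ?hausdorff_ge0 //.
  by apply: (@le_lt_trans _ _ M); [apply: hausdorffS => x; left|rewrite ltey].
rewrite addeC -leeBrDr //; apply: hausdorff_le => d2 d20; rewrite leeBrDr //.
rewrite addeC -leeBrDr ?fB //; apply: hausdorff_le => d1 d10.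
by rewrite leeBrDr ?fB //; exact: h2.
Qed.

(** Carathéodory's criterion for metric outer measures. The part of X where u > c is exhausted by
    sets at positive distance from the sublevel set; what is left is a union of thin bands, whose
    measures form a convergent series with tails tending to 0. *)
Lemma caratheodory_lip_sublevel d (u : V -> R) (c : R) :
  (forall x y, `|u x - u y| <= edist x y) ->
  (hausdorff d.+1).-caratheodory [set x | u x <= c].
Proof.
move=> lu; apply: le_caratheodory_measurable => X.
pose H := @hausdorff R n d.+1.
suff : (H (X `&` [set x | (u x <= c)%R]) + H (X `&` ~` [set x | (u x <= c)%R]) <= H X)%E by [].
have [->|Mfin] := eqVneq (H X) +oo%E; first exact: leey.
have HXX' Y : (H (X `&` Y) <= H X)%E by apply: hausdorffS => x [].
have Hfin Y : H (X `&` Y) \is a fin_num.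
  by rewrite ge0_fin_numE ?hausdorff_ge0 // (le_lt_trans (HXX' Y)) // ltey.
pose r (j : nat) : R := c + j.+1%:R^-1.
have rS j : r j.+1 < r j by rewrite ltrD2l ltf_pV2 ?posrE ?ltr0n // ltr_nat.
have rc j : c < r j by rewrite ltrDl invr_gt0 ltr0n.
have r_anti i j : (i <= j)%N -> r j <= r i.
  by move=> ij; rewrite lerD2l lef_pV2 ?posrE ?ltr0n // ler_nat ltnS.
pose T j := [set x | r j < u x].
(* The band [S j] is separated from [T j] by the gap between [r j.+1] and [r j], so bands of equal
   parity can be added one at a time by [hausdorff_separated]. *)
pose S j := [set x | r j.+2 < u x <= r j.+1].
have sep Y Z (s t : R) : s < t -> (forall x, Y x -> u x <= s) -> (forall x, Z x -> t < u x) ->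
    (H (X `&` Y) + H (X `&` Z) <= H (X `&` (Y `|` Z)))%E.
  move=> st Ys Zt; rewrite setIUr; apply: (@hausdorff_separated _ _ _ (t - s)).
    by rewrite subr_gt0.
  move=> x y [_ /Ys xs] [_ /Zt ty]; apply: le_trans (lu x y).
  by rewrite distrC; apply: le_trans (ler_norm _); lra.
have part k N : (\sum_(i < N) H (X `&` S (2 * i + k)%N) <= H (X `&` T (2 * N + k)%N))%E.
  elim: N => [|N IH]; first by rewrite big_ord0 hausdorff_ge0.
  rewrite big_ord_recr /=; apply: (le_trans (leeD IH (lexx _))).
  rewrite addeC; apply: (@le_trans _ _ (H (X `&` (S (2 * N + k)%N `|` T (2 * N + k)%N)))).
    apply: sep (rS (2 * N + k)%N) _ _ => x //.
    by case/andP.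
  apply: hausdorffS => x [Xx [/andP[h1 h2]|h]]; split => //.
    by apply: le_lt_trans h1; apply: r_anti; lia.
  by apply: le_lt_trans h; apply: r_anti; lia.
have ser : (\sum_(0 <= i <oo) H (X `&` S i) < +oo)%E.
  apply: (@le_lt_trans _ _ (H X + H X)%E); last first.
    by rewrite lte_add_pinfty // ltey.
  apply: lime_le.
    by apply: is_cvg_nneseries => i _ _; exact: hausdorff_ge0.
  near=> N; apply: (@le_trans _ _ (\sum_(0 <= i < N + N) H (X `&` S i))%E).
    rewrite [leRHS](big_cat_nat _ _ (n := N)) ?leq0n ?leq_addr //= leeDl //.
    by apply: sume_ge0 => i _; exact: hausdorff_ge0.
  have -> : (\sum_(0 <= i < N + N) H (X `&` S i) =
      \sum_(i < N) H (X `&` S (2 * i + 0)%N) + \sum_(i < N) H (X `&` S (2 * i + 1)%N))%E.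
    elim: (N) => [|m IH]; first by rewrite !big_ord0 big_nil adde0.
    rewrite addSn addnS !big_nat_recr //= IH !big_ord_recr /=.
    have -> : (2 * m + 0 = m + m)%N by lia.
    have -> : (2 * m + 1 = (m + m).+1)%N by lia.
    rewrite -!addeA; congr (_ + _)%E; rewrite addeCA; congr (_ + _)%E.
  by apply: leeD; apply: le_trans (part _ _) (HXX' _).
have tail := nneseries_tail_cvg ser (fun i _ => hausdorff_ge0 _ _).
have cv : (H X + \sum_(j <= i <oo) H (X `&` S i))%E @[j --> \oo] --> (H X + 0)%E.
  by apply: cvgeD => //; [rewrite fin_num_adde_defl|exact: cvg_cst].
rewrite -[leRHS]adde0 -(cvg_lim _ cv) //; apply: lime_ge; first exact: cvgP cv.
near=> j.
have TE : ~` [set x | u x <= c] `<=` T j.+1 `|` \bigcup_(i in ~` `I_j) S i.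
  move=> x /= /negP; rewrite -ltNge => cx.
  have [|nT] := pselect (T j.+1 x); [by left|right].
  have exk : exists k, r k < u x by exact: ltr_add_invr.
  case: (ex_minnP exk) => k ku kmin.
  have jk : (j.+1 < k)%N.
    by rewrite ltnNge; apply/negP => kj; apply: nT; apply: le_lt_trans ku; exact: r_anti.
  case: k ku kmin jk => [|[|k]] // ku kmin jk.
  exists k; first by apply/negP; rewrite -leqNgt.
  rewrite /S /= ku /= leNgt; apply/negP => /kmin; by rewrite ltnn.
apply: (@le_trans _ _ (H (X `&` [set x | (u x <= c)%R]) +
    (H (X `&` T j.+1) + H (X `&` \bigcup_(i in ~` `I_j) S i)))%E).
  rewrite leeD2l //; apply: le_trans (outer_measureU2 _ _ _).
  by rewrite -setIUr; apply: hausdorffS; exact: setIS.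
rewrite addeA; apply: leeD.
  apply: le_trans (sep _ _ c (r j.+1) (rc _) _ _) _ => //.
rewrite setI_bigcupr; exact: outer_measure_sigma_subadditive_tail.
Unshelve. all: by end_near. Qed.

End Caratheodory.

(** * Translation-invariant measures on the plane *)

(** Cauchy's functional equation: nonnegativity and additivity give monotonicity, and squeezing N s
    between consecutive integers bounds N |g s - s g 1| by g 1 for every N. *)
Lemma additive_linear {R : realType} (g : R -> R) :
  (forall s, 0 <= s -> 0 <= g s) ->
  (forall s t, 0 <= s -> 0 <= t -> g (s + t) = g s + g t) ->
  forall s, 0 <= s -> g s = s * g 1.
Proof.
move=> g0 gD s s0.
have gm x y : 0 <= x -> x <= y -> g x <= g y.
  move=> x0 xy; rewrite -(subrK x y) gD ?subr_ge0 // lerDr g0 // subr_ge0.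
  by [].
have g00 : g 0 = 0 by have := gD 0 0 (lexx _) (lexx _); rewrite addr0; lra.
have gn n x : 0 <= x -> g (n%:R * x) = n%:R * g x.
  move=> x0; elim: n => [|n IH]; first by rewrite !mul0r.
  by rewrite -natr1 !mulrDl !mul1r gD ?IH // mulr_ge0.
have key N : N%:R * `|g s - s * g 1| <= g 1.
  pose k := Num.truncn (N%:R * s).
  have Ns : 0 <= N%:R * s by rewrite mulr_ge0.
  have /andP[k1 k2] : k%:R <= N%:R * s < k.+1%:R by exact: truncn_itv.
  have h1 : k%:R * g 1 <= N%:R * g s.
    by rewrite -!gn // mulr1; exact: gm.
  have h2 : N%:R * g s <= k.+1%:R * g 1.
    by rewrite -!gn // mulr1; apply: gm => //; exact: ltW.
  have g1 : 0 <= g 1 by exact: g0.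
  have h3 := ler_wpM2r g1 k1; have h4 := ler_wpM2r g1 (ltW k2).
  rewrite -[N%:R]ger0_norm // -normrM mulrBr mulrA ler_norml.
  by move: h2 h4; rewrite -natr1 mulrDl mul1r => h2 h4; apply/andP; split; lra.
apply/eqP; rewrite -subr_eq0 -normr_eq0; apply/eqP.
have [//|ne] := eqVneq `|g s - s * g 1| 0.
have p : 0 < `|g s - s * g 1| by rewrite lt_def ne normr_ge0.
have := key (Num.truncn (g 1 / `|g s - s * g 1|)).+1.
rewrite -ler_pdivlMr // => h.
by have := truncnS_gt (g 1 / `|g s - s * g 1|); rewrite ltNge h.
Qed.

Ltac rlra :=
  repeat match goal with H : @eq (extended _) _ _ |- _ => clear H end; lra.

Section Plane.
Context {R : realType}.
Local Notation MR := (measurableTypeR R).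
Local Notation RR := (MR * MR)%type.
Local Notation leb := (@lebesgue_measure R).

Definition rect (a b c d : R) : set RR := `]a, b]%classic `*` `]c, d]%classic.

Lemma rectP a b c d x y :
  rect a b c d (x, y) <-> (a < x <= b) && (c < y <= d).
Proof. by rewrite /rect /= !in_itv /=; split => [[-> ->]|/andP]. Qed.

Definition rects : set (set RR) :=
  [set A | exists a b c d, A = rect a b c d].

Lemma measurable_rect a b c d : measurable (rect a b c d).
Proof. by apply: measurableX; exact: measurable_itv. Qed.

(** With [rectsI], this makes half-open rectangles a generating family to which uniqueness of
    measures applies. Strips over half-open intervals are countable unions of rectangles, and a
    product set is the intersection of two strips. *)
Lemma measurable_rects : @measurable _ RR = <<s rects >>.
Proof.
rewrite eqEsubset; split; last first.
  apply: smallest_sub; first exact: sigma_algebra_measurable.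
  by move=> _ [a [b [c [d ->]]]]; exact: measurable_rect.
have strip : \bigcup_n `](- n%:R : R), n%:R]%classic = setT.
  apply/seteqP; split => // x _; exists (Num.truncn `|x|).+1 => //=.
  have := truncnS_gt `|x|; rewrite ltr_norml in_itv /= => /andP[-> h].
  exact: ltW.
have mfst (A : set MR) : measurable A -> <<s rects >> (A `*` setT).
  move=> mA.
  have : <<s @ocitv R >> `<=` [set A : set MR | <<s rects >> (A `*` setT)].
    apply: smallest_sub.
      split => /=.
      - rewrite set0X; exact: sigma_algebra0.
      - move=> B hB; rewrite setTD.
        have -> : ~` B `*` [set: MR] = setT `\` (B `*` setT).
          by apply/seteqP; split => [[x y] [/= ? _]|[x y] [_ /= h]]; split => //;
            [move=> [/= ? _]|move=> ?; apply: h].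
        exact: sigma_algebraCD.
      - move=> F hF.
        have -> : \bigcup_k F k `*` [set: MR] = \bigcup_k (F k `*` setT).
          by apply/seteqP; split => [[x y] [[k _ ?] _]|[x y] [k _ [/= ? _]]];
            [exists k|split => //; exists k].
        exact: sigma_algebra_bigcup.
    move=> _ [[a b] _ <-] /=; rewrite -strip.
    have -> : `]a, b]%classic `*` (\bigcup_n `](- n%:R : R), n%:R]%classic) =
        \bigcup_n rect a b (- n%:R) n%:R.
      by apply/seteqP; split => [[x y] [? [k _ ?]]|[x y] [k _ [/= ? ?]]];
        [exists k|split => //; exists k].
    apply: sigma_algebra_bigcup => n; apply: sub_sigma_algebra.
    by exists a, b, (- n%:R), n%:R.
  by apply.
have msnd (A : set MR) : measurable A -> <<s rects >> (setT `*` A).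
  move=> mA.
  have : <<s @ocitv R >> `<=` [set A : set MR | <<s rects >> (setT `*` A)].
    apply: smallest_sub.
      split => /=.
      - rewrite setX0; exact: sigma_algebra0.
      - move=> B hB; rewrite setTD.
        have -> : [set: MR] `*` ~` B = setT `\` (setT `*` B).
          by apply/seteqP; split => [[x y] [/= _ ?]|[x y] [_ /= h]]; split => //;
            [move=> [/= _ ?]|move=> ?; apply: h].
        exact: sigma_algebraCD.
      - move=> F hF.
        have -> : [set: MR] `*` \bigcup_k F k = \bigcup_k (setT `*` F k).
          by apply/seteqP; split => [[x y] [_ [k _ ?]]|[x y] [k _ [/= _ ?]]];
            [exists k|split => //; exists k].
        exact: sigma_algebra_bigcup.
    move=> _ [[a b] _ <-] /=; rewrite -strip.
    have -> : (\bigcup_n `](- n%:R : R), n%:R]%classic) `*` `]a, b]%classic =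
        \bigcup_n rect (- n%:R) n%:R a b.
      by apply/seteqP; split => [[x y] [[k _ ?] ?]|[x y] [k _ [/= ? ?]]];
        [exists k|split => //; exists k].
    apply: sigma_algebra_bigcup => n; apply: sub_sigma_algebra.
    by exists (- n%:R), n%:R, a, b.
  by apply.
rewrite measurable_prod_measurableType; apply: smallest_sub.
  exact: smallest_sigma_algebra.
move=> _ [A mA [B mB <-]].
have -> : A `*` B = (A `*` setT) `&` (setT `*` B).
  by apply/seteqP; split => [[x y] [? ?]|[x y] [[? _] [_ ?]]].
pose T' : measurableType _ := g_sigma_algebraType rects.
by apply: (@measurableI _ T'); [exact: mfst|exact: msnd].
Qed.

Lemma rectsI : setI_closed rects.
Proof.
move=> _ _ [a [b [c [d ->]]]] [a' [b' [c' [d' ->]]]].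
have /(_ `]a, b]%classic `]a', b']%classic) := @ocitvI R.
move=> /(_ (is_ocitv _ _) (is_ocitv _ _)) [[a2 b2] _ /= e1].
have /(_ `]c, d]%classic `]c', d']%classic) := @ocitvI R.
move=> /(_ (is_ocitv _ _) (is_ocitv _ _)) [[c2 d2] _ /= e2].
by exists a2, b2, c2, d2; rewrite /rect -setXI -e1 -e2.
Qed.

Lemma lebesgue_rect a b c d : a <= b -> c <= d ->
  (leb \x leb)%E (rect a b c d) = ((b - a) * (d - c))%:E.
Proof.
move=> ab cd; rewrite product_measure1E; try exact: measurable_itv.
have leb_oc x y : x <= y -> leb `]x, y]%classic = (y - x)%:E.
  rewrite le_eqVlt lebesgue_measure_itv /= lte_fin => /predU1P[->|->] //.
  by rewrite ltxx subrr.
by rewrite EFinM; congr (_ * _)%E; exact: leb_oc.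
Qed.

(** The measure of a rectangle is additive in each side because adjacent rectangles are translates
    of rectangles at the origin; by [additive_linear] it is proportional to both sides. Uniqueness
    of measures on the generating rectangles does the rest. *)
Lemma measure_translation_invariant (m : {measure set RR -> \bar R}) (c : R) :
  (forall a b a' b' u v,
    m (rect (a + u) (b + u) (a' + v) (b' + v)) = m (rect a b a' b')) ->
  m (rect 0 1 0 1) = c%:E ->
  forall A, measurable A -> m A = (c%:E * (leb \x leb) A)%E.
Proof.
move=> mT m1.
have c0 : 0 <= c by rewrite -lee_fin -m1.
have split1 s t u : 0 <= s -> 0 <= t ->
    m (rect 0 (s + t) 0 u) = (m (rect 0 s 0 u) + m (rect 0 t 0 u))%E.
  move=> s0 t0; have := mT 0 t 0 u s 0; rewrite add0r !addr0 (addrC t) => <-.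
  rewrite -measureU; try exact: measurable_rect.
    congr (m _); apply/seteqP; split => -[x y].
      move=> /rectP/andP[/andP[h1 h2] /andP[h3 h4]].
      by have [h|h] := leP x s; [left|right]; apply/rectP; rewrite ?h1 ?h2 ?h3 ?h4 ?h.
    by move=> [|] /rectP/andP[/andP[h1 h2] /andP[h3 h4]]; apply/rectP; rewrite h3 h4 andbT;
      apply/andP; split; rlra.
  apply/seteqP; split => // -[x y] [] /rectP/andP[/andP[h1 h2] _].
  by move=> /rectP/andP[/andP[h3 h4] _]; exfalso; rlra.
have split2 s t u : 0 <= s -> 0 <= t ->
    m (rect 0 u 0 (s + t)) = (m (rect 0 u 0 s) + m (rect 0 u 0 t))%E.
  move=> s0 t0; have := mT 0 u 0 t 0 s; rewrite !add0r !addr0 (addrC t) => <-.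
  rewrite -measureU; try exact: measurable_rect.
    congr (m _); apply/seteqP; split => -[x y].
      move=> /rectP/andP[/andP[h1 h2] /andP[h3 h4]].
      by have [h|h] := leP y s; [left|right]; apply/rectP; rewrite ?h1 ?h2 ?h3 ?h4 ?h.
    by move=> [|] /rectP/andP[/andP[h1 h2] /andP[h3 h4]]; apply/rectP; rewrite h1 h2 /=;
      apply/andP; split; rlra.
  apply/seteqP; split => // -[x y] [] /rectP/andP[_ /andP[h1 h2]].
  by move=> /rectP/andP[_ /andP[h3 h4]]; exfalso; rlra.
have mle a b a' b' : a <= b -> a' <= b' -> (m (rect 0 a 0 a') <= m (rect 0 b 0 b'))%E.
  move=> ab ab'; apply: le_measure; rewrite ?inE; try exact: measurable_rect.
  move=> [x y] /rectP/andP[/andP[h1 h2] /andP[h3 h4]]; apply/rectP.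
  by rewrite h1 h3 /=; apply/andP; split; rlra.
(* Finitely many translates of the unit square cover the rectangle; finiteness is needed to pass to
   real numbers in [additive_linear]. *)
have fin s t : m (rect 0 s 0 t) \is a fin_num.
  pose N := (Num.truncn (`|s| + `|t|)).+1.
  have sN : `|s| + `|t| < N%:R by exact: truncnS_gt.
  have hs := ler_norm s; have ht := ler_norm t.
  have s0 := normr_ge0 s; have t0 := normr_ge0 t.
  rewrite ge0_fin_numE //; apply: (@le_lt_trans _ _ (m (rect 0 N%:R 0 N%:R))).
    by apply: mle; rlra.
  have f1 k : (m (rect 0 k%:R 0 1) < +oo)%E.
    elim: k => [|k IH].
      rewrite (_ : rect _ _ _ _ = set0) ?measure0 ?ltry //.
      apply/seteqP; split => // -[x y] /rectP/andP[/andP[h1 h2] _].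
      by exfalso; rlra.
    by rewrite -natr1 split1 // lte_add_pinfty // m1 ltry.
  have f2 k j : (m (rect 0 k%:R 0 j%:R) < +oo)%E.
    elim: j => [|j IH].
      rewrite (_ : rect _ _ _ _ = set0) ?measure0 ?ltry //.
      apply/seteqP; split => // -[x y] /rectP/andP[_ /andP[h1 h2]].
      by exfalso; rlra.
    by rewrite -natr1 split2 // lte_add_pinfty.
  exact: f2.
have mrect0 s t : 0 <= s -> 0 <= t -> m (rect 0 s 0 t) = (c * (s * t))%:E.
  move=> s0 t0.
  have e1 : fine (m (rect 0 s 0 t)) = s * fine (m (rect 0 1 0 t)).
    apply: (@additive_linear _ (fun s => fine (m (rect 0 s 0 t)))) => //.
    by move=> x y x0 y0 /=; rewrite split1 // fineD.
  have e2 : fine (m (rect 0 1 0 t)) = t * fine (m (rect 0 1 0 1)).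
    apply: (@additive_linear _ (fun t => fine (m (rect 0 1 0 t)))) => //.
    by move=> x y x0 y0 /=; rewrite split2 // fineD.
  by rewrite -[LHS]fineK // e1 e2 m1 /=; congr EFin; ring.
move=> A mA; have -> : (c%:E * (leb \x leb) A)%E = mscale (NngNum c0) (leb \x leb)%E A by [].
apply: (measure_unique rects (fun n => rect (- n%:R) n%:R (- n%:R) n%:R)) => //.
- exact: measurable_rects.
- exact: rectsI.
- by move=> n; exists (- n%:R), n%:R, (- n%:R), n%:R.
- apply/seteqP; split => // -[x y] _.
  exists (Num.truncn (`|x| + `|y|)).+1 => //=.
  have := truncnS_gt (`|x| + `|y|); set N := _%:R => hN.
  have := ler_norm x; have := ler_norm y; have := ler_norm (-x); have := ler_norm (-y).
  rewrite !normrN => h1 h2 h3 h4.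
  have s0 := normr_ge0 x; have t0 := normr_ge0 y.
  apply/rectP; apply/andP; split; apply/andP; split; rlra.
- move=> _ [a [b [a' [b' ->]]]].
  have [ab|/ltW ba] := leP a b; last first.
    rewrite (_ : rect _ _ _ _ = set0) ?measure0 //.
    apply/seteqP; split => // -[x y] /rectP/andP[/andP[h1 h2] _].
    by exfalso; rlra.
  have [ab'|/ltW ba'] := leP a' b'; last first.
    rewrite (_ : rect _ _ _ _ = set0) ?measure0 //.
    apply/seteqP; split => // -[x y] /rectP/andP[_ /andP[h1 h2]].
    by exfalso; rlra.
  transitivity (c%:E * (leb \x leb) (rect a b a' b'))%E; last by [].
  rewrite lebesgue_rect // -EFinM -mrect0 ?subr_ge0 //.
  by rewrite -(mT _ _ _ _ a a') !add0r !subrK.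
- move=> k; have := mT 0 (k%:R + k%:R) 0 (k%:R + k%:R) (- k%:R) (- k%:R).
  by rewrite !addrK !add0r => ->; rewrite -ge0_fin_numE.
Qed.

End Plane.

(** * The isodiametric inequality in the plane *)

Section Isodiametric.
Context {R : realType}.
Local Notation MR := (measurableTypeR R).
Local Notation RR := (MR * MR)%type.
Local Notation leb := (@lebesgue_measure R).

Lemma ge0_integral_reflect (w : MR -> \bar R) (a : R) :
  measurable_fun [set: MR] w -> (forall x, (0 <= w x)%E) ->
  (\int[leb]_x w (a - x)%R = \int[leb]_x w x)%E.
Proof.
move=> mw w0.
pose rf : MR -> MR := fun x : R => a - x.
have mr : measurable_fun [set: MR] rf.
  by apply: measurable_funB => //; exact: measurable_cst.
transitivity (\int[pushforward leb rf]_x w x)%E.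
  by rewrite ge0_integral_pushforward // => x _; exact: w0.
apply: eq_measure_integral => A mA _; apply/esym.
apply: (lebesgue_measure_unique (mu := pushforward leb rf)) => //.
move=> _ [[u v] _ <-]; rewrite /pushforward /=.
have e : rf @^-1` `]u, v] = `[a - v, a - u[%classic :> set R.
  by apply/seteqP; split => x /=; rewrite !in_itv /= /rf => /andP[h1 h2];
    apply/andP; split; lra.
transitivity (leb (`[a - v, a - u[%classic : set R)); last by rewrite -e.
rewrite !lebesgue_measure_itv /= !lte_fin ltrD2l ltrN2.
by case: ifP => // _; rewrite -!EFinD; congr EFin; ring.
Qed.

Lemma circle_continuous (m d : R) :
  continuous (fun x : R => 2 * Num.sqrt (d ^+ 2 - 4 * (x - m) ^+ 2)).
Proof.
  move=> x; apply: cvgM; first exact: cvg_cst.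
  apply: (@continuous_comp _ _ _ (fun x : R => d ^+ 2 - 4 * (x - m) ^+ 2) Num.sqrt);
    last exact: sqrt_continuous.
  apply: cvgB; first exact: cvg_cst.
  apply: cvgM; first exact: cvg_cst.
  apply: (@continuous_comp _ _ _ (fun x : R => x - m) (fun x : R => x ^+ 2));
    last exact: exprn_continuous.
  by apply: cvgB; [exact: cvg_id|exact: cvg_cst].
Qed.

(** The integrand is twice the width of the disc of diameter d, so the integral is twice its area;
    it is computed with x = m + (d/2) sin t. *)
Lemma integral_circle (m d : R) : 0 < d ->
  (\int[leb]_x (2 * Num.sqrt (d ^+ 2 - 4 * (x - m) ^+ 2))%:E = (pi / 2 * d ^+ 2)%:E)%E.
Proof.
move=> d0; pose G (x : R) := 2 * Num.sqrt (d ^+ 2 - 4 * (x - m) ^+ 2).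
pose F (t : R) : R := m + d / 2 * sin t.
pose p : R := pi / 2.
have p0 : 0 < p by rewrite divr_gt0 ?pi_gt0.
have cG : continuous G by exact: circle_continuous.
have dF (t : R) : is_derive t (1 : R) F (d / 2 * cos t).
  rewrite /F; apply: is_derive_eq.
  by rewrite /GRing.scale /=; ring.
have F'E : derive1 F = fun t => d / 2 * cos t.
  by apply/funext => t; rewrite derive1E derive_val.
have cF : continuous F.
  by move=> t; apply/differentiable_continuous/derivable1_diffP; case: (dF t).
have cF' : continuous (fun t : R => d / 2 * cos t).
  by move=> t; apply: cvgM; [exact: cvg_cst|exact: continuous_cos].
have FNp : F (- p) = m - d / 2 by rewrite /F /p sinN sin_pihalf; ring.
have Fp : F p = m + d / 2 by rewrite /F /p sin_pihalf; ring.
transitivity (\int[leb]_(x in `[F (- p)%R, F p]) (G x)%:E)%E.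
  rewrite [RHS]integral_mkcond; apply: eq_integral => x _.
  rewrite patchE; case: ifPn => // /negP xn; congr EFin.
  rewrite ler0_sqrtr ?mulr0 // leNgt; apply/negP => h; apply: xn.
  rewrite inE /= in_itv /= FNp Fp.
  have : (2 * `|x - m|) ^+ 2 < d ^+ 2.
    by rewrite exprMn real_normK ?num_real //; lra.
  rewrite ltr_pXn2r ?nnegrE ?(ltW d0) ?mulr_ge0 // => h2.
  have := ler_norm (x - m); have := ler_norm (m - x); rewrite (distrC m).
  by move=> h3 h4; apply/andP; split; lra.
rewrite (@integration_by_substitution_increasing _ F G); first last.
- exact: continuous_subspaceT.
- split; first by move=> t _; case: (dF t).
  + exact: cvg_at_right_filter (cF _).
  + exact: cvg_at_left_filter (cF _).
- by rewrite F'E; apply/cvg_ex; exists (d / 2 * cos p); exact: cvg_at_left_filter (cF' _).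
- by rewrite F'E; apply/cvg_ex; exists (d / 2 * cos (- p)); exact: cvg_at_right_filter (cF' _).
- by move=> t _; rewrite F'E; exact: cF'.
- move=> x y xI yI xy; rewrite /F ltrD2l ltr_pM2l ?divr_gt0 //.
  by rewrite ltr_sin // ?in_itv.
- lra.
pose A (t : R) : R := d ^+ 2 / 2 * (t + sin t * cos t).
have dA (t : R) : is_derive t (1 : R) A (d ^+ 2 * cos t ^+ 2).
  rewrite /A; apply: is_derive_eq.
  rewrite /GRing.scale /=.
  transitivity (d ^+ 2 / 2 * ((cos t ^+ 2 + sin t ^+ 2) + cos t ^+ 2 - sin t ^+ 2)).
    by rewrite cos2Dsin2; ring.
  by field.
transitivity (\int[leb]_(t in `[(- p)%R, p]) (d ^+ 2 * cos t ^+ 2)%R%:E)%E.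
  apply: eq_integral => t; rewrite inE /= in_itv /= => /andP[t1 t2].
  have e : G (F t) * derive1 F t = d ^+ 2 * cos t ^+ 2.
    rewrite F'E /G /F.
    have -> : d ^+ 2 - 4 * (m + d / 2 * sin t - m) ^+ 2 = (d * cos t) ^+ 2.
      rewrite exprMn -[cos t ^+ 2](addrK (sin t ^+ 2)) cos2Dsin2; by field.
    rewrite sqrtr_sqr ger0_norm; first by field.
    by rewrite mulr_ge0 ?(ltW d0) // cos_ge0_pihalf // t1.
  by rewrite -e.
have cA : continuous A.
  by move=> t; apply/differentiable_continuous/derivable1_diffP; case: (dA t).
have cf : {within `[(- p), p], continuous (fun t : R => d ^+ 2 * cos t ^+ 2)}.
  apply: continuous_subspaceT => t; apply: cvgM; first exact: cvg_cst.
  apply: (@continuous_comp _ _ _ cos (fun x : R => x ^+ 2)).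
    exact: continuous_cos.
  exact: exprn_continuous.
have AA : derivable_oo_LRcontinuous A (- p) p.
  split; first by move=> t _; case: (dA t).
  + exact: cvg_at_right_filter (cA _).
  + exact: cvg_at_left_filter (cA _).
have pp : - p < p by lra.
have dA' : {in `](- p), p[, derive1 A =1 (fun t => d ^+ 2 * cos t ^+ 2)}.
  by move=> t _; rewrite derive1E derive_val.
rewrite (continuous_FTC2 pp cf AA dA') -EFinB /A /p sinN cosN cos_pihalf.
by congr EFin; field.
Qed.

Lemma lebesgue_le_itv (S : set MR) (a b : R) : measurable S -> a <= b ->
  (forall y, S y -> a <= y <= b) -> (leb S <= (b - a)%:E)%E.
Proof.
move=> mS ab h; apply: (@le_trans _ _ (leb (`[a, b]%classic : set R))).
  by apply: le_measure; rewrite ?inE.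
rewrite lebesgue_measure_itv /= lte_fin.
by case: ifPn => // _; rewrite lee_fin subr_ge0.
Qed.

(* The sections over [t] and over its mirror image about the midpoint of the
   first projection have total length at most the width at [t] of the disc of
   diameter [d]; integrating over [t] needs no Steiner symmetrization. *)
Lemma isodiametric (C : set RR) (d : R) : 0 < d -> measurable C ->
  (forall p q, C p -> C q -> (p.1 - q.1 : R) ^+ 2 + (p.2 - q.2 : R) ^+ 2 <= d ^+ 2) ->
  ((leb \x leb) C <= (pi * (d / 2) ^+ 2)%:E)%E.
Proof.
move=> d0 mC Cd.
have [->|/set0P[p0 Cp0]] := eqVneq C set0.
  by rewrite measure0 lee_fin mulr_ge0 ?pi_ge0 ?sqr_ge0.
have d00 : 0 <= d by exact: ltW.
have absle (u v : R) : 0 <= v -> u ^+ 2 <= v ^+ 2 -> - v <= u <= v.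
  by move=> v0 h; rewrite -ler_norml -ler_sqr ?nnegrE // real_normK ?num_real.
pose T : set R := [set (p.1 : R) | p in C].
have T0 : T !=set0 by exists p0.1, p0.
have Tb p : C p -> p0.1 - d <= (p.1 : R) <= p0.1 + d.
  move=> Cp; have hb : (p.1 - p0.1 : R) ^+ 2 <= d ^+ 2.
    by apply: le_trans (Cd p p0 Cp Cp0); rewrite lerDl sqr_ge0.
  by have /andP[h1 h2] := absle _ _ d00 hb; apply/andP; split; lra.
have supT : has_sup T.
  by split => //; exists (p0.1 + d) => _ [p Cp <-]; case/andP: (Tb p Cp).
have infT : has_inf T.
  by split => //; exists (p0.1 - d) => _ [p Cp <-]; case/andP: (Tb p Cp).
pose al := inf T; pose be := sup T; pose m := (al + be) / 2.
have alT p : C p -> al <= p.1 by move=> Cp; apply: ge_inf; [case: infT|exists p].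
have beT p : C p -> (p.1 : R) <= be by move=> Cp; apply: ub_le_sup; [case: supT|exists p].
pose w (x : MR) : \bar R := leb (xsection C x).
have mS (x : MR) : measurable (xsection C x) by exact: measurable_xsection.
have SE (x y : MR) : xsection C x y -> C (x, y) by rewrite /xsection /= inE.
have w0 x : (0 <= w x)%E by exact: measure_ge0.
have emp x : (forall y, ~ C (x, y)) -> w x = 0%E.
  move=> h; rewrite /w (_ : xsection C x = set0) ?measure0 //.
  by apply/seteqP; split => // y /SE /h.
have one (x : MR) p : C p -> (w x <= (2 * Num.sqrt (d ^+ 2 - (x - p.1 : R) ^+ 2))%:E)%E.
  move=> Cp; set L := Num.sqrt _.
  have -> : 2 * L = (p.2 + L) - (p.2 - L) by ring.
  have L0 : 0 <= L by exact: sqrtr_ge0.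
  apply: lebesgue_le_itv => //; first by lra.
  move=> y /SE Cy; have h := Cd _ _ Cy Cp.
  have hb : (y - p.2 : R) ^+ 2 <= L ^+ 2.
    by rewrite sqr_sqrtr; move: h => /=; have := sqr_ge0 (y - p.2 : R); lra.
  by have /andP[h1 h2] := absle _ _ L0 hb; apply/andP; split; lra.
(* Any two points of the two sections differ by at most L in height, so sup S - inf S' and sup S' -
   inf S are at most L; their sum is the total length of the two hulls. *)
have two (x x' : MR) y y' : C (x, y) -> C (x', y') ->
    (w x + w x' <= (2 * Num.sqrt (d ^+ 2 - (x - x' : R) ^+ 2))%:E)%E.
  move=> Cy Cy'; set L := Num.sqrt _.
  have L0 : 0 <= L by exact: sqrtr_ge0.
  have SS z z' : C (x, z) -> C (x', z') -> - L <= (z - z' : R) <= L.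
    move=> Cz Cz'; apply: absle => //; rewrite sqr_sqrtr.
      by have := Cd _ _ Cz Cz' => /=; lra.
    by have := Cd _ _ Cz Cz' => /=; have := sqr_ge0 (z - z' : R); lra.
  pose S : set R := [set z | C (x, z)]; pose S' : set R := [set z | C (x', z)].
  have bS z : S z -> y' - L <= z <= y' + L.
    by move=> Sz; have /andP[h1 h2] := SS _ _ Sz Cy'; apply/andP; split; lra.
  have bS' z : S' z -> y - L <= z <= y + L.
    by move=> Sz; have /andP[h1 h2] := SS _ _ Cy Sz; apply/andP; split; lra.
  have iS z : S z -> inf S <= z <= sup S.
    move=> Sz; apply/andP; split; [apply: ge_inf => //|apply: ub_le_sup => //].
      by exists (y' - L) => t /bS /andP[].
    by exists (y' + L) => t /bS /andP[].
  have iS' z : S' z -> inf S' <= z <= sup S'.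
    move=> Sz; apply/andP; split; [apply: ge_inf => //|apply: ub_le_sup => //].
      by exists (y - L) => t /bS' /andP[].
    by exists (y + L) => t /bS' /andP[].
  have h1 : sup S - L <= inf S'.
    apply: lb_le_inf; first by exists y'.
    move=> z' Sz'; rewrite lerBlDr; apply: ge_sup; first by exists y.
    by move=> z Sz; have /andP[_ h] := SS _ _ Sz Sz'; lra.
  have h2 : sup S' - L <= inf S.
    apply: lb_le_inf; first by exists y.
    move=> z Sz; rewrite lerBlDr; apply: ge_sup; first by exists y'.
    by move=> z' Sz'; have /andP[h _] := SS _ _ Sz Sz'; lra.
  have /andP[i1 i2] := iS y Cy; have /andP[i3 i4] := iS' y' Cy'.
  apply: (@le_trans _ _ ((sup S - inf S)%:E + (sup S' - inf S')%:E)%E).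
    apply: leeD; apply: lebesgue_le_itv => //; try exact: le_trans i1 i2.
    - by move=> z /SE; exact: iS.
    - exact: le_trans i3 i4.
    - by move=> z /SE; exact: iS'.
  by rewrite -EFinD lee_fin; lra.
(* This serves when the mirror section is empty. By [one], a section of length W forces the whole
   projection [al, be] of C to lie within K of x, where K^2 = d^2 - W^2/4; since x itself lies in
   [al, be], this gives 2 |x - m| <= K. *)
have lone (x : MR) y : C (x, y) ->
    (w x <= (2 * Num.sqrt (d ^+ 2 - 4 * (x - m) ^+ 2))%:E)%E.
  move=> Cy.
  have wf : w x \is a fin_num.
    by rewrite ge0_fin_numE // (le_lt_trans (one x _ Cy)) // ltry.
  rewrite -(fineK wf) lee_fin; set W := fine (w x).
  have W0 : 0 <= W by rewrite fine_ge0.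
  have Wp p : C p -> (x - p.1 : R) ^+ 2 <= d ^+ 2 - W ^+ 2 / 4.
    move=> Cp; have := one x p Cp; rewrite -(fineK wf) lee_fin -/W => h.
    have : (W / 2) ^+ 2 <= Num.sqrt (d ^+ 2 - (x - p.1 : R) ^+ 2) ^+ 2.
      by rewrite lerXn2r ?nnegrE ?sqrtr_ge0 ?divr_ge0 //; lra.
    rewrite sqr_sqrtr; first by rewrite expr_div_n; lra.
    by have := Cd _ _ Cy Cp => /=; have := sqr_ge0 (y - p.2 : R); lra.
  have K0 : 0 <= d ^+ 2 - W ^+ 2 / 4 by apply: le_trans (Wp _ Cy); exact: sqr_ge0.
  pose K := Num.sqrt (d ^+ 2 - W ^+ 2 / 4).
  have KE : K ^+ 2 = d ^+ 2 - W ^+ 2 / 4 by rewrite sqr_sqrtr.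
  have xK p : C p -> - K <= (x - p.1 : R) <= K.
    by move=> Cp; apply: absle; [exact: sqrtr_ge0|rewrite KE; exact: Wp].
  have h1 : x - K <= al.
    by apply: lb_le_inf => // _ [p Cp <-]; have /andP[_ h] := xK p Cp; lra.
  have h2 : be <= x + K.
    by apply: ge_sup => // _ [p Cp <-]; have /andP[h _] := xK p Cp; lra.
  have h3 := alT _ Cy; have h4 := beT _ Cy; rewrite /= in h3 h4.
  have h5 : (2 * (x - m)) ^+ 2 <= K ^+ 2.
    have : `|2 * (x - m)| <= K by rewrite ler_norml /m; apply/andP; split; lra.
    by rewrite -[in X in X -> _]ler_sqr ?nnegrE ?sqrtr_ge0 // real_normK ?num_real.
  rewrite KE exprMn in h5.
  have h6 : W ^+ 2 / 4 <= d ^+ 2 - 4 * (x - m) ^+ 2 by lra.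
  have : W / 2 <= Num.sqrt (d ^+ 2 - 4 * (x - m) ^+ 2); last by lra.
  rewrite -[leLHS]ger0_norm ?divr_ge0 // -sqrtr_sqr ler_wsqrtr // expr_div_n.
  lra.
pose g (x : R) : R := 2 * Num.sqrt (d ^+ 2 - 4 * (x - m) ^+ 2).
have g0 x : 0 <= g x by rewrite mulr_ge0 ?sqrtr_ge0.
have gr x : g (2 * m - x) = g x by rewrite /g; congr (2 * Num.sqrt _); ring.
have pair (x : MR) : (w x + w (2 * m - x)%R <= (g x)%:E)%E.
  have [[y Cy]|n1] := pselect (exists y, C (x, y));
  have [[y' Cy']|n2] := pselect (exists y', C (2 * m - x, y')).
  - apply: le_trans (two _ _ _ _ Cy Cy') _.
    by rewrite lee_fin /g le_eqVlt; apply/orP; left; apply/eqP; congr (2 * Num.sqrt _); ring.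
  - rewrite (emp (2 * m - x)%R) ?adde0; first exact: lone Cy.
    by move=> y' Cy'; apply: n2; exists y'.
  - rewrite (emp x) ?add0e; first by rewrite -gr; exact: lone Cy'.
    by move=> y Cy; apply: n1; exists y.
  - rewrite (emp x) ?(emp (2 * m - x)%R) ?adde0 ?lee_fin //.
      by move=> y' Cy'; apply: n2; exists y'.
    by move=> y Cy; apply: n1; exists y.
have mw : measurable_fun [set: MR] w by exact: measurable_fun_xsection.
have mr : measurable_fun [set: MR] (fun x : MR => w (2 * m - x)%R).
  apply: (measurableT_comp mw).
  by apply: measurable_funB => //; exact: measurable_cst.
have I2 := integral_circle m d0.
have -> : (leb \x leb)%E C = (\int[leb]_x w x)%E by [].
have h : (\int[leb]_x w x + \int[leb]_x w x <= (pi / 2 * d ^+ 2)%:E)%E.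
  rewrite -{2}(ge0_integral_reflect (2 * m) mw w0) -ge0_integralD // -I2.
  apply: ge0_le_integral => //.
  - by move=> x _; apply: adde_ge0.
  - exact: emeasurable_funD.
  - apply/measurable_EFinP; apply: continuous_measurable_fun.
    exact: circle_continuous.
have wf : (\int[leb]_x w x)%E \is a fin_num.
  rewrite ge0_fin_numE ?integral_ge0 //; apply: le_lt_trans (ltry (pi / 2 * d ^+ 2)).
  by apply: le_trans h; rewrite leeDl // integral_ge0.
move: h; rewrite -(fineK wf) -EFinD !lee_fin expr_div_n; lra.
Qed.

End Isodiametric.

(** * H^2 in the plane as a multiple of Lebesgue measure *)

Lemma hausdorff_iso {R : realType} {n m : nat} {T : Type} d (A : set T)
    (f : T -> 'rV[R]_n) (g : T -> 'rV[R]_m) :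
  (forall x y, A x -> A y -> edist (f x) (f y) = edist (g x) (g y)) ->
  hausdorff d.+1 (f @` A) = hausdorff d.+1 (g @` A).
Proof.
move=> fg; apply/eqP; rewrite eq_le; apply/andP; split.
  by have := @hausdorff_map R _ _ _ d 1 A f g ltr01; rewrite expr1n mul1e; apply => x y Ax Ay;
    rewrite mul1r fg.
by have := @hausdorff_map R _ _ _ d 1 A g f ltr01; rewrite expr1n mul1e; apply => x y Ax Ay;
  rewrite mul1r fg.
Qed.

Section Plane.
Context {R : realType}.
Local Notation MR := (measurableTypeR R).
Local Notation RR := (MR * MR)%type.
Local Notation leb := (@lebesgue_measure R).

Definition vec2 (x y : R) : 'rV[R]_2 := \row_i (if i == ord0 then x else y).

Lemma sqr_edist_vec2 x y x' y' :
  edist (vec2 x y) (vec2 x' y') ^+ 2 = (x - x') ^+ 2 + (y - y') ^+ 2.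
Proof.
by rewrite /edist sqr_enorm /dotp !big_ord_recl big_ord0 !mxE /= addr0 -!expr2.
Qed.

Lemma sqrt_le_of_sqr (a b : R) : 0 <= b -> a ^+ 2 <= b ^+ 2 -> a <= b.
Proof.
by move=> b0 h; apply: le_trans (ler_norm a) _; rewrite -ler_sqr ?nnegrE // real_normK ?num_real.
Qed.

Lemma vec2K (v : 'rV[R]_2) : vec2 (v ord0 ord0) (v ord0 (lift ord0 ord0)) = v.
Proof.
apply/rowP => i; rewrite mxE; case: (unliftP ord0 i) => [j ->|->] //=.
by rewrite (ord1 j).
Qed.

Definition diag (a b : R) (p : RR) : 'rV[R]_2 := vec2 (a * p.1) (b * p.2).

Lemma diagE a b (p : RR) i :
  diag a b p ord0 i = if i == ord0 then a * p.1 else b * p.2.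
Proof. by rewrite mxE. Qed.

Lemma sqr_edist_diag a b (p q : RR) : edist (diag a b p) (diag a b q) ^+ 2 =
  a ^+ 2 * (p.1 - q.1 : R) ^+ 2 + b ^+ 2 * (p.2 - q.2 : R) ^+ 2.
Proof. by rewrite sqr_edist_vec2; ring. Qed.

Section Positive.
Variables a b : R.
Hypotheses (a0 : 0 < a) (b0 : 0 < b).

Lemma diag_inj : injective (diag a b).
Proof.
move=> [x y] [x' y'] h.
have := congr1 (fun v : 'rV[R]_2 => v ord0 ord0) h.
have := congr1 (fun v : 'rV[R]_2 => v ord0 (lift ord0 ord0)) h.
rewrite !diagE /= => /(mulfI (lt0r_neq0 b0)) -> /(mulfI (lt0r_neq0 a0)) -> //.
Qed.

Lemma diag_surj v : exists p, diag a b p = v.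
Proof.
exists (v ord0 ord0 / a, v ord0 (lift ord0 ord0) / b).
by rewrite /diag /= !(mulrC _ (_ / _)) !divfK ?lt0r_neq0 // vec2K.
Qed.

(** It suffices to treat rectangles, whose images are cut out by sublevel sets of coordinates, and
    coordinates are 1-Lipschitz. *)
Lemma caratheodory_diag A : measurable A ->
  (@hausdorff R 2 2).-caratheodory (diag a b @` A).
Proof.
rewrite measurable_rects; move: A; apply: smallest_sub.
  split => /=.
  - by rewrite image_set0; exact: caratheodory_measurable_set0.
  - move=> A hA; rewrite setTD.
    have -> : diag a b @` (~` A) = ~` (diag a b @` A).
      apply/seteqP; split => [_ [p nA <-] [q Aq /diag_inj qp]|v nv].
        by apply: nA; rewrite -qp.
      have [p pv] := diag_surj v; exists p => // Ap.
      by apply: nv; exists p.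
    exact: caratheodory_measurable_setC.
  - by move=> F hF; rewrite image_bigcup; exact: caratheodory_measurable_bigcup.
move=> _ [x [x' [y [y' ->]]]] /=.
have coord i (c : R) : (@hausdorff R 2 2).-caratheodory [set v : 'rV[R]_2 | v ord0 i <= c].
  apply: caratheodory_lip_sublevel => v w.
  by have := coord_le_enorm (v - w) i; rewrite !mxE.
pose i1 : 'I_2 := lift ord0 ord0.
have -> : diag a b @` rect x x' y y' =
    ([set v : 'rV[R]_2 | v ord0 ord0 <= a * x'] `\` [set v : 'rV[R]_2 | v ord0 ord0 <= a * x])
    `&` ([set v : 'rV[R]_2 | v ord0 i1 <= b * y'] `\` [set v : 'rV[R]_2 | v ord0 i1 <= b * y]).
  apply/seteqP; split => [_ [[s t] /rectP/andP[/andP[h1 h2] /andP[h3 h4]] <-]|v].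
    by rewrite /= !diagE /= !ler_pM2l // h2 h4; split; split => //; apply/negP; rewrite -ltNge.
  have [[s t] <-] := diag_surj v; rewrite /= !diagE /= !ler_pM2l //.
  move=> [[h1 /negP h2] [h3 /negP h4]]; exists (s, t) => //; apply/rectP.
  by rewrite h1 h3 !ltNge h2 h4.
by apply: caratheodory_measurable_setI; apply: caratheodory_measurable_setD.
Qed.

End Positive.

(** The scaling factors carry their positivity in their type because the measure structure declared
    below depends on it. *)
Definition planar_measure (a b : {posnum R}) (A : set RR) : \bar R :=
  hausdorff 2 (diag a%:num b%:num @` A).

Section PlanarMeasure.
Variables a b : {posnum R}.

Let planar0 : planar_measure a b set0 = 0%E.
Proof. by rewrite /planar_measure image_set0 hausdorff_set0. Qed.

Let planar_ge0 A : (0 <= planar_measure a b A)%E.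
Proof. exact: hausdorff_ge0. Qed.

Let planar_semi_sigma_additive : semi_sigma_additive (planar_measure a b).
Proof.
move=> F mF tF mUF; rewrite /planar_measure image_bigcup.
have mI A : measurable A -> (@hausdorff R 2 2).-cara.-measurable (diag a%:num b%:num @` A).
  exact: caratheodory_diag.
apply: (@caratheodory_measure_sigma_additive _ _ (@hausdorff R 2 2)
  (fun k => diag a%:num b%:num @` F k)).
- by move=> k; apply: mI.
- apply/trivIsetP => i j _ _ ij; rewrite -subset0 => v [[p Fp <-] [q Fq qp]].
  have pq := diag_inj (gt0 a) (gt0 b) qp; rewrite pq in Fq.
  have /trivIsetP/(_ i j I I ij) := tF; rewrite -subset0; apply.
  by split; [exact: Fp|exact: Fq].
- by rewrite -image_bigcup; exact: mI.
Qed.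

HB.instance Definition _ := isMeasure.Build _ _ _ (planar_measure a b)
  planar0 planar_ge0 planar_semi_sigma_additive.

End PlanarMeasure.

Lemma planar_measure_rect (a b : {posnum R}) (x x' y y' u v : R) :
  planar_measure a b (rect (x + u) (x' + u) (y + v) (y' + v)) =
  planar_measure a b (rect x x' y y').
Proof.
rewrite /planar_measure.
have -> : rect (x + u) (x' + u) (y + v) (y' + v) =
    (fun p : RR => ((p.1 + u : R), (p.2 + v : R)) : RR) @` rect x x' y y'.
  apply/seteqP; split => [[s t] /rectP/andP[/andP[h1 h2] /andP[h3 h4]]|_ [[s t]
      /rectP/andP[/andP[h1 h2] /andP[h3 h4]] <-]].
    exists ((s : R) - u : R, (t : R) - v : R); last by rewrite /= !subrK.
    by apply/rectP; apply/andP; split; apply/andP; split; lra.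
  by apply/rectP => /=; apply/andP; split; apply/andP; split; lra.
rewrite image_comp; apply: hausdorff_iso => p q _ _.
apply/eqP; rewrite -(@eqrXn2 _ 2) ?edist_ge0 // !sqr_edist_diag /=.
by apply/eqP; congr (_ * _ ^+ 2 + _ * _ ^+ 2); ring.
Qed.

Local Notation one := (1%:pos : {posnum R})%R.

(** A grid of mesh 1/N covers the square by at most (N + 1)^2 <= 4 N^2 cells, each of diameter at
    most 2/N and hence of cost at most pi/N^2. *)
Lemma planar_measure_unit_fin : (planar_measure one one (rect 0 1 0 1) < +oo)%E.
Proof.
apply: (@le_lt_trans _ _ (4 * pi)%:E); last exact: ltry.
apply: hausdorff_le => delta d0.
pose N := (Num.truncn (2 / delta)).+1.
have N0 : 0 < N%:R :> R by rewrite ltr0n.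
have Nd : 2 / N%:R <= delta.
  by rewrite ler_pdivrMr // mulrC -ler_pdivrMr // ltW // truncnS_gt.
pose Q (i j : nat) : set 'rV[R]_2 := diag 1 1 @` [set p : RR |
  (i%:R / N%:R <= (p.1 : R) <= i.+1%:R / N%:R) && (j%:R / N%:R <= (p.2 : R) <= j.+1%:R / N%:R)].
(* There are N + 1 indices per axis: a point with a coordinate equal to 1 falls into the cell of
   index N. *)
pose U (k : nat) := if (k < N.+1 * N.+1)%N then Q (divn k N.+1) (modn k N.+1) else set0.
have Qd i j : diam_bounded (Q i j) (2 / N%:R).
  move=> _ _ [p /andP[/andP[h1 h2] /andP[h3 h4]] <-] [q /andP[/andP[h5 h6] /andP[h7 h8]] <-].
  have i0 : 0 <= 2 / N%:R :> R by rewrite divr_ge0.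
  apply: sqrt_le_of_sqr => //; rewrite sqr_edist_diag !expr1n !mul1r.
  have e k : k.+1%:R / N%:R = k%:R / N%:R + N%:R^-1 :> R by rewrite -natr1 mulrDl mul1r.
  rewrite (e i) in h2 h6; rewrite (e j) in h4 h8.
  have aux (u : R) : - N%:R^-1 <= u <= N%:R^-1 -> u ^+ 2 <= N%:R^-1 ^+ 2.
    by rewrite -ler_norml => h; rewrite -[u ^+ 2]real_normK ?num_real // lerXn2r ?nnegrE // invr_ge0.
  have := aux (p.1 - q.1 : R); have := aux (p.2 - q.2 : R).
  move=> /(_ ltac:(apply/andP; split; lra)) a1 /(_ ltac:(apply/andP; split; lra)) a2.
  by rewrite exprMn; have := sqr_ge0 (N%:R^-1 : R); lra.
apply: (le_trans (@content_le _ _ _ _ _ U _)).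
  split; last first.
    move=> k x y; rewrite /U; case: ifP => // _ Ux Uy.
    exact: le_trans (Qd _ _ _ _ Ux Uy) Nd.
  move=> _ [[x y] /rectP/andP[/andP[x0 x1] /andP[y0 y1]] <-].
  pose i := Num.truncn (N%:R * x); pose j := Num.truncn (N%:R * y).
  have tr (z : R) : 0 < z -> z <= 1 -> (Num.truncn (N%:R * z) < N.+1)%N /\
      (Num.truncn (N%:R * z))%:R / N%:R <= z <= (Num.truncn (N%:R * z)).+1%:R / N%:R.
    move=> z0 z1; have Nz : 0 <= N%:R * z by rewrite mulr_ge0 // ltW.
    have /andP[h1 h2] : (Num.truncn (N%:R * z))%:R <= N%:R * z < (Num.truncn (N%:R * z)).+1%:R.
      exact: truncn_itv.
    split.
      rewrite ltnS -(ler_nat R); apply: le_trans h1 _.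
      by rewrite -[leRHS]mulr1 ler_wpM2l.
    by rewrite ler_pdivrMr // ler_pdivlMr // (mulrC z) h1 ltW.
  have [iN i1] := tr x x0 x1; have [jN j1] := tr y y0 y1.
  exists (i * N.+1 + j)%N => //; rewrite /U.
  have -> : (i * N.+1 + j < N.+1 * N.+1)%N by nia.
  rewrite divnMDl // (divn_small jN) addn0 modnMDl (modn_small jN).
  by exists (x, y) => //=; rewrite i1 j1.
rewrite (nneseries_split _ (N.+1 * N.+1)); last by move=> k _; rewrite lee_fin ball_volume_ge0.
rewrite [X in (_ + X)%E]eseries0 ?adde0; last first.
  by move=> k; rewrite add0n => kN _; rewrite /U ltnNge kN /= ball_volume_set0.
rewrite add0n sumEFin lee_fin.
apply: (@le_trans _ _ (\sum_(0 <= k < N.+1 * N.+1) (pi / N%:R ^+ 2))).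
  apply: ler_sum_nat => k /andP[_ kN]; rewrite /U kN /ball_volume /=.
  have dq : diam (Q (divn k N.+1) (modn k N.+1)) <= 2 / N%:R.
    by apply: diam_le => //; rewrite divr_ge0.
  have -> : 2 * pi / 2 * 1 = pi :> R by field.
  rewrite ler_wpM2l ?pi_ge0 // -exprVn lerXn2r ?nnegrE ?divr_ge0 ?diam_ge0 ?invr_ge0 //.
  by move: dq; set t := diam _; lra.
rewrite sumr_const_nat subn0 -[_ *+ _]mulr_natl mulrCA mulrC ler_wpM2r ?pi_ge0 //.
rewrite ler_pdivrMr ?exprn_gt0 // natrM -natr1.
have : 1 <= N%:R :> R by rewrite ler1n.
nra.
Qed.

End Plane.

Section ClosureDiam.
Context {R : realType} {n : nat}.
Implicit Types U : set 'rV[R]_n.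

Lemma closure_diam_bounded U c : diam_bounded U c -> diam_bounded (closure U) c.
Proof.
move=> Uc x y Ux Uy; apply/ler_addgt0Pr => e e0.
have e20 : 0 < e / 2 by rewrite divr_gt0.
have nx (z : 'rV[R]_n) : nbhs z (eball z (e / 2)) by apply/nbhs_eball; exists (e / 2).
have [x' [Ux' xx']] := Ux _ (nx x); have [y' [Uy' yy']] := Uy _ (nx y).
have := Uc _ _ Ux' Uy'; rewrite /eball /= in xx' yy'.
have := edist_triangle x' x y; have := edist_triangle y' x' y.
by rewrite (edistC y' y); lra.
Qed.

Lemma ball_volume_closure d U c : diam_bounded U c ->
  ball_volume d (closure U) <= ball_volume d U.
Proof.
move=> Uc; rewrite -[leRHS]mul1r -(expr1n _ d); apply: ball_volume_le => //.
rewrite mul1r; apply: diam_le; first exact: diam_ge0.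
by apply: closure_diam_bounded => x y Ux Uy; exact: le_diam Uc Ux Uy.
Qed.

Lemma content_adherent d delta (A : set 'rV[R]_n) (e : R) : 0 < e ->
  (hausdorff_content d delta A < +oo)%E ->
  exists2 U, delta_cover delta A U &
    (\sum_(0 <= k <oo) (ball_volume d (U k))%:E <= hausdorff_content d delta A + e%:E)%E.
Proof.
move=> e0 fin.
have ff : hausdorff_content d delta A \is a fin_num by rewrite ge0_fin_numE ?content_ge0.
have [_ [U [AU Ud ->]] le] := lb_ereal_inf_adherent e0 ff.
by exists U; [split|exact: ltW].
Qed.

End ClosureDiam.

Section Plane.
Context {R : realType}.
Local Notation MR := (measurableTypeR R).
Local Notation RR := (MR * MR)%type.
Local Notation leb := (@lebesgue_measure R).
Local Notation one := (1%:pos : {posnum R})%R.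

(** The set is the union of the half-open rectangles with rational corners that it contains.
    Openness is phrased with coordinates so that it can be checked directly on pairs. *)
Lemma measurable_open_plane (O : set RR) :
  (forall p, O p -> exists2 e : R, 0 < e &
    forall q, `|q.1 - p.1 : R| < e -> `|q.2 - p.2 : R| < e -> O q) ->
  measurable O.
Proof.
move=> Oo.
pose F (n : nat) : set RR := if (unpickle n : option (rat * rat * rat * rat)%type) is
    Some (a, b, c, d) then
  (if `[< rect (ratr a) (ratr b) (ratr c) (ratr d) `<=` O >] then
     rect (ratr a) (ratr b) (ratr c) (ratr d) else set0) else set0.
have -> : O = \bigcup_n F n.
  apply/seteqP; split => [p Op|p [n _]]; last first.
    rewrite /F; case: unpickle => [[[[a b] c] d]|] //.
    by case: ifPn => // /asboolP; apply.
  have [e e0 h] := Oo p Op.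
  have rat_between (x y : R) : x < y -> exists q : rat, x < ratr q < y.
    by move=> xy; have [q] := rat_in_itvoo xy; rewrite in_itv /=; exists q.
  have [|a /andP[a1 a2]] := rat_between (p.1 - e) p.1; first by lra.
  have [|b /andP[b1 b2]] := rat_between p.1 (p.1 + e); first by lra.
  have [|c /andP[c1 c2]] := rat_between (p.2 - e) p.2; first by lra.
  have [|d /andP[d1 d2]] := rat_between p.2 (p.2 + e); first by lra.
  exists (pickle (a, b, c, d)); [exact: I|rewrite /F pickleK].
  case: ifPn => [_|/asboolP[]].
    by case: p {Op h} a1 a2 b1 b2 c1 c2 d1 d2 => x y /= *; apply/rectP;
      apply/andP; split; apply/andP; split => //; lra.
  move=> [x y] /rectP/andP[/andP[h1 h2] /andP[h3 h4]]; apply: h => /=;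
    by rewrite ltr_norml; apply/andP; split; lra.
apply: bigcup_measurable => n _; rewrite /F.
case: unpickle => [[[[a b] c] d]|] //; case: ifPn => // _; exact: measurable_rect.
Qed.

Lemma edist_diag1_le (p q : RR) :
  edist (diag 1 1 p) (diag 1 1 q) <= `|p.1 - q.1 : R| + `|p.2 - q.2 : R|.
Proof.
apply: sqrt_le_of_sqr; first by rewrite addr_ge0.
rewrite sqr_edist_diag expr1n !mul1r [leRHS]sqrrD !real_normK ?num_real //.
by have : 0 <= `|p.1 - q.1 : R| * `|p.2 - q.2 : R|; [rewrite mulr_ge0|lra].
Qed.

Lemma measurable_diag_closed (C : set 'rV[R]_2) : closed C ->
  measurable (diag 1 1 @^-1` C : set RR).
Proof.
move=> cC; rewrite -[X in measurable X]setCK; apply: measurableC.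
apply: measurable_open_plane => p /= nCp.
have /nbhs_eball[e e0 he] : nbhs (diag 1 1 p) (~` C).
  by move: cC; rewrite -openC openE; apply.
exists (e / 2) => [|q h1 h2]; first by rewrite divr_gt0.
apply: he; rewrite /eball /=; apply: le_lt_trans (edist_diag1_le _ _) _.
by rewrite (distrC p.1) (distrC p.2); lra.
Qed.

Lemma ball_volume2 {n : nat} (A : set 'rV[R]_n) : ball_volume 2 A = pi * (diam A / 2) ^+ 2.
Proof. by rewrite /ball_volume /=; congr (_ * _); field. Qed.

Lemma lebesgue_le_ball_volume (C : set 'rV[R]_2) c : closed C -> diam_bounded C c ->
  ((leb \x leb) (diag 1 1 @^-1` C) <= (ball_volume 2 C)%:E)%E.
Proof.
move=> cC Cc; rewrite ball_volume2.
have mC := measurable_diag_closed cC.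
have Cd p q : C (diag 1 1 p) -> C (diag 1 1 q) ->
    (p.1 - q.1 : R) ^+ 2 + (p.2 - q.2 : R) ^+ 2 <= diam C ^+ 2.
  move=> Cp Cq; have := le_diam Cc Cp Cq; rewrite -ler_sqr ?nnegrE ?edist_ge0 ?diam_ge0 //.
  by rewrite sqr_edist_diag expr1n !mul1r.
have := diam_ge0 C; rewrite le_eqVlt => /predU1P[d0|d0]; last first.
  exact: isodiametric.
(* When the diameter is 0, [isodiametric] is applied with a positive d' chosen so that the disc of
   diameter d' has area e. *)
apply/lee_addgt0Pr => e e0; pose d' := Num.sqrt (4 * e / pi).
have d'0 : 0 < d' by rewrite sqrtr_gt0 divr_gt0 ?mulr_gt0 ?pi_gt0.
apply: (le_trans (@isodiametric _ _ d' _ _ _)) => //.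
  by move=> p q Cp Cq; apply: le_trans (Cd p q Cp Cq) _; rewrite -d0 expr0n sqr_ge0.
rewrite -d0 mul0r expr0n mulr0 add0e lee_fin expr_div_n sqr_sqrtr; last first.
  by rewrite divr_ge0 ?mulr_ge0 ?pi_ge0 // ltW.
rewrite le_eqVlt; apply/orP; left; apply/eqP.
have := @pi_gt0 R; move: (@pi R) => q q0; field.
by rewrite lt0r_neq0.
Qed.

(** The ratio of H^2 to Lebesgue measure in the plane. *)
Definition hausdorff_unit : R := fine (planar_measure one one (rect 0 1 0 1)).

Lemma hausdorff_unitE : planar_measure one one (rect 0 1 0 1) = hausdorff_unit%:E.
Proof. by rewrite fineK // ge0_fin_numE // planar_measure_unit_fin. Qed.

Lemma planar_measure1E A : measurable A ->
  planar_measure one one A = (hausdorff_unit%:E * (leb \x leb) A)%E.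
Proof.
apply: measure_translation_invariant; first exact: planar_measure_rect.
exact: hausdorff_unitE.
Qed.

Lemma planar_measureE (a b : {posnum R}) A : measurable A ->
  planar_measure a b A = ((a%:num * b%:num)%:E * planar_measure one one A)%E.
Proof.
move=> mA; rewrite planar_measure1E // muleA -EFinM.
apply: measure_translation_invariant => //; first exact: planar_measure_rect.
transitivity (planar_measure one one (rect 0 a%:num 0 b%:num)).
  have -> : rect 0 a%:num 0 b%:num = (fun p : RR => (a%:num * p.1 : R, b%:num * p.2 : R) : RR)
     @` rect 0 1 0 1.
    apply/seteqP; split => [[s t] /rectP/andP[/andP[h1 h2] /andP[h3 h4]]|_ [[s t]
        /rectP/andP[/andP[h1 h2] /andP[h3 h4]] <-]].
      exists ((s : R) / a%:num, (t : R) / b%:num); last first.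
        by rewrite /= !(mulrC _ (_ / _)) !divfK // lt0r_neq0.
      by apply/rectP; rewrite !divr_gt0 //= !ler_pdivrMr // !mul1r h2 h4.
    apply/rectP; rewrite /= !mulr_gt0 //= !ler_piMr //=.
  rewrite /planar_measure image_comp; apply: hausdorff_iso => p q _ _.
  apply/eqP; rewrite -(@eqrXn2 _ 2) ?edist_ge0 // !sqr_edist_diag /=.
  by apply/eqP; ring.
by rewrite planar_measure1E ?lebesgue_rect ?subr0 -?EFinM 1?mulrC //; exact: measurable_rect.
Qed.

(** Passing to closures keeps diameters and makes a covering measurable; by the isodiametric
    inequality each closed set has Lebesgue measure at most its cost. *)
Lemma hausdorff_unit_ge1 : 1 <= hausdorff_unit.
Proof.
rewrite -lee_fin -hausdorff_unitE.
apply: le_trans _ (content_le_hausdorff _ _ ltr01).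
apply: content_ge => U [AU Ud].
have -> : 1%E = (leb \x leb)%E (rect 0 1 0 1) by rewrite lebesgue_rect // !subr0 mulr1.
have mU k : measurable (diag 1 1 @^-1` closure (U k) : set RR).
  by apply: measurable_diag_closed; exact: closed_closure.
apply: (@le_trans _ _ (\sum_(0 <= k <oo) (leb \x leb) (diag 1 1 @^-1` closure (U k)))%E).
  apply: measure_sigma_subadditive => //; first exact: measurable_rect.
  move=> p rp; have [k _ Uk] := AU _ (imageP (diag 1 1) rp); exists k => //.
  exact: subset_closure.
apply: lee_nneseries => [k _ _|k _]; first exact: measure_ge0.
apply: (le_trans (@lebesgue_le_ball_volume _ 1 _ _)).
- exact: closed_closure.
- exact: closure_diam_bounded.
- by rewrite lee_fin (@ball_volume_closure _ _ _ _ 1).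
Qed.

(** G is the intersection, over finer and finer scales, of the unions of closures of nearly optimal
    coverings. It transfers facts about measurable sets to arbitrary A. *)
Lemma hausdorff_hull (A : set RR) : exists G : set RR, [/\ measurable G, A `<=` G &
  (hausdorff 2 (diag 1 1 @` G) <= hausdorff 2 (diag 1 1 @` A))%E].
Proof.
set H := hausdorff 2 _.
have [Hoo|] := eqVneq H +oo%E; first by exists setT; split => //; rewrite Hoo leey.
rewrite -ltey => Hfin.
have ex (j : nat) : exists U : nat -> set 'rV[R]_2, delta_cover j.+1%:R^-1 (diag 1 1 @` A) U /\
   (\sum_(0 <= k <oo) (ball_volume 2 (U k))%:E <= H + (j.+1%:R^-1)%:E)%E.
  have j0 : 0 < j.+1%:R^-1 :> R by rewrite invr_gt0 ltr0n.
  have cH := content_le_hausdorff 2 (diag 1 1 @` A) j0.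
  have [U cU hU] := content_adherent j0 (le_lt_trans cH Hfin).
  by exists U; split => //; apply: le_trans hU _; apply: leeD.
have [U hU] := choice ex.
pose G := \bigcap_j \bigcup_k (diag 1 1 @^-1` closure (U j k) : set RR).
exists G; split.
- apply: bigcap_measurable => // j _; apply: bigcup_measurable => k _.
  by apply: measurable_diag_closed; exact: closed_closure.
- move=> p Ap j _; have [[AU _] _] := hU j.
  have [k _ Uk] := AU _ (imageP (diag 1 1) Ap); exists k => //.
  exact: subset_closure.
apply: hausdorff_le => delta d0; apply/lee_addgt0Pr => e e0.
pose m := Num.min delta e; have m0 : 0 < m by rewrite lt_min d0 e0.
have [j jm] : exists j : nat, j.+1%:R^-1 <= m.
  have [j] := ltr_add_invr m0; rewrite add0r => /ltW; by exists j.
move: jm; rewrite le_min => /andP[jd je].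
have [[AU Ud] hs] := hU j.
apply: (le_trans (content_antitone _ _ jd)).
apply: (le_trans (@content_le _ _ _ _ _ (fun k => closure (U j k)) _)).
  split; last by move=> k; apply: closure_diam_bounded; exact: Ud.
  by move=> _ [p Gp <-]; have [k _ Uk] := Gp j I; exists k.
apply: le_trans (le_trans hs _); last by apply: leeD.
apply: lee_nneseries => [k _ _|k _]; first by rewrite lee_fin ball_volume_ge0.
by rewrite lee_fin (ball_volume_closure _ (Ud k)).
Qed.

Lemma hausdorff_diag (a b : R) (A : set RR) : 0 < a -> 0 < b ->
  (hausdorff 2 (diag a b @` A) <= (a * b)%:E * hausdorff 2 (diag 1 1 @` A))%E.
Proof.
move=> a0 b0; have [G [mG AG GA]] := hausdorff_hull A.
apply: (@le_trans _ _ (hausdorff 2 (diag a b @` G))).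
  by apply: hausdorffS; exact: image_subset.
have := planar_measureE (PosNum a0) (PosNum b0) mG; rewrite /planar_measure /= => ->.
by rewrite lee_pmul2l // lte_fin mulr_gt0.
Qed.

Lemma lebesgue_le_hausdorff (G : set RR) : measurable G ->
  ((leb \x leb) G <= hausdorff 2 (diag 1 1 @` G))%E.
Proof.
move=> mG; have := planar_measure1E mG; rewrite /planar_measure /= => ->.
by rewrite -{1}[leLHS]mul1e lee_wpmul2r ?measure_ge0 // lee_fin hausdorff_unit_ge1.
Qed.

Lemma hausdorff_null (G : set RR) : measurable G -> (leb \x leb)%E G = 0%E ->
  hausdorff 2 (diag 1 1 @` G) = 0%E.
Proof.
by move=> mG G0; have := planar_measure1E mG; rewrite /planar_measure /= G0 mule0.
Qed.

End Plane.

(** * Almost everywhere derivability of Lipschitz functions on the line *)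

Section LipschitzDerivable.
Context {R : realType}.
Local Notation MR := (measurableTypeR R).
Local Notation leb := (@lebesgue_measure R).
Variables (u : R -> R) (K : R).
Hypotheses (K0 : 0 < K) (uK : forall x y, `|u x - u y| <= K * `|x - y|).

(** The added linear term makes the function nondecreasing, so that it has a Lebesgue-Stieltjes
    measure. *)
Let G (x : R) : R := u x + K * x.

Let Gnd : nondecreasing G.
Proof.
move=> x y xy; rewrite /G; have := uK x y; rewrite distrC (distrC x).
rewrite (ger0_norm (_ : 0 <= y - x)) ?subr_ge0 // mulrBr.
by have := ler_norm (u x - u y); rewrite distrC; lra.
Qed.

Let Glip x y : x <= y -> G y - G x <= (2 * K) * (y - x).
Proof.
move=> xy; rewrite /G; have := uK y x.
rewrite (ger0_norm (_ : 0 <= y - x)) ?subr_ge0 // !mulrBr.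
by have := ler_norm (u y - u x); lra.
Qed.

Let ucont : continuous u.
Proof.
move=> x; apply/cvgrPdist_le => e e0.
have K1 : 0 < K + 1 by rewrite ltr_wpDl // ltW.
have d0 : 0 < e / (K + 1) by rewrite divr_gt0.
near=> y; apply: le_trans (uK x y) _.
apply: (@le_trans _ _ ((K + 1) * `|x - y|)).
  by rewrite ler_wpM2r // lerDl.
rewrite mulrC -ler_pdivlMr //; near: y.
Unshelve. all: by end_near. Qed.

Let Gcont : continuous G.
Proof.
move=> x; apply: cvgD; first exact: ucont.
by apply: cvgM; [exact: cvg_cst|exact: cvg_id].
Qed.

HB.instance Definition _ := isCumulative.Build R _ R G Gnd
  (right_continuousW Gcont).

Let nu := lebesgue_stieltjes_measure G.

Let nu_itv (a b : R) : a <= b -> nu `]a, b]%classic = (G b - G a)%:E.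
Proof.
move=> ab; rewrite /nu /lebesgue_stieltjes_measure /measure_extension /=.
rewrite measurable_mu_extE; last exact: is_ocitv.
exact: wlength_itv_bnd.
Qed.

Let nu_le (A : set MR) : (nu A <= (2 * K)%:E * leb A)%E.
Proof.
have K2 : 0 < 2 * K by rewrite mulr_gt0.
rewrite /nu /lebesgue_stieltjes_measure /measure_extension -lee_pdivrMl //.
apply: le_ereal_inf_tmp => _ [F [mF AF] <-]; rewrite lee_pdivrMl //.
apply: (@le_trans _ _ (\sum_(0 <= k <oo) wlength G (F k))%E).
  by apply: ereal_inf_lbound; exists F.
rewrite -nneseriesZl //.
apply: lee_nneseries => [k _ _|k _]; first exact: wlength_ge0.
have /ocitvP[->|[[a b] /= ab ->]] := mF k; first last.
  rewrite (_ : wlength G _ = (G b - G a)%:E); last exact/wlength_itv_bnd/ltW.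
  rewrite (_ : wlength idfun _ = (b - a)%:E); last exact/wlength_itv_bnd/ltW.
  by rewrite -EFinM lee_fin; apply: Glip; exact: ltW.
by rewrite wlength0 mule_ge0 ?lee_fin ?(ltW K2) // wlength_ge0.
Qed.

Let derivable_ball (N : nat) :
  {ae leb, forall x : MR, - N%:R < (x : R) < N%:R -> derivable u x 1}.
Proof.
pose E : set MR := `](- N%:R : R), N%:R]%classic.
have mE : measurable E by exact: measurable_itv.
have NN : - N%:R <= N%:R :> R by rewrite ge0_cp.
have nuE : (nu E < +oo)%E by rewrite nu_itv // ltry.
pose nuN : {finite_measure set MR -> \bar R} := mfrestr mE nuE.
have nuN0 : nuN `<< leb.
  move=> A A0 B mB BA; apply/eqP; rewrite eq_le measure_ge0 andbT.
  apply: (@le_trans _ _ (nu B)).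
    by apply: le_measure; rewrite ?inE //; exact: measurableI.
  by apply: le_trans (nu_le B) _; rewrite (A0 B mB BA) mule0.
have [f [f0 ffin fint fE]] := radon_nikodym_sigma_finite nuN0.
pose g (x : R) : R := fine (f x).
have gE : EFin \o g = f by apply/funext => x /=; rewrite /g fineK.
have gint : leb.-integrable [set: MR] (EFin \o g) by rewrite gE.
have gloc : locally_integrable [set: R] g.
  by apply: open_integrable_locally => //; exact: openT.
have gint' (y : R) : leb.-integrable `]- N%:R, y] (EFin \o g).
  by apply: integrableS gint => //; exact: measurable_itv.
have := FTC1 gint' gloc.
apply: filterS; first exact: (ae_filter_ringOfSetsType leb).
move=> x /= h /andP[x1 x2].
have [dF _] := h x1.
have dG : derivable G x 1.
  have : derivable (fun y : R => Rintegral leb `]- N%:R, y] g + G (- N%:R)) x 1.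
    by apply: derivableD => //; exact: derivable_cst.
  apply: near_eq_derivable; near=> y.
  have yN : - N%:R <= y <= N%:R.
    have : y \in `](- N%:R), N%:R[.
      by near: y; apply: near_in_itvoo; rewrite in_itv /= x1 x2.
    by rewrite in_itv /= => /andP[/ltW -> /ltW ->].
  rewrite /Rintegral (_ : (fun x => _) = f) // -fE; last exact: measurable_itv.
  have -> : nuN `](- N%:R : R), y]%classic = nu `](- N%:R : R), y]%classic.
    have sub : (`](- N%:R), y]%classic : set R) `<=` `](- N%:R), N%:R]%classic.
      by apply: subset_itvl; rewrite bnd_simp; case/andP: yN.
    by rewrite /nuN /= /mfrestr /mrestr (setIidl sub).
  by case/andP: yN => yN _; rewrite nu_itv //= subrK.
have -> : u = (fun y => G y - K * y) by apply/funext => y; rewrite /G addrK.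
apply: derivableB => //; apply: derivableM => //; exact: derivable_cst.
Unshelve. all: by end_near. Qed.

(** The Stieltjes measure of u + K x is at most 2 K times Lebesgue measure, hence has a density by
    Radon-Nikodym; u + K x is then locally a primitive of an integrable function, to which the
    fundamental theorem of calculus applies. Bounded windows keep the measure finite. *)
Lemma lipschitz_derivable_ae : {ae leb, forall x : MR, derivable u x 1}.
Proof.
have : {ae leb, forall (x : MR) (N : nat), - N%:R < (x : R) < N%:R -> derivable u x 1}.
  by apply: ae_foralln => N; exact: derivable_ball.
apply: negligibleS => x /= nd h; apply: nd.
by apply: (h (Num.truncn `|x|).+1); rewrite -ltr_norml; exact: truncnS_gt.
Qed.

End LipschitzDerivable.

(** * Nearly planar sets *)

(** The factor is the determinant s t of a diagonal map, where a plain Lipschitz bound would only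
    give max(s, t)^2. The area and coarea bounds with sharp constants depend on this gain. *)
Lemma hausdorff_linear_bound {R : realType} {n : nat} {T : Type} (A : set T)
    (f : T -> 'rV[R]_n) (g : T -> (measurableTypeR R * measurableTypeR R)%type) (s t : R) :
  0 < s -> 0 < t ->
  (forall x y, A x -> A y -> edist (f x) (f y) ^+ 2 <=
     s ^+ 2 * ((g x).1 - (g y).1 : R) ^+ 2 + t ^+ 2 * ((g x).2 - (g y).2 : R) ^+ 2) ->
  (hausdorff 2 (f @` A) <= (s * t)%:E * hausdorff 2 (diag 1 1 @` (g @` A)))%E.
Proof.
move=> s0 t0 fg; apply: le_trans (hausdorff_diag _ s0 t0).
rewrite image_comp -[leRHS]mul1e.
have := @hausdorff_map R _ _ _ 1 1 A f (diag s t \o g) ltr01; rewrite expr1n; apply.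
move=> x y Ax Ay; rewrite mul1r; apply: sqrt_le_of_sqr; first exact: edist_ge0.
by rewrite sqr_edist_diag; exact: fg.
Qed.

(** Orthogonal projection of A to the plane of e and v is injective, and its inverse stretches
    distances by at most sqrt(1 + eps). *)
Definition near_planar {R : realType} {n : nat} (eps : R) (A : set 'rV[R]_n) : Prop :=
  exists e v : 'rV[R]_n, [/\ dotp e e = 1, dotp v v = 1, dotp e v = 0 &
    forall p q, A p -> A q ->
      edist p q ^+ 2 <= (1 + eps) * (dotp (p - q) e ^+ 2 + dotp (p - q) v ^+ 2)].

Lemma near_planar_closure {R : realType} {n : nat} (eps : R) (A : set 'rV[R]_n) :
  0 <= eps -> near_planar eps A -> near_planar eps (closure A).
Proof.
move=> eps0 [e [v [ee vv ev h]]]; exists e, v; split => // p q Ap Aq.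
have e1 : enorm e = 1 by rewrite /enorm ee sqrtr1.
have v1 : enorm v = 1 by rewrite /enorm vv sqrtr1.
set X := dotp (p - q) e; set Y := dotp (p - q) v; set D := edist p q.
have D0 : 0 <= D by exact: edist_ge0.
(* Points of A at distance less than t/2 from p and q satisfy the inequality exactly; replacing them
   by p and q costs an explicit multiple of t. *)
have key (t : R) : 0 < t -> t <= 1 -> D ^+ 2 <= (1 + eps) * (X ^+ 2 + Y ^+ 2) +
    t * (2 * D + (1 + eps) * (2 * `|X| + 2 * `|Y| + 2)).
  move=> t0 t1; have t20 : 0 < t / 2 by rewrite divr_gt0.
  have nx (z : 'rV[R]_n) : nbhs z (eball z (t / 2)) by apply/nbhs_eball; exists (t / 2).
  have [p' [Ap' pp']] := Ap _ (nx p); have [q' [Aq' qq']] := Aq _ (nx q).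
  rewrite /eball /= in pp' qq'.
  have dd : enorm ((p - q) - (p' - q')) <= t.
    have -> : (p - q) - (p' - q') = (p - p') + - (q - q').
      by rewrite !opprD !opprK; apply/rowP => i; rewrite !mxE; ring.
    apply: le_trans (enormD _ _) _; rewrite enormN.
    by move: pp' qq'; rewrite /edist; lra.
  have := h _ _ Ap' Aq'; set X' := dotp (p' - q') e; set Y' := dotp (p' - q') v.
  set D' := edist p' q' => hD.
  have hX : `|X - X'| <= t.
    rewrite /X /X' -dotpBl; apply: le_trans (dotp_norm_le _ _) _.
    by rewrite e1 mulr1.
  have hY : `|Y - Y'| <= t.
    rewrite /Y /Y' -dotpBl; apply: le_trans (dotp_norm_le _ _) _.
    by rewrite v1 mulr1.
  have hDD : D <= D' + t.
    have -> : D = enorm ((p' - q') + ((p - q) - (p' - q'))) by rewrite addrC subrK.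
    by apply: le_trans (enormD _ _) _; rewrite lerD2l.
  have D'0 : 0 <= D' by exact: edist_ge0.
  have h1 : D ^+ 2 <= D' ^+ 2 + 2 * t * D.
    have [Dt|Dt] := leP D t; first by have := sqr_ge0 D'; nra.
    have : (D - t) ^+ 2 <= D' ^+ 2 by rewrite lerXn2r ?nnegrE //; lra.
    have := sqr_ge0 t; nra.
  have sq (a b : R) : `|a - b| <= t -> b ^+ 2 <= a ^+ 2 + t * (2 * `|a| + 1).
    move=> hab; have hb : `|b| <= `|a| + t.
      have -> : b = a + - (a - b) by rewrite opprB addrC subrK.
      by apply: le_trans (ler_normD _ _) _; rewrite normrN lerD2l.
    rewrite -(real_normK (num_real b)) -(real_normK (num_real a)).
    have : `|b| ^+ 2 <= (`|a| + t) ^+ 2 by rewrite lerXn2r ?nnegrE ?addr_ge0 ?(ltW t0).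
    have := normr_ge0 a; nra.
  have h2 := sq _ _ hX; have h3 := sq _ _ hY.
  have h4 : (1 + eps) * (X' ^+ 2 + Y' ^+ 2) <=
     (1 + eps) * (X ^+ 2 + t * (2 * `|X| + 1) + (Y ^+ 2 + t * (2 * `|Y| + 1))).
    by rewrite ler_wpM2l ?addr_ge0 //; lra.
  apply: le_trans h1 _; apply: le_trans (lerD (le_trans hD h4) (lexx _)) _.
  by rewrite le_eqVlt; apply/orP; left; apply/eqP; ring.
set C := 2 * D + (1 + eps) * (2 * `|X| + 2 * `|Y| + 2) in key.
have C0 : 0 < C.
  have X0 := normr_ge0 X; have Y0 := normr_ge0 Y.
  rewrite /C; apply: ltr_wpDl; first by rewrite mulr_ge0.
  by apply: mulr_gt0; lra.
apply/ler_addgt0Pr => r r0; pose t := Num.min 1 (r / C).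
have t0 : 0 < t by rewrite lt_min ltr01 divr_gt0.
apply: le_trans (key t t0 _) _; first by rewrite ge_min lexx.
by rewrite lerD2l -ler_pdivlMr // ge_min lexx orbT.
Qed.

(* Gram-Schmidt on [q1], [q2]; an [eta]-small relative error off their span. *)
Lemma near_planar_of_affine {R : realType} {n : nat} {T : Type} (A : set T)
    (f : T -> 'rV[R]_n) (a b : T -> T -> R) (q1 q2 : 'rV[R]_n) (eta eps : R) :
  0 < eta -> eta <= 1 / 2 -> 2 * eta <= eps ->
  (forall s t, s != 0 \/ t != 0 -> s *: q1 + t *: q2 != 0) ->
  (forall x y, A x -> A y -> enorm (f x - f y - (a x y *: q1 + b x y *: q2)) <=
     eta * enorm (a x y *: q1 + b x y *: q2)) ->
  near_planar eps (f @` A).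
Proof.
move=> eta0 eta2 etaeps free h.
have q10 : q1 != 0.
  have := free 1 0; rewrite scale1r scale0r addr0; apply; left; exact: oner_neq0.
have nq1 : 0 < enorm q1 by rewrite enorm_gt0.
have unit (x : 'rV[R]_n) : 0 < enorm x ->
    exists e, [/\ dotp e e = 1, x = enorm x *: e & e = (enorm x)^-1 *: x].
  move=> x0; exists ((enorm x)^-1 *: x); split => //.
    by rewrite dotpZl dotpZr -sqr_enorm; field; exact: lt0r_neq0.
  by rewrite scalerA mulfV ?lt0r_neq0 // scale1r.
have [e [ee q1E eE]] := unit _ nq1.
pose w := q2 - dotp q2 e *: e.
have w0 : w != 0.
  have -> : w = (- (dotp q2 e / enorm q1)) *: q1 + 1 *: q2.
    by rewrite /w {2}eE scalerA scale1r scaleNr addrC.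
  by apply: free; right; exact: oner_neq0.
have nw : 0 < enorm w by rewrite enorm_gt0.
have [v [vv wE vE]] := unit _ nw.
have ev : dotp e v = 0.
  have ew : dotp e w = 0 by rewrite /w dotpBr dotpZr ee mulr1 (dotpC e) subrr.
  by rewrite vE dotpZr ew mulr0.
have q2E : q2 = dotp q2 e *: e + enorm w *: v by rewrite -wE /w addrC subrK.
exists e, v; split => // _ _ [x Ax <-] [y Ay <-].
set u := f x - f y; have := h x y Ax Ay; rewrite -/u.
set z := a x y *: q1 + b x y *: q2; set rho := u - z => hr.
pose P (t : 'rV[R]_n) := dotp t e *: e + dotp t v *: v.
have Pz : P z = z.
  have zE : exists c d, z = c *: e + d *: v.
    exists (a x y * enorm q1 + b x y * dotp q2 e), (b x y * enorm w).
    rewrite /z q2E {1}q1E; apply/rowP => i; rewrite !mxE.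
    have -> : dotp (dotp q2 e *: e + enorm w *: v) e = dotp q2 e.
      by rewrite !dotpE ee (dotpC v) ev mulr0 addr0 mulr1.
    by ring.
  have [c [d ->]] := zE; rewrite /P !dotpE ee vv (dotpC v) ev.
  by rewrite !mulr0 !mulr1 addr0 add0r.
have PD t1 t2 : P (t1 + t2) = P t1 + P t2.
  by rewrite /P !dotpE !scalerDl addrACA.
have nP t : enorm (P t) ^+ 2 = dotp t e ^+ 2 + dotp t v ^+ 2.
  by rewrite sqr_enorm /P !dotpE ee vv (dotpC v) ev; ring.
have pyth t : enorm t ^+ 2 = enorm (P t) ^+ 2 + enorm (t - P t) ^+ 2.
  rewrite nP !sqr_enorm /P !dotpE ee vv (dotpC v e) ev (dotpC e t) (dotpC v t); ring.
have uE : u = z + rho by rewrite /rho addrC subrK.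
have uPu : u - P u = rho - P rho.
  by rewrite uE PD Pz opprD addrACA subrr add0r.
have r1 : enorm (u - P u) ^+ 2 <= (eta * enorm z) ^+ 2.
  have := pyth rho; rewrite -uPu => hp.
  have : enorm rho ^+ 2 <= (eta * enorm z) ^+ 2.
    by rewrite lerXn2r ?nnegrE ?mulr_ge0 ?enorm_ge0 ?(ltW eta0).
  by have := sqr_ge0 (enorm (P rho)); lra.
have r2 : (1 - eta) * enorm z <= enorm (P u).
  have hz : enorm z <= enorm (P u) + enorm (P rho).
    have -> : z = P u + - P rho by rewrite uE PD Pz addrK.
    by rewrite -(enormN (P rho)); exact: enormD.
  have : enorm (P rho) <= enorm rho.
    by apply: sqrt_le_of_sqr; [exact: enorm_ge0|rewrite (pyth rho) lerDl sqr_ge0].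
  lra.
rewrite /edist -/u -nP (pyth u) mulrDl mul1r lerD2l.
apply: le_trans r1 _.
have nz := enorm_ge0 z; have nPu := enorm_ge0 (P u).
have hh : enorm z <= 2 * enorm (P u) by nra.
have : (eta * enorm z) ^+ 2 <= (eta * (2 * enorm (P u))) ^+ 2.
  by rewrite lerXn2r ?nnegrE ?mulr_ge0 ?(ltW eta0) // ler_wpM2l ?(ltW eta0).
move/le_trans; apply; rewrite exprMn exprMn mulrA ler_wpM2r ?sqr_ge0 //.
nra.
Qed.

(** The radii are reciprocals of integers so that approximability can later be expressed by
    countable operations on sets. *)
Lemma derivable_affine_approx {R : realType} (f : R -> R) (x : R) :
  derivable f x 1 -> exists L : R, forall e : R, 0 < e ->
    exists2 k : nat, True & forall t : R, `|t| <= k.+1%:R^-1 ->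
      `|f (x + t) - f x - t * L| <= e * `|t|.
Proof.
move=> /cvg_ex[/= L fL]; exists L => e e0.
have /cvgrPdist_le/(_ e e0) := fL.
move=> /nbhs_ballP[d /= d0 hd].
have [k] := ltr_add_invr d0; rewrite add0r => kd.
exists k => // t tk; have [->|t0] := eqVneq t 0.
  by rewrite addr0 subrr mul0r subr0 normr0 mulr0.
have := hd t; rewrite -ball_normE /ball_ /= sub0r normrN => /(_ (le_lt_trans tk kd) t0).
rewrite /GRing.scale /= mulr1 (addrC t x) => h.
have -> : f (x + t) - f x - t * L = - t * (L - t^-1 * (f (x + t) - f x)).
  by field.
by rewrite normrM normrN mulrC ler_wpM2r.
Qed.

(** * Partial derivatives of Lipschitz maps of the plane *)

Section LipschitzPlane.
Context {R : realType} {n : nat}.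
Local Notation MR := (measurableTypeR R).
Local Notation RR := (MR * MR)%type.
Local Notation leb := (@lebesgue_measure R).
Local Notation V := 'rV[R]_n.
Local Notation D := (diag (1 : R) 1).
Variables (phi : RR -> V) (K : R).
Hypotheses (K0 : 0 < K) (phiK : forall p q, edist (phi p) (phi q) <= K * edist (D p) (D q)).

Let phi_l1 p q : edist (phi p) (phi q) <= K * (`|p.1 - q.1 : R| + `|p.2 - q.2 : R|).
Proof. by apply: le_trans (phiK p q) _; rewrite ler_pM2l // edist_diag1_le. Qed.

Definition shift (i : bool) (p : RR) (t : R) : RR :=
  if i then ((p.1 : R) + t : R, p.2) else (p.1, (p.2 : R) + t : R).

Definition dir_affine (i : bool) (q : V) (e d : R) : set RR :=
  [set p | forall t, `|t| <= d -> enorm (phi (shift i p t) - phi p - t *: q) <= e * `|t|].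

Lemma measurable_dir_affine i q e d : measurable (dir_affine i q e d).
Proof.
rewrite -[X in measurable X]setCK; apply: measurableC.
apply: measurable_open_plane => p /= /existsNP[t /not_implyP[td /negP]].
rewrite -ltNge => h.
pose g := enorm (phi (shift i p t) - phi p - t *: q) - e * `|t|.
have g0 : 0 < g by rewrite subr_gt0.
(* Moving p by less than this in each coordinate changes phi at either end of the increment by at
   most 2 g/5, in total less than the excess g. *)
exists (g / (5 * K)) => [|p' h1 h2]; first by rewrite divr_gt0 // mulr_gt0.
move=> /(_ t td); apply/negP; rewrite -ltNge.
have close p1 p2 : `|p2.1 - p1.1 : R| < g / (5 * K) -> `|p2.2 - p1.2 : R| < g / (5 * K) ->
    enorm (phi p1 - phi p2) <= 2 * g / 5.
  move=> a1 a2; apply: le_trans (phi_l1 p1 p2) _; rewrite (distrC p1.1) (distrC p1.2).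
  apply: (@le_trans _ _ (K * (g / (5 * K) + g / (5 * K)))).
    by rewrite ler_pM2l // lerD // ltW.
  by rewrite le_eqVlt; apply/orP; left; apply/eqP; field; rewrite lt0r_neq0.
have c1 := close p p' h1 h2.
have c2 : enorm (phi (shift i p t) - phi (shift i p' t)) <= 2 * g / 5.
  apply: close; case: (i); rewrite /= ?[_ + t - _]opprD ?addrA //.
  - by rewrite (_ : p'.1 + t - (p.1 + t) = p'.1 - p.1 :> R) //; ring.
  - by rewrite (_ : p'.2 + t - (p.2 + t) = p'.2 - p.2 :> R) //; ring.
have tri : enorm (phi (shift i p t) - phi p - t *: q) <=
    enorm (phi (shift i p' t) - phi p' - t *: q) +
    (enorm (phi (shift i p t) - phi (shift i p' t)) + enorm (phi p - phi p')).
  rewrite -(enormN (phi p - phi p')).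
  apply: le_trans (le_trans (enormD _ _) (lerD (lexx _) (enormD _ _))).
  rewrite le_eqVlt; apply/orP; left; apply/eqP; congr enorm.
  by apply/rowP => j; rewrite !mxE; ring.
move: tri g0; rewrite /g => tri g0; rewrite /g in c1 c2; lra.
Qed.

(** A measurable surrogate for the existence of the partial derivative along axis i: rational
    vectors and reciprocal scales leave only countable unions and intersections of measurable
    sets. *)
Definition dir_derivable (i : bool) : set RR :=
  \bigcap_m \bigcup_(qk in [set: 'rV[rat]_n * nat])
    dir_affine i (map_mx ratr qk.1) m.+1%:R^-1 qk.2.+1%:R^-1.

Lemma measurable_bigcup_count {J : countType} (F : J -> set RR) :
  (forall i, measurable (F i)) -> measurable (\bigcup_i F i).
Proof.
move=> mF; have -> : \bigcup_i F i =
    \bigcup_k (if unpickle k is Some i then F i else set0).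
  apply/seteqP; split => [p [i _ Fp]|p [k _]].
    by exists (pickle i); [exact: I|rewrite pickleK].
  by case: unpickle => // i Fp; exists i.
by apply: bigcup_measurable => k _; case: unpickle.
Qed.

Lemma measurable_dir_derivable i : measurable (dir_derivable i).
Proof.
apply: bigcap_measurable => // m _; apply: measurable_bigcup_count => qk.
exact: measurable_dir_affine.
Qed.

Lemma dir_derivable_of i p :
  (forall j, derivable (fun t : R => phi (shift i p t) ord0 j) 0 1) -> dir_derivable i p.
Proof.
move=> dphi m _; have [L hL] := choice (fun j => derivable_affine_approx (dphi j)).
(* Each of the n coordinates contributes an error e from the derivative and e from its rational
   approximation; n + 1 allows n = 0. *)
pose e : R := m.+1%:R^-1 / (2 * n.+1%:R).
have n0 : 0 < n.+1%:R :> R by rewrite ltr0n.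
have e0 : 0 < e by rewrite divr_gt0 ?mulr_gt0 // invr_gt0 ltr0n.
have [k hk] := choice (fun j => let: ex_intro2 k _ h := hL j e e0 in ex_intro _ k h).
have exq j : exists q : rat, `|L j - ratr q| <= e.
  have [|q] := @rat_in_itvoo R (L j - e) (L j + e); first by lra.
  rewrite in_itv /= => /andP[q1 q2]; exists q.
  by rewrite ler_norml; apply/andP; split; lra.
have [q hq] := choice exq.
pose kk := \max_j k j.
exists ((\row_j q j), kk) => // t /= tk.
apply: le_trans (enorm_le_sum _) _.
apply: (@le_trans _ _ (\sum_(j < n) (2 * e * `|t|))).
  apply: ler_sum => j _; rewrite !mxE.
  have tj : `|t| <= (k j).+1%:R^-1.
    apply: le_trans tk _; rewrite lef_pV2 ?posrE ?ltr0n // ler_nat ltnS.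
    exact: leq_bigmax.
  have := hk j t tj; rewrite add0r.
  have -> : phi (shift i p 0) = phi p.
    by rewrite /shift; case: (i); rewrite addr0; case: (p).
  set A := phi _ ord0 j - phi p ord0 j => hA.
  have -> : A - t * ratr (q j) = (A - t * L j) + t * (L j - ratr (q j)) by ring.
  apply: le_trans (ler_normD _ _) _; rewrite normrM.
  have := ler_wpM2l (normr_ge0 t) (hq j); lra.
rewrite sumr_const card_ord -[_ *+ _]mulr_natl /e.
have : (n%:R : R) <= n.+1%:R by rewrite ler_nat.
have t0 := normr_ge0 t.
have -> : n%:R * (2 * (m.+1%:R^-1 / (2 * n.+1%:R)) * `|t|) = (n%:R / n.+1%:R) * (m.+1%:R^-1 * `|t|).
  by field; rewrite lt0r_neq0 //= pnatr_eq0.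
move=> nn; rewrite -[leRHS]mul1r; apply: ler_wpM2r.
  by rewrite mulr_ge0 // invr_ge0.
by rewrite ler_pdivrMr // mul1r.
Qed.

Let line_ae (i : bool) (p : RR) :
  {ae leb, forall t : MR, forall j, derivable (fun s : R => phi (shift i p s) ord0 j) t 1}.
Proof.
have lip j : forall s t : R, `|phi (shift i p s) ord0 j - phi (shift i p t) ord0 j| <= K * `|s - t|.
  move=> s t; have := coord_le_enorm (phi (shift i p s) - phi (shift i p t)) j.
  rewrite !mxE => /le_trans; apply; apply: le_trans (phi_l1 _ _) _.
  rewrite ler_pM2l // /shift; case: (i) => /=.
    by rewrite (_ : p.1 + s - (p.1 + t) = s - t :> R) ?subrr ?normr0 ?addr0 //; ring.
  by rewrite (_ : p.2 + s - (p.2 + t) = s - t :> R) ?subrr ?normr0 ?add0r //; ring.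
have h j := lipschitz_derivable_ae K0 (lip j).
(* Coordinates are reindexed by natural numbers so that [ae_foralln] can collect the finitely many
   null sets. *)
pose P (k : nat) (t : MR) := forall j : 'I_n, k = j -> derivable (fun s : R => phi (shift i p s) ord0 j) t 1.
have : {ae leb, forall (t : MR) (k : nat), P k t}.
  apply: ae_foralln => k; have [kn|kn] := ltnP k n.
    have := h (Ordinal kn); apply: negligibleS => t nP hP; apply: nP => j kj.
    by rewrite (_ : j = Ordinal kn) //; apply: val_inj.
  have := h; case: (pselect (exists j : 'I_n, true)) => [[j _] hj|nj _].
    have := hj j; apply: negligibleS => t nP _; apply: nP => j' kj.
    by move: kn; rewrite kj leqNgt ltn_ord.
  apply: (@negligibleS _ _ _ _ set0); last exact: negligible_set0.
  by move=> t nP; apply: nP => j; exfalso; apply: nj; exists j.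
by apply: negligibleS => t nP hP; apply: nP => j; exact: hP.
Qed.

Let line_null (i : bool) (p : RR) :
  leb.-negligible [set t : MR | ~ dir_derivable i (shift i p t)].
Proof.
have := line_ae i p; apply: negligibleS => t nd hj; apply: nd.
apply: dir_derivable_of => j.
have -> : (fun s : R => phi (shift i (shift i p t) s) ord0 j) =
    (fun s : R => phi (shift i p s) ord0 j) \o (fun s : R => t + s).
  apply/funext => s /=; congr (phi _ ord0 j); rewrite /shift; case: (i) => /=;
  by rewrite addrA.
apply/derivable1_diffP/differentiable_comp; apply/derivable1_diffP.
  by apply: derivableD; [exact: derivable_cst|exact: derivable_id].
by rewrite addr0; exact: hj.
Qed.

(** Every line parallel to axis i meets the complement in a null set, so Fubini applies; for the
    first axis the product measure is rewritten with the other order of integration. *)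
Lemma dir_derivable_full i : (leb \x leb)%E (~` dir_derivable i) = 0%E.
Proof.
have mD := measurableC (measurable_dir_derivable i).
case: i mD => mD; last first.
  rewrite /product_measure1; apply: integral0_eq => x _ /=.
  apply: measure_negligible; first exact: measurable_xsection.
  have := line_null false (x, (0 : R)); apply: negligibleS => y /=.
  by rewrite /xsection /= inE /shift /= add0r.
transitivity ((leb \x^ leb)%E (~` dir_derivable true)).
  by apply: product_measure_unique => // A B mA mB; exact: product_measure2E.
rewrite /product_measure2; apply: integral0_eq => y _ /=.
apply: measure_negligible; first exact: measurable_ysection.
have := line_null true ((0 : R), y); apply: negligibleS => x /=.
by rewrite /ysection /= inE /shift /= add0r.
Qed.

End LipschitzPlane.

(** * Pieces of the plane on which a Lipschitz map is nearly affine *)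

Section Pieces.
Context {R : realType} {n : nat}.
Local Notation MR := (measurableTypeR R).
Local Notation RR := (MR * MR)%type.
Local Notation leb := (@lebesgue_measure R).
Local Notation V := 'rV[R]_n.
Local Notation D := (diag (1 : R) 1).
Local Notation one := (1%:pos : {posnum R})%R.
Variables (phi : RR -> V) (K : R).
Hypotheses (K0 : 0 < K) (phiK : forall p q, edist (phi p) (phi q) <= K * edist (D p) (D q)).

Let phi_l1 p q : edist (phi p) (phi q) <= K * (`|p.1 - q.1 : R| + `|p.2 - q.2 : R|).
Proof. by apply: le_trans (phiK p q) _; rewrite ler_pM2l // edist_diag1_le. Qed.

Definition piece_index : countType :=
  ('rV[rat]_n * 'rV[rat]_n * nat * (int * int))%type.

Definition vq (q : 'rV[rat]_n) : V := map_mx ratr q.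

Definition cell (k : nat) (i j : int) : set RR :=
  rect (i%:~R / k.+1%:R) ((i + 1)%:~R / k.+1%:R) (j%:~R / k.+1%:R) ((j + 1)%:~R / k.+1%:R).

(** The increments along both axes are approximated by the same vectors q1 and q2, up to a length
    equal to the side of the cell; on a piece phi is therefore close to a single affine map. *)
Definition piece (m : nat) (J : piece_index) : set RR :=
  let: (q1, q2, k, (i, j)) := J in
  dir_affine phi true (vq q1) m.+1%:R^-1 k.+1%:R^-1 `&`
  dir_affine phi false (vq q2) m.+1%:R^-1 k.+1%:R^-1 `&` cell k i j.

Lemma measurable_piece m J : measurable (piece m J).
Proof.
case: J => [[[q1 q2] k] [i j]]; apply: measurableI; last exact: measurable_rect.
by apply: measurableI; exact: measurable_dir_affine K0 phiK _ _ _ _.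
Qed.

Lemma cell_dist k i j (p q : RR) : cell k i j p -> cell k i j q ->
  `|p.1 - q.1 : R| <= k.+1%:R^-1 /\ `|p.2 - q.2 : R| <= k.+1%:R^-1.
Proof.
case: p q => [x y] [x' y'] /rectP/andP[/andP[h1 h2] /andP[h3 h4]].
move=> /rectP/andP[/andP[h5 h6] /andP[h7 h8]] /=.
have e (z : int) : (z + 1)%:~R / k.+1%:R = z%:~R / k.+1%:R + k.+1%:R^-1 :> R.
  by rewrite intrD mulrDl mul1r.
rewrite !e in h2 h4 h6 h8.
move: h1 h2 h3 h4 h5 h6 h7 h8.
move: (k.+1%:R^-1) (i%:~R / _) (j%:~R / _) => r a b h1 h2 h3 h4 h5 h6 h7 h8.
by rewrite !ler_norml; split; apply/andP; split; lra.
Qed.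

Lemma cell_cover k (p : RR) : exists i j, cell k i j p.
Proof.
have k0 : 0 < k.+1%:R :> R by rewrite ltr0n.
have ex (x : R) : exists i : int, i%:~R / k.+1%:R < x <= (i + 1)%:~R / k.+1%:R.
  exists (Num.ceil (x * k.+1%:R) - 1); rewrite subrK.
  rewrite ltr_pdivrMr // ler_pdivlMr //.
  by have := ceil_itv (x * k.+1%:R).
case: p => x y; have [i hi] := ex x; have [j hj] := ex y.
by exists i, j; apply/rectP; rewrite hi hj.
Qed.

(* Going from [p] to [p'] along the first axis starting at [p] and along the
   second axis ending at [p'] only uses the increments at these two points. *)
Lemma piece_affine m q1 q2 k ij p p' :
  piece m (q1, q2, k, ij) p -> piece m (q1, q2, k, ij) p' ->
  enorm (phi p' - phi p - ((p'.1 - p.1 : R) *: vq q1 + (p'.2 - p.2 : R) *: vq q2)) <=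
    m.+1%:R^-1 * (`|p'.1 - p.1 : R| + `|p'.2 - p.2 : R|).
Proof.
case: ij => i j [[h1 h2] hc] [[h1' h2'] hc'].
have [d1 d2] := cell_dist hc' hc.
have a1 := h1 _ d1; have := h2' (- (p'.2 - p.2 : R)); rewrite normrN => /(_ d2) a2.
have e1 : shift true p (p'.1 - p.1) = (p'.1, p.2) by rewrite /shift addrC subrK.
have e2 : shift false p' (- (p'.2 - p.2 : R)) = (p'.1, p.2).
  by rewrite /shift opprB addrC subrK.
rewrite e1 in a1; rewrite e2 in a2.
rewrite mulrDr; apply: le_trans _ (lerD a1 a2).
rewrite -[in leRHS](enormN (_ - _ - - _ *: _)).
apply: le_trans _ (enormD _ _).
rewrite le_eqVlt; apply/orP; left; apply/eqP; congr enorm.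
by apply/rowP => l; rewrite !mxE; ring.
Qed.

Lemma dir_derivable_piece m k0 p : dir_derivable phi true p -> dir_derivable phi false p ->
  exists J : piece_index, (k0 <= J.1.2)%N /\ piece m J p.
Proof.
move=> /(_ m I)[[q1 k1] _ h1] /(_ m I)[[q2 k2] _ h2].
pose k := (k0 + k1 + k2)%N; have [i [j cij]] := cell_cover k p.
have mono (k' : nat) (t : R) : (k' <= k)%N -> `|t| <= k.+1%:R^-1 -> `|t| <= k'.+1%:R^-1.
  by move=> kk /le_trans; apply; rewrite lef_pV2 ?posrE ?ltr0n // ler_nat ltnS.
exists (q1, q2, k, (i, j)); split; first by rewrite /= /k -addnA leq_addr.
split => //; split => t tk; [apply: h1|apply: h2]; apply: mono tk => /=.
  by rewrite /k; lia.
by rewrite /k; lia.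
Qed.

(** The linear part is nondegenerate by a margin M times the approximation error 1/(m + 1). *)
Definition good (M : R) (m : nat) (J : piece_index) : Prop :=
  forall s t : R, M * m.+1%:R^-1 * (`|s| + `|t|) <= enorm (s *: vq J.1.1.1 + t *: vq J.1.1.2).

Lemma good_near_planar (M eps : R) m J : 2 <= M -> 2 <= eps * M -> good M m J ->
  near_planar eps (phi @` piece m J).
Proof.
move=> M2 Me g; case: J g => [[[q1 q2] k] ij] g.
have m0 : 0 < m.+1%:R^-1 :> R by rewrite invr_gt0 ltr0n.
have M0 : 0 < M by lra.
apply: (@near_planar_of_affine _ _ _ _ _ (fun p p' : RR => p.1 - p'.1 : R)
   (fun p p' : RR => p.2 - p'.2 : R) (vq q1) (vq q2) M^-1).
- by rewrite invr_gt0.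
- by rewrite -div1r ler_pdivrMr //; lra.
- by rewrite ler_pdivrMr.
- move=> s t st; rewrite -enorm_gt0; apply: lt_le_trans (g s t).
  rewrite !mulr_gt0 //; case: st => [s0|t0].
    by rewrite ltr_wpDr // normr_gt0.
  by rewrite ltr_wpDl // normr_gt0.
- move=> p p' Ap Ap'; apply: le_trans (piece_affine Ap' Ap) _.
  rewrite -ler_pdivrMl ?invr_gt0 // invrK mulrA; exact: g.
Qed.

Lemma diag1_rot (c d : R) (A : set RR) : c ^+ 2 + d ^+ 2 = 1 ->
  hausdorff 2 (D @` ((fun p : RR => ((c * p.1 + d * p.2 : R), (- d * p.1 + c * p.2 : R)) : RR) @` A))
  = hausdorff 2 (D @` A).
Proof.
move=> cd; rewrite image_comp; apply: hausdorff_iso => p q _ _.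
apply/eqP; rewrite -(@eqrXn2 _ 2) ?edist_ge0 // !sqr_edist_diag /= expr1n !mul1r.
apply/eqP; rewrite -[RHS]mul1r -cd; ring.
Qed.

(** In some unit direction (c, d) the linear part has norm O(1/(m + 1)), and its columns are bounded
    by K + 1. In coordinates rotated to that direction, [hausdorff_linear_bound] gives a factor
    O(1/(m + 1)), which vanishes as m grows. *)
Lemma bad_piece_null (M : R) m J (A : set RR) : 0 <= M -> ~ good M m J -> A `<=` piece m J ->
  (hausdorff 2 (phi @` A) <=
   (4 * (M + 1) * (4 * (K + 2)) / m.+1%:R)%:E * hausdorff 2 (D @` A))%E.
Proof.
move=> M0; case: J => [[[q1 q2] k] ij] /existsNP[s /existsNP[t /negP]].
rewrite -ltNge /= => st AP; set e : R := m.+1%:R^-1.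
have e0 : 0 < e by rewrite invr_gt0 ltr0n.
have e1 : e <= 1 by rewrite invf_le1 ?ltr0n // ler1n.
have [->|/set0P[p0 Ap0]] := eqVneq A set0.
  by rewrite !image_set0 !hausdorff_set0 mule0.
pose rho := Num.sqrt (s ^+ 2 + t ^+ 2).
have ss := sqr_ge0 s; have tt := sqr_ge0 t.
have rho2 : rho ^+ 2 = s ^+ 2 + t ^+ 2 by rewrite sqr_sqrtr // addr_ge0.
have rhoge : 0 <= rho by exact: sqrtr_ge0.
have sr : `|s| <= rho by apply: sqrt_le_of_sqr => //; rewrite real_normK ?num_real // rho2; lra.
have tr : `|t| <= rho by apply: sqrt_le_of_sqr => //; rewrite real_normK ?num_real // rho2; lra.
have rho0 : 0 < rho.
  rewrite lt_def rhoge andbT; apply/negP => /eqP r0; move: st.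
  rewrite r0 in sr tr.
  have -> : s = 0 by apply/normr0_eq0/eqP; rewrite eq_le sr normr_ge0.
  have -> : t = 0 by apply/normr0_eq0/eqP; rewrite eq_le tr normr_ge0.
  by rewrite !normr0 addr0 mulr0 ltNge enorm_ge0.
pose c := s / rho; pose d := t / rho.
have cd : c ^+ 2 + d ^+ 2 = 1.
  by rewrite /c /d !expr_div_n -mulrDl -rho2 mulfV // sqrf_eq0 lt0r_neq0.
have qk : enorm (c *: vq q1 + d *: vq q2) <= 2 * M * e.
  have -> : c *: vq q1 + d *: vq q2 = rho^-1 *: (s *: vq q1 + t *: vq q2).
    by rewrite scalerDr !scalerA ![rho^-1 * _]mulrC.
  rewrite enormZ gtr0_norm ?invr_gt0 // ler_pdivrMl //; apply: le_trans (ltW st) _.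
  have : M * e * (`|s| + `|t|) <= M * e * (2 * rho).
    by rewrite ler_wpM2l ?mulr_ge0 ?(ltW e0) //; lra.
  by move/le_trans; apply; rewrite le_eqVlt; apply/orP; left; apply/eqP; ring.
have c1 : `|c| <= 1.
  by apply: sqrt_le_of_sqr => //; rewrite real_normK ?num_real // expr1n; have := sqr_ge0 d; lra.
have d1 : `|d| <= 1.
  by apply: sqrt_le_of_sqr => //; rewrite real_normK ?num_real // expr1n; have := sqr_ge0 c; lra.
clearbody c d.
have Pp0 : piece m (q1, q2, k, ij) p0 by exact: AP.
have k0 : 0 < k.+1%:R^-1 :> R by rewrite invr_gt0 ltr0n.
(* An actual increment of phi has slope at most K, and q differs from that slope by at most e <=
   1. *)
have qb (b : bool) (q : V) : dir_affine phi b q e k.+1%:R^-1 p0 -> enorm q <= K + 1.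
  move=> h; have := h k.+1%:R^-1; rewrite gtr0_norm // lexx => /(_ isT).
  set t0 : R := k.+1%:R^-1 in k0 *; move=> h1.
  have h2 : edist (phi (shift b p0 t0)) (phi p0) <= K * t0.
    apply: le_trans (phi_l1 _ _) _; rewrite ler_pM2l // /shift; case: (b) => /=.
      by rewrite subrr normr0 addr0 (addrC p0.1) addrK gtr0_norm.
    by rewrite subrr normr0 add0r (addrC p0.2) addrK gtr0_norm.
  have h3 : enorm (t0 *: q) <= K * t0 + e * t0.
    have -> : t0 *: q = (phi (shift b p0 t0) - phi p0) +
        - (phi (shift b p0 t0) - phi p0 - t0 *: q) by rewrite opprB addrC subrK.
    by apply: le_trans (enormD _ _) _; rewrite enormN; apply: lerD.
  rewrite enormZ gtr0_norm // mulrC -ler_pdivlMr // in h3.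
  by apply: le_trans h3 _; rewrite -mulrDl mulfK ?lt0r_neq0 // lerD2l.
have [q1b q2b] : enorm (vq q1) <= K + 1 /\ enorm (vq q2) <= K + 1.
  by case: ij Pp0 {AP} => i j [[h1 h2] _]; split; [exact: qb h1|exact: qb h2].
have qp : enorm (- d *: vq q1 + c *: vq q2) <= 2 * (K + 1).
  apply: le_trans (enormD _ _) _; rewrite !enormZ normrN.
  have h1 : `|d| * enorm (vq q1) <= 1 * (K + 1) by apply: ler_pM => //; exact: enorm_ge0.
  have h2 : `|c| * enorm (vq q2) <= 1 * (K + 1) by apply: ler_pM => //; exact: enorm_ge0.
  lra.
pose g (p : RR) : RR := ((c * p.1 + d * p.2 : R), (- d * p.1 + c * p.2 : R)).
rewrite -(diag1_rot A cd).
have -> : 4 * (M + 1) * (4 * (K + 2)) / m.+1%:R = (4 * (M + 1) * e) * (4 * (K + 2)).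
  by rewrite /e; ring.
apply: (@hausdorff_linear_bound _ _ _ A phi g).
- by rewrite !mulr_gt0 //; lra.
- by apply: mulr_gt0 => //; apply: addr_gt0.
move=> p p' Ap Ap'; have h := piece_affine (AP _ Ap') (AP _ Ap).
set a := (g p).1 - (g p').1 : R; set b := (g p).2 - (g p').2 : R.
pose D1 : R := p.1 - p'.1; pose D2 : R := p.2 - p'.2.
have ae : a = c * D1 + d * D2 by rewrite /a /g /D1 /D2 /=; ring.
have be : b = - d * D1 + c * D2 by rewrite /b /g /D1 /D2 /=; ring.
have D1E : D1 = c * a - d * b by rewrite ae be -[LHS]mul1r -cd; ring.
have D2E : D2 = d * a + c * b by rewrite ae be -[LHS]mul1r -cd; ring.
have nab : `|D1| + `|D2| <= 2 * (`|a| + `|b|).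
  have h1 : `|D1| <= `|a| + `|b|.
    rewrite D1E; apply: le_trans (ler_normB _ _) _; rewrite !normrM.
    by apply: lerD; rewrite ler_piMl.
  have h2 : `|D2| <= `|a| + `|b|.
    rewrite D2E; apply: le_trans (ler_normD _ _) _; rewrite !normrM.
    by apply: lerD; rewrite ler_piMl.
  lra.
have lin : enorm (D1 *: vq q1 + D2 *: vq q2) <= `|a| * (2 * M * e) + `|b| * (2 * (K + 1)).
  have -> : D1 *: vq q1 + D2 *: vq q2 =
      a *: (c *: vq q1 + d *: vq q2) + b *: (- d *: vq q1 + c *: vq q2).
    by rewrite D1E D2E; apply/rowP => l; rewrite !mxE; ring.
  apply: le_trans (enormD _ _) _; rewrite !enormZ.
  by apply: lerD; apply: ler_wpM2l.
have fin : edist (phi p) (phi p') <= (2 * (M + 1) * e) * `|a| + (2 * (K + 2)) * `|b|.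
  have -> : edist (phi p) (phi p') = enorm ((phi p - phi p' - (D1 *: vq q1 + D2 *: vq q2)) +
     (D1 *: vq q1 + D2 *: vq q2)) by rewrite subrK.
  apply: le_trans (enormD _ _) _; apply: le_trans (lerD h lin) _.
  rewrite -/D1 -/D2 -/e.
  have h1 : e * (`|D1| + `|D2|) <= e * (2 * (`|a| + `|b|)) by rewrite ler_pM2l.
  have h2 : e * `|b| <= `|b| by rewrite ler_piMl.
  by apply: le_trans (lerD h1 (lexx _)) _; lra.
have sq : edist (phi p) (phi p') ^+ 2 <=
    ((2 * (M + 1) * e) * `|a| + (2 * (K + 2)) * `|b|) ^+ 2.
  rewrite lerXn2r ?nnegrE ?edist_ge0 // ; apply: le_trans fin; exact: edist_ge0.
apply: le_trans sq _.
rewrite -(real_normK (num_real a)) -(real_normK (num_real b)).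
set x := (2 * (M + 1) * e) * `|a|; set y := (2 * (K + 2)) * `|b|.
have -> : (4 * (M + 1) * e) ^+ 2 * `|a| ^+ 2 = 4 * x ^+ 2 by rewrite /x; ring.
have -> : (4 * (K + 2)) ^+ 2 * `|b| ^+ 2 = 4 * y ^+ 2 by rewrite /y; ring.
have := sqr_ge0 (x - y); have := sqr_ge0 x; have := sqr_ge0 y; nra.
Qed.

End Pieces.

Lemma hausdorff_null_bigcup {R : realType} {n : nat} d (F : nat -> set 'rV[R]_n) :
  (forall k, hausdorff d.+1 (F k) = 0%E) -> hausdorff d.+1 (\bigcup_k F k) = 0%E.
Proof.
move=> F0; apply/eqP; rewrite eq_le hausdorff_ge0 andbT.
by apply: le_trans (hausdorff_subadd _ _) _; rewrite eseries0.
Qed.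

Lemma hausdorff_nullS {R : realType} {n : nat} d (A B : set 'rV[R]_n) :
  A `<=` B -> hausdorff d B = 0%E -> hausdorff d A = 0%E.
Proof.
by move=> AB B0; apply/eqP; rewrite eq_le hausdorff_ge0 andbT -B0 hausdorffS.
Qed.

Lemma caratheodory_closed {R : realType} {n : nat} d (C : set 'rV[R]_n) : closed C ->
  (@hausdorff R n d.+1).-caratheodory C.
Proof.
move=> cC; have [->|/set0P C0] := eqVneq C set0; first exact: caratheodory_measurable_set0.
have -> : C = [set x | pt_dist x C <= 0].
  apply/seteqP; split => x /=; last exact: pt_dist_closed.
  by move=> Cx; apply: le_trans (pt_dist_le x Cx) _; rewrite edistxx.
by apply: caratheodory_lip_sublevel => x y; exact: pt_dist_lip.
Qed.

Lemma near_planarS {R : realType} {n : nat} (eps : R) (A B : set 'rV[R]_n) :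
  A `<=` B -> near_planar eps B -> near_planar eps A.
Proof.
by move=> AB [e [v [h1 h2 h3 h]]]; exists e, v; split => // p q Ap Aq; apply: h; exact: AB.
Qed.

Lemma near_planar_set0 {R : realType} {n : nat} (eps : R) :
  near_planar eps (set0 : set 'rV[R]_n.+2).
Proof.
have dd (i j : 'I_n.+2) :
    dotp (delta_mx ord0 i : 'rV[R]_n.+2) (delta_mx ord0 j) = (i == j)%:R.
  rewrite /dotp (bigD1 i) //= !mxE !eqxx /= mul1r big1 ?addr0 //.
  by move=> k ki; rewrite !mxE /= (negbTE ki) mul0r.
exists (delta_mx ord0 ord0), (delta_mx ord0 (lift ord0 ord0)).
by rewrite !dd !eqxx; split.
Qed.

(** * Decomposition of rectifiable sets into nearly planar pieces *)

Section Decomposition.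
Context {R : realType} {n : nat}.
Local Notation MR := (measurableTypeR R).
Local Notation RR := (MR * MR)%type.
Local Notation leb := (@lebesgue_measure R).
Local Notation V := 'rV[R]_n.+2.
Local Notation D := (diag (1 : R) 1).
Local Notation one := (1%:pos : {posnum R})%R.

(** The sets P are the images of all good pieces, for all m. A point outside them either lacks a
    partial derivative, which happens on a null set, or lies in a bad piece for every m; in a
    bounded square the latter have an image of measure O(1/(m + 1)) for every m, hence 0. *)
Lemma lipschitz_decomposition (phi : RR -> V) (K eps rho : R) : 0 < K ->
  (forall p q, edist (phi p) (phi q) <= K * edist (D p) (D q)) -> 0 < eps -> 0 < rho ->
  exists P : nat -> set V, (forall k, near_planar eps (P k) /\ diam_bounded (P k) rho) /\
    hausdorff 2 (range phi `\` \bigcup_k P k) = 0%E.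
Proof.
move=> K0 phiK eps0 rho0.
pose M : R := Num.max 2 (2 / eps).
have M2 : 2 <= M by rewrite le_max lexx.
have Me : 2 <= eps * M by rewrite mulrC -ler_pdivrMr // le_max lexx orbT.
have M0 : 0 <= M by lra.
(* Restricting to cells of side at most 1/(k0 + 1) makes the images of the pieces have diameter at
   most rho. *)
have [k0 k0P] : exists k0 : nat, K * (2 * k0.+1%:R^-1) <= rho.
  have r0 : 0 < rho / (2 * K) by rewrite divr_gt0 // mulr_gt0.
  have [k] := ltr_add_invr r0; rewrite add0r => /ltW h; exists k.
  move: h; rewrite ler_pdivlMr ?mulr_gt0 //; move: (k.+1%:R^-1) => x; lra.
pose ok (m : nat) (J : @piece_index n.+2) := good M m J /\ (k0 <= J.1.2)%N.
pose P (l : nat) : set V := if (unpickle l : option (nat * @piece_index n.+2)%type) is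
   Some (m, J) then (if `[< ok m J >] then phi @` piece phi m J else set0) else set0.
exists P; split.
  move=> l; rewrite /P; case: unpickle => [[m J]|]; last first.
    by split => //; exact: near_planar_set0.
  case: ifPn => [/asboolP[gJ kJ]|_]; last by split => //; exact: near_planar_set0.
  split; first exact: good_near_planar gJ.
  case: J gJ kJ => [[[q1 q2] k] [i j]] gJ /= kJ _ _ [p [_ cp] <-] [q [_ cq] <-].
  apply: le_trans (phiK p q) _; apply: le_trans k0P; rewrite ler_pM2l //.
  apply: le_trans (edist_diag1_le _ _) _.
  have [h1 h2] := cell_dist cp cq.
  have h3 : k.+1%:R^-1 <= k0.+1%:R^-1 :> R by rewrite lef_pV2 ?posrE ?ltr0n // ler_nat ltnS.
  have := lerD (le_trans h1 h3) (le_trans h2 h3); move/le_trans; apply.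
  by rewrite mulrDl mul1r.
pose U : set RR := [set p | forall m J, ok m J -> ~ piece phi m J p].
have sub : range phi `\` \bigcup_k P k `<=` phi @` U.
  move=> _ [[p _ <-] nP]; exists p => // m J okJ pJ; apply: nP.
  exists (pickle (m, J)); first exact: I.
  by rewrite /P pickleK asboolT //; exists p.
apply: hausdorff_nullS sub _.
pose Dt := dir_derivable phi true; pose Df := dir_derivable phi false.
have mDt : measurable Dt by exact: measurable_dir_derivable K0 phiK _.
have mDf : measurable Df by exact: measurable_dir_derivable K0 phiK _.
have nullD (A : set RR) : measurable A -> (leb \x leb)%E A = 0%E ->
    hausdorff 2 (phi @` A) = 0%E.
  move=> mA A0; apply/eqP; rewrite eq_le hausdorff_ge0 andbT.
  apply: le_trans (@hausdorff_map R _ _ _ 1 K A phi D K0 _) _.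
    by move=> p q _ _; exact: phiK.
  by rewrite hausdorff_null // mule0.
pose rN (N : nat) : set RR := rect (- N%:R) N%:R (- N%:R) N%:R.
pose B N := Dt `&` Df `&` U `&` rN N.
have Bnull N : hausdorff 2 (phi @` B N) = 0%E.
  have NN : - N%:R <= N%:R :> R by rewrite ge0_cp.
  pose h : R := @hausdorff_unit R * ((N%:R - - N%:R) * (N%:R - - N%:R)).
  have hE : planar_measure one one (rN N) = h%:E.
    by rewrite planar_measure1E ?lebesgue_rect //; exact: measurable_rect.
  pose C : R := 4 * (M + 1) * (4 * (K + 2)).
  have C0 : 0 <= C by rewrite /C !mulr_ge0 //; lra.
  have h0 : 0 <= h by rewrite -lee_fin -hE measure_ge0.
  have key (m : nat) : (hausdorff 2 (phi @` B N) <= (C / m.+1%:R * h)%:E)%E.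
    pose F (l : nat) : set RR := if (unpickle l : option (@piece_index n.+2)) is
      Some J then (if `[< ~ good M m J >] then piece phi m J else set0) else set0.
    have mF l : measurable (F l).
      rewrite /F; case: unpickle => // J; case: ifPn => // _.
      exact: measurable_piece K0 phiK _ _.
    have BF : B N `<=` \bigcup_l F l.
      move=> p [[[ht hf] Up] _].
      have [J [kJ pJ]] := dir_derivable_piece K0 m k0 ht hf.
      exists (pickle J); first exact: I.
      rewrite /F pickleK; case: asboolP => // /contrapT gJ.
      by exfalso; apply: (Up m J).
    (* Bad pieces may overlap; made disjoint, their areas inside the square add up to at most its
       area. *)
    pose Q := seqDU F.
    have mQ l : measurable (Q l) by apply: measurableD => //; exact: bigsetU_measurable.
    have BQ : phi @` B N `<=` \bigcup_l (phi @` (B N `&` Q l)).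
      move=> _ [p Bp <-]; have := BF p Bp; rewrite seqDU_bigcup_eq => -[l _ Ql].
      by exists l => //; exists p.
    apply: le_trans (hausdorffS _ BQ) _; apply: le_trans (hausdorff_subadd _ _) _.
    have Cm0 : 0 <= C / m.+1%:R by rewrite divr_ge0.
    apply: (@le_trans _ _ (\sum_(0 <= l <oo)
        ((C / m.+1%:R)%:E * planar_measure one one (rN N `&` Q l)))%E).
      apply: lee_nneseries => [l _ _|l _]; first exact: hausdorff_ge0.
      apply: (@le_trans _ _ ((C / m.+1%:R)%:E * hausdorff 2 (D @` (B N `&` Q l)))%E).
        have QF : Q l `<=` F l by move=> p [].
        have [J bad] : exists J, (B N `&` Q l `<=` set0) \/
            (~ good M m J /\ B N `&` Q l `<=` piece phi m J).
          move: QF; rewrite {1}/F; case: unpickle => [J|] QF; last first.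
            by exists (0, 0, 0%N, (0, 0)); left => p [_ /QF].
          exists J; move: QF; case: asboolP => [gJ|_] QF; last by left => p [_ /QF].
          by right; split => // p [_ /QF].
        case: bad => [|[gJ sJ]].
          rewrite subset0 => ->; rewrite !image_set0 !hausdorff_set0 mule0 //.
        exact: (bad_piece_null K0 phiK M0 gJ sJ).
      rewrite lee_wpmul2l ?lee_fin //; apply: hausdorffS.
      by apply: image_subset => p [[_ ?] ?].
    rewrite nneseriesZl // [leRHS]EFinM lee_wpmul2l ?lee_fin // -hE.
    rewrite -measure_semi_bigcup.
    - by apply: le_measure; rewrite ?inE; [apply: bigcup_measurable => l _; apply: measurableI => //|
        |move=> p [l _ []]] => //; exact: measurable_rect.
    - by move=> l; apply: measurableI => //; exact: measurable_rect.
    - by apply: trivIset_setIl; exact: trivIset_seqDU.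
    - by apply: bigcup_measurable => l _; apply: measurableI => //; exact: measurable_rect.
  apply/eqP; rewrite eq_le hausdorff_ge0 andbT; apply/lee_addgt0Pr => r r0.
  have q0 : 0 < r / (C * h + 1) by rewrite divr_gt0 // ltr_wpDl // mulr_ge0.
  have [m] := ltr_add_invr q0; rewrite add0r => hm.
  apply: le_trans (key m) _; rewrite add0e lee_fin.
  have Ch1 : 0 < C * h + 1 by rewrite ltr_wpDl // mulr_ge0.
  rewrite ltr_pdivlMr // in hm.
  have : 0 <= m.+1%:R^-1 :> R by rewrite invr_ge0.
  by move: (m.+1%:R^-1) hm => x hm x0; nra.
have -> : phi @` U = \bigcup_k (phi @` (if k is k'.+2 then B k' else
    if k is 1%N then U `\` Dt else U `\` Df)).
  apply/seteqP; split => [_ [p Up <-]|_ [[|[|N]] _ [p Bp <-]]].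
  - have [pt|npt] := pselect (Dt p); last by exists 1%N => //; exists p.
    have [pf|npf] := pselect (Df p); last by exists 0%N => //; exists p.
    pose N := (Num.truncn (`|p.1 : R| + `|p.2 : R|)).+1.
    have : `|p.1 : R| + `|p.2 : R| < N%:R by exact: truncnS_gt.
    move=> hN; exists N.+2 => //; exists p => //; split => //.
    rewrite /rN (_ : p = (p.1, p.2)); last by case: (p).
    apply/rectP; move: hN; set x : R := p.1; set y : R := p.2 => hN.
    have := ler_norm x; have := ler_norm y; have := ler_norm (- x : R); have := ler_norm (- y : R).
    rewrite !normrN => h1 h2 h3 h4; have s0 := normr_ge0 x; have t0 := normr_ge0 y.
    by apply/andP; split; apply/andP; split; lra.
  - by exists p => //; case: Bp.
  - by exists p => //; case: Bp.
  - by exists p => //; case: Bp => -[].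
apply: hausdorff_null_bigcup => -[|[|N]]; last exact: Bnull.
- apply: (@hausdorff_nullS _ _ _ _ (phi @` (~` Df))).
    by apply: image_subset => p [].
  by apply: nullD; [exact: measurableC|exact: dir_derivable_full K0 phiK _].
- apply: (@hausdorff_nullS _ _ _ _ (phi @` (~` Dt))).
    by apply: image_subset => p [].
  by apply: nullD; [exact: measurableC|exact: dir_derivable_full K0 phiK _].
Qed.

Lemma rectifiable_decomposition (E : set V) (eps rho : R) :
  rectifiable 2 E -> 0 < eps -> 0 < rho ->
  exists Q : nat -> set V,
    (forall k, [/\ closed (Q k), near_planar eps (Q k) & diam_bounded (Q k) rho]) /\
    hausdorff 2 (E `\` \bigcup_k Q k) = 0%E.
Proof.
move=> [f [lf Enull]] eps0 rho0.
have exP k : exists P : nat -> set V,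
    (forall l, near_planar eps (P l) /\ diam_bounded (P l) rho) /\
    hausdorff 2 (range (f k) `\` \bigcup_l P l) = 0%E.
  have [K hK] := lf k.
  have [||||P [P1 P2]] := @lipschitz_decomposition (fun p : RR => f k (D p)) (Num.max 1 K) eps rho => //.
  - by rewrite lt_max ltr01.
  - move=> p q; apply: le_trans (hK _ _ I I) _.
    by rewrite ler_wpM2r ?edist_ge0 // le_max lexx orbT.
  exists P; split => //; apply: hausdorff_nullS P2 => y [[x _ <-] nP]; split => //.
  have [p <-] := diag_surj ltr01 ltr01 x.
  by exists p.
have [P hP] := choice exP.
pose Q (l : nat) : set V := if (unpickle l : option (nat * nat)%type) is Some (k, j) then
  closure (P k j) else set0.
exists Q; split.
  move=> l; rewrite /Q; case: unpickle => [[k j]|].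
    have [/(_ j)[h1 h2] _] := hP k; split.
    - exact: closed_closure.
    - by apply: near_planar_closure => //; exact: ltW.
    - exact: closure_diam_bounded.
  by split => //; [exact: closed0|exact: near_planar_set0].
have sub : E `\` \bigcup_k Q k `<=` \bigcup_k (if k is k'.+1 then
    range (f k') `\` \bigcup_l P k' l else E `\` \bigcup_k range (f k)).
  move=> x [Ex nQ]; have [[k _ fkx]|nf] := pselect ((\bigcup_k range (f k)) x).
    exists k.+1 => //; split => // -[l _ Pl]; apply: nQ.
    exists (pickle (k, l)); first exact: I.
    by rewrite /Q pickleK; exact: subset_closure.
  by exists 0%N.
apply: hausdorff_nullS sub _; apply: hausdorff_null_bigcup => -[|k] //.
by have [_] := hP k.
Qed.

End Decomposition.

(** * Norms and radial maps on nearly planar pieces *)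

Section Radial.
Context {R : realType} {n : nat}.
Local Notation V := 'rV[R]_n.
Implicit Types p q x : V.

Lemma bessel (e v x : V) : dotp e e = 1 -> dotp v v = 1 -> dotp e v = 0 ->
  enorm (x - (dotp x e *: e + dotp x v *: v)) ^+ 2 =
    enorm x ^+ 2 - (dotp x e ^+ 2 + dotp x v ^+ 2).
Proof.
move=> ee vv ev; rewrite !sqr_enorm !dotpE ee vv (dotpC v e) ev (dotpC e x) (dotpC v x).
by ring.
Qed.

(** Rotating the frame within its plane puts the whole projection of N on e', so that the norm
    varies to first order only along e' on a plane piece with radial direction N. *)
Lemma rotate_orthonormal (e v : V) (N : V) :
  dotp e e = 1 -> dotp v v = 1 -> dotp e v = 0 ->
  exists e' v', [/\ dotp e' e' = 1, dotp v' v' = 1, dotp e' v' = 0, dotp N v' = 0 &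
    forall x, dotp x e' ^+ 2 + dotp x v' ^+ 2 = dotp x e ^+ 2 + dotp x v ^+ 2].
Proof.
move=> ee vv ev; set al := dotp N e; set be := dotp N v.
have [h0|h0] := eqVneq (al ^+ 2 + be ^+ 2) 0.
  exists e, v; split => //; apply/eqP; rewrite -sqrf_eq0.
  by have := sqr_ge0 al; have := sqr_ge0 be; move: h0 => /eqP; rewrite -/be eq_le => /andP[h _];
    rewrite eq_le sqr_ge0 andbT; lra.
pose r := Num.sqrt (al ^+ 2 + be ^+ 2).
have r2 : r ^+ 2 = al ^+ 2 + be ^+ 2 by rewrite sqr_sqrtr // addr_ge0 ?sqr_ge0.
have r0 : r != 0 by rewrite -sqrf_eq0 r2.
exists ((al / r) *: e + (be / r) *: v), ((- be / r) *: e + (al / r) *: v).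
have c1 : (al / r) ^+ 2 + (be / r) ^+ 2 = 1 by rewrite !expr_div_n -mulrDl -r2 mulfV // sqrf_eq0.
have c2 x : dotp x e ^+ 2 + dotp x v ^+ 2 =
   ((al / r) ^+ 2 + (be / r) ^+ 2) * (dotp x e ^+ 2 + dotp x v ^+ 2) by rewrite c1 mul1r.
split.
- by rewrite !dotpDl !dotpDr !dotpZl !dotpZr ee vv (dotpC v e) ev -[RHS]c1; ring.
- by rewrite !dotpDl !dotpDr !dotpZl !dotpZr ee vv (dotpC v e) ev -[RHS]c1; ring.
- by rewrite !dotpDl !dotpDr !dotpZl !dotpZr ee vv (dotpC v e) ev; ring.
- by rewrite dotpDr !dotpZr -/al -/be; ring.
- by move=> x; rewrite c2 !dotpDr !dotpZr; ring.
Qed.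

(** The gradient of the norm is the unit radial vector, which is nearly constant on a small piece
    away from 0. Explicitly, (|p| + |q|)(|p| - |q|) = (p - q).(p + q), and |p| N and |q| N are
    within 2 rho of p and q. *)
Lemma radial_linearization p0 p q (rho a : R) : 0 < a ->
  a <= enorm p0 -> a <= enorm p -> a <= enorm q ->
  edist p p0 <= rho -> edist q p0 <= rho ->
  `|enorm p - enorm q - dotp (p - q) ((enorm p0)^-1 *: p0)| <= 2 * rho / a * edist p q.
Proof.
move=> a0 ap0 ap aq pp0 qp0; set N := (enorm p0)^-1 *: p0.
have np0 : 0 < enorm p0 by lra.
have p0E : p0 = enorm p0 *: N by rewrite scalerA mulfV ?scale1r // lt0r_neq0.
have nN : enorm N = 1 by rewrite enormZ gtr0_norm ?invr_gt0 // mulVf // lt0r_neq0.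
have near x : edist x p0 <= rho -> enorm (x - enorm x *: N) <= 2 * rho.
  move=> xp0.
  have -> : x - enorm x *: N = (x - p0) + (enorm p0 - enorm x) *: N.
    by rewrite scalerBl -p0E addrA subrK.
  apply: le_trans (enormD _ _) _; rewrite enormZ nN mulr1.
  have := enorm_lip p0 x; rewrite edistC => h.
  by move: xp0; rewrite /edist in h * => xp0; lra.
set s := enorm p + enorm q; have s0 : 2 * a <= s by rewrite /s; lra.
have sp : 0 < s by lra.
have key : s * (enorm p - enorm q - dotp (p - q) N) =
    dotp (p - q) ((p - enorm p *: N) + (q - enorm q *: N)).
  have e1 : dotp (p - q) (p + q) = enorm p ^+ 2 - enorm q ^+ 2.
    by rewrite !sqr_enorm !dotpE (dotpC q p); ring.
  transitivity (dotp (p - q) (p + q) - s * dotp (p - q) N); first by rewrite e1 /s; ring.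
  by rewrite /s !dotpDr !dotpNr !dotpZr; ring.
have h : s * `|enorm p - enorm q - dotp (p - q) N| <= edist p q * (4 * rho).
  rewrite -{1}(gtr0_norm sp) -normrM key; apply: le_trans (dotp_norm_le _ _) _.
  rewrite ler_wpM2l ?enorm_ge0 //; apply: le_trans (enormD _ _) _.
  by have := near p pp0; have := near q qp0; lra.
rewrite -ler_pdivlMl // in h; apply: le_trans h _.
have rho0 : 0 <= rho by apply: le_trans pp0; exact: edist_ge0.
have -> : s^-1 * (edist p q * (4 * rho)) = s^-1 * (4 * rho) * edist p q by ring.
rewrite ler_wpM2r ?edist_ge0 // ler_pdivrMl //.
have -> : 4 * rho = (2 * a) * (2 * rho / a) by field; exact: lt0r_neq0.
by rewrite ler_wpM2r // divr_ge0 ?mulr_ge0 // ltW.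
Qed.

Lemma radial_coordinates (A : set V) (eps rho a : R) : 0 <= eps -> 0 < a ->
  near_planar (eps ^+ 2) A -> diam_bounded A rho -> (forall x, A x -> a <= enorm x) ->
  exists e v : V, exists c : R, `|c| <= 1 /\ forall p q, A p -> A q ->
    [/\ dotp (p - q) e ^+ 2 + dotp (p - q) v ^+ 2 <= edist p q ^+ 2,
        edist p q ^+ 2 <= (1 + eps ^+ 2) * (dotp (p - q) e ^+ 2 + dotp (p - q) v ^+ 2) &
        `|enorm p - enorm q - c * dotp (p - q) e| <= (eps + 2 * rho / a) * edist p q].
Proof.
move=> eps0 a0 [e0 [v0 [ee0 vv0 ev0 np]]] Ad Aa.
have [->|/set0P[p0 Ap0]] := eqVneq A set0.
  by exists e0, v0, 0; rewrite normr0; split => // p q [].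
pose N := (enorm p0)^-1 *: p0.
have np0 : 0 < enorm p0 by have := Aa _ Ap0; lra.
have nN : enorm N = 1 by rewrite enormZ gtr0_norm ?invr_gt0 // mulVf // lt0r_neq0.
have [e [v [ee vv ev Nv rot]]] := rotate_orthonormal N ee0 vv0 ev0.
exists e, v, (dotp e N); split.
  apply: le_trans (dotp_norm_le _ _) _; rewrite nN mulr1.
  by rewrite /enorm ee sqrtr1.
move=> p q Ap Aq; set X := dotp (p - q) e; set Y := dotp (p - q) v.
have bes := bessel (p - q) ee vv ev; rewrite -/X -/Y in bes.
set rest := (p - q) - _ in bes.
have hp : edist p q ^+ 2 <= (1 + eps ^+ 2) * (X ^+ 2 + Y ^+ 2) by rewrite rot; exact: np.
have hb : X ^+ 2 + Y ^+ 2 <= edist p q ^+ 2.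
  by rewrite -subr_ge0 /edist -bes sqr_ge0.
split => //.
have rr : enorm rest <= eps * edist p q.
  apply: sqrt_le_of_sqr; first by rewrite mulr_ge0 ?edist_ge0.
  rewrite bes -/(edist p q) exprMn.
  have := ler_wpM2l (sqr_ge0 eps) hb; lra.
have dN : dotp (p - q) N = dotp e N * X + dotp rest N.
  have -> : p - q = rest + (X *: e + Y *: v) by rewrite /rest subrK.
  by rewrite !dotpDl !dotpZl (dotpC v N) Nv; ring.
have hl := radial_linearization a0 (Aa _ Ap0) (Aa _ Ap) (Aa _ Aq) (Ad _ _ Ap Ap0) (Ad _ _ Aq Ap0).
rewrite -/N dN in hl.
have hrN : `|dotp rest N| <= eps * edist p q.
  by apply: le_trans (dotp_norm_le _ _) _; rewrite nN mulr1.
have -> : enorm p - enorm q - dotp e N * X =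
   (enorm p - enorm q - (dotp e N * X + dotp rest N)) + dotp rest N by ring.
by apply: le_trans (ler_normD _ _) _; lra.
Qed.

Definition radial_map (psi : R -> R) (x : V) : V := (psi (enorm x) / enorm x) *: x.

(** The law of cosines: (|p - q|^2 - (|p| - |q|)^2) / (|p| |q|) depends only on the angle between p
    and q, which a radial map keeps. *)
Lemma sqr_edist_radial (k l : R) p q : p != 0 -> q != 0 ->
  edist ((k / enorm p) *: p) ((l / enorm q) *: q) ^+ 2 =
  (k - l) ^+ 2 + k * l / (enorm p * enorm q) *
    (edist p q ^+ 2 - (enorm p - enorm q) ^+ 2).
Proof.
rewrite -!enorm_gt0 => np nq; rewrite /edist !sqr_enormB !enormZ.
have -> : (`|k / enorm p| * enorm p) ^+ 2 = k ^+ 2.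
  rewrite exprMn real_normK ?num_real //; field; exact: lt0r_neq0.
have -> : (`|l / enorm q| * enorm q) ^+ 2 = l ^+ 2.
  rewrite exprMn real_normK ?num_real //; field; exact: lt0r_neq0.
rewrite dotpZl dotpZr; field; by rewrite !lt0r_neq0.
Qed.

Lemma radial_map_le (psi : R -> R) (sigma tau : R) p q : 0 <= tau -> tau <= sigma ->
  p != 0 -> q != 0 ->
  0 <= psi (enorm p) <= tau * enorm p -> 0 <= psi (enorm q) <= tau * enorm q ->
  `|psi (enorm p) - psi (enorm q)| <= sigma * `|enorm p - enorm q| ->
  edist (radial_map psi p) (radial_map psi q) ^+ 2 <=
  (sigma ^+ 2 - tau ^+ 2) * (enorm p - enorm q) ^+ 2 + tau ^+ 2 * edist p q ^+ 2.
Proof.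
move=> t0 ts p0 q0 /andP[kp0 kp] /andP[kq0 kq] h.
rewrite /radial_map sqr_edist_radial //.
have np : 0 < enorm p by rewrite enorm_gt0.
have nq : 0 < enorm q by rewrite enorm_gt0.
have h1 : (psi (enorm p) - psi (enorm q)) ^+ 2 <= sigma ^+ 2 * (enorm p - enorm q) ^+ 2.
  rewrite -exprMn -[leLHS]real_normK ?num_real // -[leRHS]real_normK ?num_real //.
  by rewrite lerXn2r ?nnegrE // normrM (ger0_norm (le_trans t0 ts)).
have h2 : 0 <= edist p q ^+ 2 - (enorm p - enorm q) ^+ 2.
  rewrite subr_ge0 -[leLHS]real_normK ?num_real // lerXn2r ?nnegrE ?edist_ge0 //.
  exact: enorm_lip.
have h3 : psi (enorm p) * psi (enorm q) / (enorm p * enorm q) <= tau ^+ 2.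
  rewrite ler_pdivrMr ?mulr_gt0 //.
  have -> : tau ^+ 2 * (enorm p * enorm q) = (tau * enorm p) * (tau * enorm q) by ring.
  exact: ler_pM.
have := ler_wpM2r h2 h3; lra.
Qed.

End Radial.

(** * The area bound for radial maps *)

Section Shell.
Context {R : realType} {n : nat}.
Local Notation V := 'rV[R]_n.+2.
Local Notation RR := (measurableTypeR R * measurableTypeR R)%type.

Lemma rectifiable_pieces (E : set V) (eps rho : R) :
  rectifiable 2 E -> 0 < eps -> 0 < rho ->
  exists A : nat -> set V,
    [/\ forall k, [/\ (@hausdorff R n.+2 2).-caratheodory (A k), near_planar eps (A k) &
          diam_bounded (A k) rho],
        trivIset setT A & hausdorff 2 (E `\` \bigcup_k A k) = 0%E].
Proof.
move=> rE eps0 rho0; have [Q [hQ Q0]] := rectifiable_decomposition rE eps0 rho0.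
exists (seqDU Q); split.
- move=> k; have [cQ nQ dQ] := hQ k.
  have sub : seqDU Q k `<=` Q k by move=> x [].
  split; [|exact: near_planarS nQ|by move=> x y /sub Qx /sub Qy; exact: dQ].
  apply: caratheodory_measurable_setD; first exact: caratheodory_closed.
  apply: caratheodory_measurable_bigsetU => j; apply: caratheodory_closed.
  by have [] := hQ j.
- exact: trivIset_seqDU.
- by rewrite -seqDU_bigcup_eq.
Qed.

Lemma hausdorff_pieces (E : set V) (A : nat -> set V) :
  (forall k, (@hausdorff R n.+2 2).-caratheodory (A k)) -> trivIset setT A ->
  (\sum_(0 <= k <oo) hausdorff 2 (E `&` A k) <= hausdorff 2 E)%E.
Proof.
move=> cA tA; apply: le_trans (caratheodory_lime_le cA tA E).
by rewrite leeDl // outer_measure_ge0.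
Qed.

(** The radial part of p - q is c X up to a small error, with |c| <= 1. As tau <= sigma, pretending
    that e is fully radial only enlarges the bound: stretch sigma along e and tau along v, whose
    product is the area factor. *)
Lemma radial_map_piece (A : set V) (psi : R -> R) (sigma tau eps rho a kap eta : R) :
  0 <= eps -> 0 < a -> near_planar (eps ^+ 2) A -> diam_bounded A rho ->
  (forall x, A x -> a <= enorm x) ->
  0 <= tau -> tau <= sigma -> 0 < sigma ->
  (forall x y, A x -> A y ->
    `|psi (enorm x) - psi (enorm y)| <= sigma * `|enorm x - enorm y|) ->
  (forall x, A x -> 0 <= psi (enorm x) <= tau * enorm x) ->
  eps + 2 * rho / a <= kap -> eps ^+ 2 <= kap -> kap <= 1 -> 0 < eta ->
  7 * kap * sigma ^+ 2 <= eta ^+ 2 ->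
  (hausdorff 2 (radial_map psi @` A) <=
    ((sigma * (1 + 4 * kap)) * (tau + eta))%:E * hausdorff 2 A)%E.
Proof.
move=> eps0 a0 np Ad Aa t0 ts s0 psil psit hk1 hk2 k1 eta0 hk.
have k0 : 0 <= kap by apply: le_trans hk2; exact: sqr_ge0.
have [e [v [c [c1 h]]]] := radial_coordinates eps0 a0 np Ad Aa.
pose g (p : V) : RR := (dotp p e, dotp p v).
have gA : (hausdorff 2 (diag 1 1 @` (g @` A)) <= hausdorff 2 A)%E.
  rewrite image_comp -{2}(image_id A) -[leRHS]mul1e.
  have := @hausdorff_map R _ _ _ 1 1 A (diag 1 1 \o g) id ltr01; rewrite expr1n; apply.
  move=> p q Ap Aq; rewrite mul1r; apply: sqrt_le_of_sqr; first exact: edist_ge0.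
  have [hb _ _] := h p q Ap Aq; apply: le_trans hb.
  by rewrite sqr_edist_diag /g /= expr1n !mul1r -!dotpBl.
have st0 : 0 < sigma * (1 + 4 * kap) by rewrite mulr_gt0 //; lra.
have tt0 : 0 < tau + eta by lra.
apply: (@le_trans _ _ (((sigma * (1 + 4 * kap)) * (tau + eta))%:E *
    hausdorff 2 (diag 1 1 @` (g @` A)))%E); last first.
  by apply: lee_wpmul2l => //; rewrite lee_fin mulr_ge0 // ltW.
apply: (@hausdorff_linear_bound _ _ _ A (radial_map psi) g) => // p q Ap Aq.
have [hb hp hr] := h p q Ap Aq; rewrite /g /= -!dotpBl.
set X := dotp (p - q) e in hb hp hr *; set Y := dotp (p - q) v in hb hp *.
have pn x : A x -> x != 0 by move=> Ax; rewrite -enorm_gt0; have := Aa x Ax; lra.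
apply: le_trans (radial_map_le t0 ts (pn _ Ap) (pn _ Aq) (psit _ Ap) (psit _ Aq)
  (psil _ _ Ap Aq)) _.
set Del := enorm p - enorm q in hr *; set d := edist p q in hb hp hr *.
have d0 : 0 <= d by exact: edist_ge0.
have X2 := sqr_ge0 X; have Y2 := sqr_ge0 Y.
have Xd : `|X| <= d.
  by apply: sqrt_le_of_sqr => //; rewrite real_normK ?num_real //; lra.
have hD : `|Del| <= `|X| + kap * d.
  have -> : Del = (Del - c * X) + c * X by rewrite subrK.
  apply: le_trans (ler_normD _ _) _; rewrite addrC; apply: lerD.
    by rewrite normrM ler_piMl.
  by apply: le_trans hr _; rewrite ler_wpM2r.
have X0 := normr_ge0 X.
have hD2 : Del ^+ 2 <= X ^+ 2 + 3 * kap * d ^+ 2.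
  rewrite -(real_normK (num_real Del)) -(real_normK (num_real X)).
  have : `|Del| ^+ 2 <= (`|X| + kap * d) ^+ 2.
    by rewrite lerXn2r ?nnegrE ?addr_ge0 ?mulr_ge0.
  have h1 : kap * d * `|X| <= kap * d * d by rewrite ler_wpM2l ?mulr_ge0.
  have h2 : kap * (kap * d ^+ 2) <= 1 * (kap * d ^+ 2) by rewrite ler_wpM2r ?mulr_ge0 ?sqr_ge0.
  move/le_trans; apply; rewrite sqrrD; lra.
have XY0 : 0 <= X ^+ 2 + Y ^+ 2 by lra.
have hd1 : d ^+ 2 <= (1 + kap) * (X ^+ 2 + Y ^+ 2).
  by apply: le_trans hp _; rewrite ler_wpM2r // lerD2l.
have hd2 : d ^+ 2 <= 2 * (X ^+ 2 + Y ^+ 2).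
  by apply: le_trans hd1 _; rewrite ler_wpM2r //; lra.
have st : 0 <= sigma ^+ 2 - tau ^+ 2.
  by rewrite subr_ge0 lerXn2r ?nnegrE // ltW.
have sig2 := sqr_ge0 sigma; have tau2 := sqr_ge0 tau.
have s1 : (sigma ^+ 2 - tau ^+ 2) * Del ^+ 2 <=
    (sigma ^+ 2 - tau ^+ 2) * X ^+ 2 + sigma ^+ 2 * (6 * kap * (X ^+ 2 + Y ^+ 2)).
  apply: le_trans (ler_wpM2l st hD2) _; rewrite mulrDr lerD2l.
  apply: (@le_trans _ _ (sigma ^+ 2 * (3 * kap * d ^+ 2))).
    by rewrite ler_wpM2r ?mulr_ge0 ?sqr_ge0 //; lra.
  rewrite ler_wpM2l //; have := ler_wpM2l k0 hd2; lra.
have s2 : tau ^+ 2 * d ^+ 2 <= tau ^+ 2 * (X ^+ 2 + Y ^+ 2) + sigma ^+ 2 * (kap * (X ^+ 2 + Y ^+ 2)).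
  apply: le_trans (ler_wpM2l tau2 hd1) _; rewrite mulrDl mul1r mulrDr lerD2l.
  by rewrite ler_wpM2r ?mulr_ge0 //; lra.
(* The total error 7 kap sigma^2 (X^2 + Y^2) is absorbed by 4 kap in the factor of X and by eta in
   the factor of Y. *)
apply: le_trans (lerD s1 s2) _.
have u1 : sigma ^+ 2 * (1 + 7 * kap) <= (sigma * (1 + 4 * kap)) ^+ 2.
  by rewrite exprMn ler_wpM2l //; have := sqr_ge0 kap; lra.
have u2 : tau ^+ 2 + 7 * kap * sigma ^+ 2 <= (tau + eta) ^+ 2.
  by rewrite sqrrD; have : 0 <= tau * eta by [rewrite mulr_ge0 // ltW]; lra.
have := ler_wpM2r X2 u1; have := ler_wpM2r Y2 u2; lra.
Qed.

(** The piecewise bounds add up because the pieces are disjoint and Carathéodory measurable; the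
    remainder is null and stays null under a Lipschitz map. The errors vanish as the pieces get
    flatter and smaller. *)
Lemma hausdorff_radial_map (E : set V) (psi : R -> R) (sigma tau a : R) :
  rectifiable 2 E -> (hausdorff 2 E < +oo)%E ->
  0 < a -> (forall x, E x -> a <= enorm x) ->
  0 <= tau -> tau <= sigma -> 0 < sigma ->
  (forall x y, E x -> E y ->
    `|psi (enorm x) - psi (enorm y)| <= sigma * `|enorm x - enorm y|) ->
  (forall x, E x -> 0 <= psi (enorm x) <= tau * enorm x) ->
  (hausdorff 2 (radial_map psi @` E) <= (sigma * tau)%:E * hausdorff 2 E)%E.
Proof.
move=> rE fE a0 Ea t0 ts s0 psil psit.
have HE : hausdorff 2 E \is a fin_num by rewrite ge0_fin_numE // hausdorff_ge0.
set H := fine (hausdorff 2 E).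
have H0 : 0 <= H by rewrite fine_ge0 // hausdorff_ge0.
have main (eta : R) : 0 < eta -> eta <= 1 ->
    (hausdorff 2 (radial_map psi @` E) <= ((sigma * (1 + 4 * eta)) * (tau + eta) * H)%:E)%E.
  move=> eta0 eta1; pose kap := Num.min eta (eta ^+ 2 / (7 * sigma ^+ 2)).
  have kap0 : 0 < kap by rewrite lt_min eta0 divr_gt0 ?mulr_gt0 ?exprn_gt0.
  have kape : kap <= eta by rewrite ge_min lexx.
  have kap7 : 7 * kap * sigma ^+ 2 <= eta ^+ 2.
    rewrite mulrAC mulrC -ler_pdivlMr ?mulr_gt0 ?exprn_gt0 //.
    by rewrite ge_min lexx orbT.
  (* These choices make eps + 2 rho/a equal to kap. *)
  pose eps := kap / 2; pose rho := kap * a / 4.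
  have eps0 : 0 < eps by rewrite divr_gt0.
  have rho0 : 0 < rho by rewrite divr_gt0 ?mulr_gt0.
  have [A [hA tA NA]] := rectifiable_pieces rE (exprn_gt0 2 eps0) rho0.
  pose N := E `\` \bigcup_k A k.
  have cover : radial_map psi @` E `<=` (\bigcup_k (radial_map psi @` (E `&` A k))) `|`
      radial_map psi @` N.
    move=> _ [x Ex <-]; have [[k _ Ak]|nA] := pselect ((\bigcup_k A k) x).
      by left; exists k => //; exists x.
    by right; exists x.
  have N0 : hausdorff 2 (radial_map psi @` N) = 0%E.
    apply/eqP; rewrite eq_le hausdorff_ge0 andbT.
    have := @hausdorff_map R _ _ _ 1 sigma N (radial_map psi) id s0.
    rewrite image_id /N NA mule0; apply => x y [Ex _] [Ey _].
    apply: sqrt_le_of_sqr; first by rewrite mulr_ge0 ?edist_ge0 // ltW.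
    have pn z : E z -> z != 0 by move=> Ez; rewrite -enorm_gt0; have := Ea z Ez; lra.
    apply: le_trans (radial_map_le t0 ts (pn _ Ex) (pn _ Ey) (psit _ Ex) (psit _ Ey)
      (psil _ _ Ex Ey)) _.
    rewrite exprMn; have h1 : (enorm x - enorm y) ^+ 2 <= edist x y ^+ 2.
      by rewrite -[leLHS]real_normK ?num_real // lerXn2r ?nnegrE ?edist_ge0 // enorm_lip.
    have st : 0 <= sigma ^+ 2 - tau ^+ 2.
      by rewrite subr_ge0 lerXn2r ?nnegrE // ltW.
    by have := ler_wpM2l st h1; lra.
  apply: le_trans (hausdorffS _ cover) _; apply: le_trans (outer_measureU2 _ _ _) _.
  rewrite [X in (_ + X)%E]N0 adde0; apply: le_trans (hausdorff_subadd _ _) _.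
  have C0 : 0 <= (sigma * (1 + 4 * eta)) * (tau + eta).
    by apply: mulr_ge0; [apply: mulr_ge0|]; lra.
  apply: (@le_trans _ _ (\sum_(0 <= k <oo) (((sigma * (1 + 4 * eta)) * (tau + eta))%:E *
      hausdorff 2 (E `&` A k)))%E).
    apply: lee_nneseries => [k _ _|k _]; first exact: hausdorff_ge0.
    have [_ np dA] := hA k.
    apply: (@le_trans _ _ (((sigma * (1 + 4 * kap)) * (tau + eta))%:E *
      hausdorff 2 (E `&` A k))%E).
      apply: (@radial_map_piece _ psi sigma tau eps rho a kap eta) => //.
      - exact: ltW.
      - by apply: near_planarS np => x [].
      - by move=> x y [_ Ax] [_ Ay]; exact: dA.
      - by move=> x [Ex _]; exact: Ea.
      - by move=> x y [Ex _] [Ey _]; exact: psil.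
      - by move=> x [Ex _]; exact: psit.
      - rewrite /eps /rho le_eqVlt; apply/orP; left; apply/eqP; field; exact: lt0r_neq0.
      - by rewrite /eps expr_div_n; nra.
      - exact: le_trans kape eta1.
    rewrite lee_wpmul2r ?hausdorff_ge0 // lee_fin ler_wpM2r //; first by lra.
    by rewrite ler_wpM2l ?(ltW s0) //; lra.
  rewrite nneseriesZl //; last by move=> k _; exact: hausdorff_ge0.
  rewrite [leRHS]EFinM fineK // lee_wpmul2l ?lee_fin //.
  by apply: hausdorff_pieces => // k; have [] := hA k.
rewrite -(fineK HE) -EFinM -/H; apply/lee_addgt0Pr => r r0.
(* For eta <= 1 the excess over sigma tau H is sigma H eta (1 + 4 tau + 4 eta) <= eta C. *)
pose C := sigma * (1 + 4 * tau + 4) * H + 1.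
have C0 : 0 < C by rewrite /C ltr_wpDl // !mulr_ge0 //; lra.
pose eta := Num.min 1 (r / C).
have eta0 : 0 < eta by rewrite lt_min ltr01 divr_gt0.
have eta1 : eta <= 1 by rewrite ge_min lexx.
have etaC : eta * C <= r by rewrite -ler_pdivlMr // ge_min lexx orbT.
apply: le_trans (main eta eta0 eta1) _; rewrite -EFinD lee_fin.
have sH : 0 <= sigma * H by rewrite mulr_ge0 // ltW.
have e2 : eta * eta <= eta by rewrite ler_piMl // ltW.
have := ler_wpM2l sH e2; rewrite /C in etaC; lra.
Qed.

End Shell.

(** * Eilenberg's inequality *)

Section Slices.
Context {R : realType}.
Local Notation MR := (measurableTypeR R).
Local Notation leb := (@lebesgue_measure R).

Lemma ball_volume1 {n : nat} (A : set 'rV[R]_n) : ball_volume 1 A = diam A.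
Proof. by rewrite /ball_volume /= expr1 mulrCA mulfV ?mulr1. Qed.

Lemma content_le_single {n : nat} d delta (A : set 'rV[R]_n) : diam_bounded A delta ->
  (hausdorff_content d.+1 delta A <= (ball_volume d.+1 A)%:E)%E.
Proof.
move=> Ad; pose U (k : nat) : set 'rV[R]_n := if k is 0 then A else set0.
have hU : delta_cover delta A U.
  split; first by move=> x Ax; exists 0.
  by case=> // k x y [].
apply: (le_trans (content_le _ hU)).
rewrite (@nneseries_split _ _ 0 1); last by move=> k _; rewrite lee_fin ball_volume_ge0.
rewrite eseries0 ?adde0 ?add0n ?big_nat1 //.
by case=> // k _ _; rewrite /U ball_volume_set0.
Qed.

Lemma content_subadd2 {n : nat} d delta (A B : set 'rV[R]_n) : 0 <= delta ->
  (hausdorff_content d.+1 delta (A `|` B) <=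
   hausdorff_content d.+1 delta A + hausdorff_content d.+1 delta B)%E.
Proof.
move=> d0; rewrite -bigcup2E; apply: (le_trans (content_subadd _ _ _)).
rewrite (@nneseries_split _ _ 0 2); last by move=> k _; rewrite content_ge0.
rewrite eseries0 ?adde0 ?add0n; first by rewrite big_nat_recr //= big_nat1.
by case=> [|[]] // k _ _; rewrite /bigcup2 /= content_set0.
Qed.

Definition line (t : R) : 'rV[R]_1 := const_mx t.

Lemma edist_line s t : edist (line s) (line t) = `|s - t|.
Proof.
by rewrite /edist /enorm /dotp big_ord_recl big_ord0 addr0 !mxE -expr2 sqrtr_sqr.
Qed.

Lemma content_line_itv (delta a b : R) : 0 < delta -> a <= b ->
  (hausdorff_content 1 delta (line @` `]a, b]%classic) <= (b - a)%:E)%E.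
Proof.
move=> d0 ab; have [N N0 hN] : exists2 N : nat, 0 < N%:R :> R & (b - a) / delta <= N%:R.
  by exists (Num.truncn ((b - a) / delta)).+1; rewrite ?ltr0n // ltW // truncnS_gt.
pose l := (b - a) / N%:R; have l0 : 0 <= l by rewrite divr_ge0 ?subr_ge0 // ltW.
have ld : l <= delta.
  by rewrite ler_pdivrMr // mulrC -ler_pdivrMr.
have main m : (hausdorff_content 1 delta (line @` `]a, (a + m%:R * l)%R]%classic)
    <= (m%:R * l)%:E)%E.
  elim: m => [|m IH].
    by rewrite mul0r addr0 set_itvoc0 image_set0 content_set0 // ltW.
  have sub : line @` `]a, (a + m.+1%:R * l)%R]%classic `<=` (line @` `]a, (a + m%:R * l)%R]%classic)
      `|` line @` `](a + m%:R * l)%R, (a + m.+1%:R * l)%R]%classic.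
    rewrite -image_setU; apply: image_subset => x /=; rewrite !in_itv /= => /andP[-> ->].
    by case: (leP x (a + m%:R * l)) => _; [left|right].
  apply: le_trans (contentS _ _ sub) _; apply: le_trans (content_subadd2 _ _ _ (ltW d0)) _.
  rewrite -natr1 mulrDl mul1r EFinD; apply: leeD => //.
  set I := (X in line @` X).
  have Il : diam_bounded (line @` I) l.
    move=> _ _ [s /= sI <-] [t /= tI <-]; rewrite edist_line.
    move: sI tI; rewrite /I /= !in_itv /= => /andP[s1 s2] /andP[t1 t2].
    by rewrite ler_norml; lra.
  apply: le_trans (content_le_single _ _) _.
    by move=> x y Ix Iy; apply: le_trans ld; exact: Il.
  by rewrite ball_volume1 lee_fin diam_le.
have Nl : N%:R * l = b - a by rewrite /l mulrC divfK // lt0r_neq0.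
by have := main N; rewrite Nl [a + _]addrC subrK.
Qed.

Lemma hausdorff_line (S : set R) : measurable (S : set MR) ->
  (hausdorff 1 (line @` S) <= leb S)%E.
Proof.
move=> mS; apply: hausdorff_le => delta d0; apply: le_ereal_inf_tmp => _ [U [mU SU] <-].
apply: (@le_trans _ _ (hausdorff_content 1 delta (\bigcup_k (line @` U k)))).
  by apply: contentS => _ [t St <-]; have [k _ Uk] := SU t St; exists k => //; exists t.
apply: (le_trans (content_subadd _ _ _)).
apply: lee_nneseries => [k _ _|k _]; first exact: content_ge0.
have [[a b] _ /= <-] := mU k.
have [ab|/ltW ba] := leP a b; first by rewrite wlength_itv_bnd // content_line_itv.
by rewrite set_itv_ge ?image_set0 ?content_set0 ?wlength0 ?(ltW d0) // bnd_simp -leNgt.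
Qed.

Lemma limn_einf_ge (u : (\bar R)^nat) (m : \bar R) N :
  (forall k, (N <= k)%N -> (m <= u k)%E) -> (m <= limn_einf u)%E.
Proof.
move=> h; rewrite limn_einf_lim (cvg_lim _ (@cvg_einfs_sup _ u)) //.
apply: le_trans (ereal_sup_ubound _); last by exists N.
by apply: le_ereal_inf_tmp => _ [k /= Nk <-]; exact: h.
Qed.

Lemma limn_einf_le (u : (\bar R)^nat) (c M : R) : 
  (forall k, (u k <= (c + M * k.+1%:R^-1)%:E)%E) -> (limn_einf u <= c%:E)%E.
Proof.
move=> h; have cv : (c + M * k.+1%:R^-1)%:E @[k --> \oo] --> c%:E.
  apply: cvg_EFin; first by near=> k.
  rewrite -[X in _ --> X]addr0 -(mulr0 M); apply: cvgD; first exact: cvg_cst.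
  apply: cvgM; first exact: cvg_cst.
  exact: cvg_harmonic.
have [cv1 cv2] := cvg_limn_einf_sup cv; rewrite -cv2.
rewrite !limn_einf_lim limn_esup_lim; apply: lee_lim.
- exact: is_cvg_einfs.
- exact: is_cvg_esups.
- near=> k; apply: (@le_trans _ _ (u k)).
    by rewrite /einfs /=; apply: ereal_inf_lbound; exists k => /=.
  rewrite /esups /=; apply: le_trans (h k) _.
  by apply: ereal_sup_ubound; rewrite /sdrop /=; exists k => /=.
Unshelve. all: by end_near. Qed.

(* The factor 4 (instead of the optimal 4 / pi) leaves room to replace the
   interval u(U) of a covering set U by one centred at a point of it. *)
Lemma eilenberg {n : nat} (A : set 'rV[R]_n) (u : 'rV[R]_n -> R) (L : R) : 0 <= L ->
  (forall p q, A p -> A q -> `|u p - u q| <= L * edist p q) ->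
  (hausdorff 2 A < +oo)%E ->
  exists J : MR -> \bar R, [/\ measurable_fun [set: MR] J,
    forall r, (0 <= J r)%E,
    forall r, (hausdorff 1 (A `&` [set p | u p = r]) <= J r)%E &
    (\int[leb]_r J r <= (4 * L)%:E * hausdorff 2 A)%E].
Proof.
move=> L0 uL fA.
have HA : hausdorff 2 A \is a fin_num by rewrite ge0_fin_numE // hausdorff_ge0.
set H := fine (hausdorff 2 A).
have ex (j : nat) : exists U : nat -> set 'rV[R]_n,
    [/\ delta_cover j.+1%:R^-1 A U, forall k, U k `<=` A &
    (\sum_(0 <= k <oo) (ball_volume 2 (U k))%:E <= (H + j.+1%:R^-1)%:E)%E].
  have j0 : 0 < j.+1%:R^-1 :> R by rewrite invr_gt0 ltr0n.
  have cf : (hausdorff_content 2 j.+1%:R^-1 A <= H%:E)%E.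
    by rewrite fineK //; exact: content_le_hausdorff.
  have [|U [cU dU] sU] := @content_adherent _ _ 2 j.+1%:R^-1 A j.+1%:R^-1 j0.
    exact: le_lt_trans cf (ltry _).
  exists (fun k => U k `&` A); split.
  - split; first by move=> x Ax; have [k _ Uk] := cU x Ax; exists k => //; split.
    by move=> k x y [Ux _] [Uy _]; exact: (dU k x y Ux Uy).
  - by move=> k x [].
  - apply: le_trans (_ : _ <= \sum_(0 <= k <oo) (ball_volume 2 (U k))%:E)%E _.
      apply: lee_nneseries => [k _ _|k _]; rewrite lee_fin ?ball_volume_ge0 //.
      rewrite -[leRHS]mul1r -(expr1n _ 2); apply: ball_volume_le => //.
      by rewrite mul1r; apply: diamS (dU k) _ => x [].
    by apply: le_trans sU _; rewrite EFinD; apply: leeD.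
have [U hU] := choice ex.
pose d j k := diam (U j k).
have d0 j k : 0 <= d j k by exact: diam_ge0.
(* For an empty covering set this is the default 0; the diameter is then 0 and the term contributes
   nothing. *)
pose x0 j k : 'rV[R]_n := xget 0 (U j k).
pose I j k : set MR := `[u (x0 j k) - L * d j k, u (x0 j k) + L * d j k]%classic.
have mI j k : measurable (I j k) by exact: measurable_itv.
have LD j k : 0 <= L * d j k by rewrite mulr_ge0.
have UI j k p : U j k p -> I j k (u p).
  move=> Up; have Ux : U j k (x0 j k) by exact: xgetI Up.
  have [[_ dU] UA _] := hU j.
  rewrite /I /= in_itv /=; have := uL _ _ (UA _ _ Up) (UA _ _ Ux).
  have : L * edist p (x0 j k) <= L * d j k by rewrite ler_wpM2l //; exact: le_diam (dU k) _ _.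
  by move=> h1 h2; have := le_trans h2 h1; rewrite ler_norml; lra.
pose f j k (r : MR) : \bar R := ((d j k) * \1_(I j k) r)%:E.
pose W j (r : MR) : \bar R := (\sum_(0 <= k <oo) f j k r)%E.
have f0 j k r : (0 <= f j k r)%E by rewrite lee_fin mulr_ge0.
have mf j k : measurable_fun [set: MR] (f j k).
  apply/measurable_EFinP; apply: measurable_funM; first exact: measurable_cst.
  exact: measurable_indic.
have mW j : measurable_fun [set: MR] (W j).
  by apply: ge0_emeasurable_sum => // k r _ _; exact: f0.
have W0 j r : (0 <= W j r)%E by apply: nneseries_ge0 => k _ _; exact: f0.
have intW j : (\int[leb]_r W j r <= (4 * L * H + 4 * L * j.+1%:R^-1)%:E)%E.
  rewrite integral_nneseries //.
  have intf k : (\int[leb]_r f j k r <= (4 * L)%:E * (ball_volume 2 (U j k))%:E)%E.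
    under eq_integral do rewrite /f EFinM.
    rewrite ge0_integralZl //; last 2 first.
    - by apply/measurable_EFinP; exact: measurable_indic.
    - by rewrite lee_fin.
    have lI : leb (I j k) = (2 * L * d j k)%:E.
      rewrite /I lebesgue_measure_itv /= lte_fin; have := LD j k.
      by case: ltP => h1 h2; rewrite -?EFinB; congr _%:E; lra.
    rewrite integral_indic // setIT [X in ((d j k)%:E * X)%E]lI -!EFinM lee_fin ball_volume2 -/(d j k).
    have pi2 : 2 <= pi :> R by exact: pi_ge2.
    have h : 0 <= L * d j k ^+ 2 * (pi - 2) by rewrite !mulr_ge0 ?subr_ge0 // sqr_ge0.
    rewrite expr_div_n; have -> : 4 * L * (pi * (d j k ^+ 2 / 2 ^+ 2)) = L * d j k ^+ 2 * pi.
      by clear pi2 h; move: (pi) => P; field.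
    by lra.
  apply: (@le_trans _ _ (\sum_(0 <= k <oo) (4 * L)%:E * (ball_volume 2 (U j k))%:E)%E).
    by apply: lee_nneseries => [k _ _|k _ //]; apply: integral_ge0 => r _; exact: f0.
  rewrite nneseriesZl //; last by move=> k _; rewrite lee_fin ball_volume_ge0.
  by rewrite -mulrDr [leRHS]EFinM lee_wpmul2l ?lee_fin ?mulr_ge0 //; have [] := hU j.
(* The slice measure is replaced by a measurable majorant, the lower limit of the covering sums,
   whose integral is controlled by Fatou's lemma. *)
exists (fun r => limn_einf (W ^~ r)); split.
- rewrite (_ : (fun r => limn_einf (W ^~ r)) = (fun r => - limn_esup (fun j => - W j r)%E)%E) //.
  by apply: measurableT_comp => //; apply: measurable_fun_limn_esup => j; exact: measurableT_comp.
- by move=> r; apply: (@limn_einf_ge _ _ 0) => k _.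
- move=> r; apply: hausdorff_le => delta dl0.
  have [N hN] : exists N : nat, N.+1%:R^-1 < delta.
    by have [N] := @ltr_add_invr _ 0 delta dl0; rewrite add0r; exists N.
  apply: (@limn_einf_ge _ _ N) => j Nj.
  have jd : j.+1%:R^-1 <= delta.
    by apply: le_trans (ltW hN); rewrite lef_pV2 ?posrE ?ltr0n // ler_nat ltnS.
  apply: le_trans (content_antitone _ _ jd) _.
  have [[cU dU] UA _] := hU j.
  pose U' k := if r \in I j k then U j k else set0.
  have cov : delta_cover j.+1%:R^-1 (A `&` [set p | u p = r]) U'.
    split; last by move=> k x y; rewrite /U'; case: ifP => // _; exact: dU.
    move=> p [Ap /= pr]; have [k _ Uk] := cU p Ap; exists k => //.
    by rewrite /U' ifT //; apply/mem_set; rewrite -pr; exact: UI.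
  apply: le_trans (content_le _ cov) _; apply: lee_nneseries => [k _ _|k _].
    by rewrite lee_fin ball_volume_ge0.
  rewrite /f lee_fin ball_volume1 /U' indicE; case: ifP => _ /=; first by rewrite mulr1.
  by rewrite diam_set0 mulr0.
- apply: le_trans (fatou _ _ _ _) _ => //.
  rewrite -(fineK HA) -EFinM; apply: (@limn_einf_le _ _ (4 * L)) => j; exact: intW.
Qed.

End Slices.

(** * The coarea inequality for the norm *)

Section Coarea.
Context {R : realType} {n : nat}.
Local Notation V := 'rV[R]_n.+2.
Local Notation MR := (measurableTypeR R).
Local Notation RR := (MR * MR)%type.
Local Notation leb := (@lebesgue_measure R).

(** If |c| < 1/8 the norm is 1/4-Lipschitz on A, and the constant 4 of Eilenberg's inequality is
    compensated. Otherwise |p| and p.v serve as coordinates: the slices are nearly segments in the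
    direction v, their lengths are bounded by the sections of a measurable planar hull, and Fubini
    integrates these. *)
Lemma coarea_piece (A : set V) (eps rho a kap : R) :
  0 <= eps -> 0 < a -> near_planar (eps ^+ 2) A -> diam_bounded A rho ->
  (forall x, A x -> a <= enorm x) -> (hausdorff 2 A < +oo)%E ->
  eps + 2 * rho / a <= kap -> eps ^+ 2 <= kap -> 0 <= kap -> kap <= 128^-1 ->
  exists J : MR -> \bar R, [/\ measurable_fun [set: MR] J,
    forall r, (0 <= J r)%E,
    forall r, (hausdorff 1 (A `&` esphere 0%R r) <= J r)%E &
    (\int[leb]_r J r <= (1 + 16 * kap)%:E * hausdorff 2 A)%E].
Proof.
move=> eps0 a0 np Ad Aa fA hk1 hk2 k0 k1.
have [e [v [c [c1 h]]]] := radial_coordinates eps0 a0 np Ad Aa.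
have hr p q : A p -> A q ->
    `|enorm p - enorm q| <= `|c| * `|dotp (p - q) e| + kap * edist p q.
  move=> Ap Aq; have [_ _ hr] := h p q Ap Aq.
  rewrite -normrM -[X in `|X| <= _](subrK (c * dotp (p - q) e)).
  apply: le_trans (ler_normD _ _) _; rewrite addrC lerD2l.
  by apply: le_trans hr _; rewrite ler_wpM2r // edist_ge0.
have Xd p q : A p -> A q -> `|dotp (p - q) e| <= edist p q.
  move=> Ap Aq; have [hb _ _] := h p q Ap Aq.
  apply: sqrt_le_of_sqr; first exact: edist_ge0.
  by rewrite real_normK ?num_real //; have := sqr_ge0 (dotp (p - q) v); lra.
have sphE r : A `&` esphere 0 r = A `&` [set p | enorm p = r].
  by apply/seteqP; split => p [Ap]; rewrite /esphere /= edist0l.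
have [c8|c8] := ltP (`|c|) (8^-1).
  have [|p q Ap Aq|//|J [mJ J0 JH iJ]] := @eilenberg R _ A (@enorm R _) (4^-1).
  - by rewrite invr_ge0.
  - apply: le_trans (hr p q Ap Aq) _; have := Xd p q Ap Aq.
    have := edist_ge0 p q; move: (edist p q) => d d0 hd.
    apply: (@le_trans _ _ (8^-1 * d + 128^-1 * d)).
      by apply: lerD; [apply: ler_pM => //; exact: ltW|rewrite ler_wpM2r].
    by lra.
  - exists J; split => // [r|]; first by rewrite sphE.
    apply: le_trans iJ _; rewrite lee_wpmul2r ?hausdorff_ge0 // lee_fin.
    by rewrite mulfV //; lra.
pose F (p : V) : RR := (enorm p, dotp p v).
have [G [mG FG GH]] := hausdorff_hull (F @` A).
have HG : ((leb \x leb) G <= ((1 + 3 * kap) ^+ 2)%:E * hausdorff 2 A)%E.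
  apply: le_trans (lebesgue_le_hausdorff mG) _; apply: le_trans GH _.
  rewrite image_comp -{2}(image_id A).
  have K0 : 0 < 1 + 3 * kap by lra.
  apply: (@hausdorff_map R _ _ _ 1 (1 + 3 * kap) A (diag 1 1 \o F) id) => // p q Ap Aq.
  have d0 := edist_ge0 p q.
  apply: sqrt_le_of_sqr; first by rewrite mulr_ge0 // ltW.
  rewrite sqr_edist_diag expr1n !mul1r /F /= -dotpBl.
  have [hb _ _] := h p q Ap Aq.
  have hD : `|enorm p - enorm q| <= `|dotp (p - q) e| + kap * edist p q.
    by apply: le_trans (hr p q Ap Aq) _; rewrite lerD2r ler_piMl.
  have {}Xd := Xd p q Ap Aq.
  rewrite -[X in X + _]real_normK ?num_real //.
  rewrite -[X in X + _ <= _]real_normK ?num_real // in hb.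
  move: (`|enorm p - enorm q|) (normr_ge0 (enorm p - enorm q)) hD => D D0 hD.
  move: (`|dotp (p - q) e|) (normr_ge0 (dotp (p - q) e)) hD Xd hb => X X0 hD Xd hb.
  move: (edist p q) d0 hD Xd hb => d d0 hD Xd hb.
  have h1 : D ^+ 2 <= (X + kap * d) ^+ 2 by rewrite lerXn2r ?nnegrE // addr_ge0 ?mulr_ge0.
  have h2 : kap * d * X <= kap * d * d by rewrite ler_wpM2l ?mulr_ge0.
  have h3 : kap * (kap * d ^+ 2) <= 1 * (kap * d ^+ 2).
    by rewrite ler_wpM2r ?mulr_ge0 ?sqr_ge0 //; lra.
  have h4 : 0 <= kap * d ^+ 2 by rewrite mulr_ge0 ?sqr_ge0.
  have h5 : 0 <= (kap * d) ^+ 2 by rewrite sqr_ge0.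
  rewrite sqrrD in h1; rewrite exprMn; lra.
have K0 : 0 < 1 + 2 * kap by lra.
pose w (r : MR) : \bar R := leb (xsection G r).
have mw : measurable_fun [set: MR] w by exact: measurable_fun_xsection.
have iw : (\int[leb]_r w r = (leb \x leb) G)%E by [].
exists (fun r => (1 + 2 * kap)%:E * w r)%E; split.
- by apply: emeasurable_funM => //; exact: measurable_cst.
- by move=> r; rewrite mule_ge0 ?lee_fin ?(ltW K0) // /w measure_ge0.
- move=> r; rewrite sphE; set S := A `&` _.
  apply: (@le_trans _ _ ((1 + 2 * kap)%:E * hausdorff 1 ((line \o (fun p => dotp p v)) @` S))%E).
    rewrite -{1}(image_id S).
    apply: (@hausdorff_map R _ _ _ 0 (1 + 2 * kap) S id (line \o (fun p => dotp p v))) => //.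
    move=> p q [Ap /= pr] [Aq qr]; rewrite edist_line -dotpBl.
    have [_ hp hc] := h p q Ap Aq; rewrite pr qr subrr sub0r normrN normrM in hc.
    have d0 := edist_ge0 p q.
    have {}hc : `|c| * `|dotp (p - q) e| <= kap * edist p q.
      by apply: le_trans hc _; rewrite ler_wpM2r.
    apply: sqrt_le_of_sqr; first by rewrite mulr_ge0 // ltW.
    rewrite -[X in _ * (X + _)]real_normK ?num_real // in hp.
    (* Within a slice the norm is constant, so c X is of size kap d, and |c| >= 1/8 bounds X. *)
    have hX : `|dotp (p - q) e| <= 8 * kap * edist p q.
      have := ler_wpM2r (normr_ge0 (dotp (p - q) e)) c8; lra.
    move: (`|dotp (p - q) e|) (normr_ge0 (dotp (p - q) e)) hX hp {hc} => X X0 hX hp.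
    rewrite exprMn real_normK ?num_real //.
    move: (edist p q) (dotp (p - q) v) d0 hX hp => d Y d0 hX hp.
    have h1 : X ^+ 2 <= (8 * kap * d) ^+ 2.
      by rewrite lerXn2r ?nnegrE // !mulr_ge0.
    have h2 : kap * (kap * d ^+ 2) <= 128^-1 * (kap * d ^+ 2).
      by rewrite ler_wpM2r ?mulr_ge0 ?sqr_ge0.
    have h3 : X ^+ 2 <= kap / 2 * d ^+ 2 by rewrite !exprMn in h1; lra.
    have d2 := sqr_ge0 d; have Y2 := sqr_ge0 Y.
    have XY : 0 <= X ^+ 2 + Y ^+ 2 by rewrite addr_ge0 ?sqr_ge0.
    have h4 : d ^+ 2 <= (1 + kap) * (X ^+ 2 + Y ^+ 2).
      by apply: le_trans hp _; rewrite ler_wpM2r // lerD2l.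
    have h5 : (1 + kap) * (X ^+ 2 + Y ^+ 2) <= (1 + kap) * (kap / 2 * d ^+ 2 + Y ^+ 2).
      by rewrite ler_wpM2l ?lerD2r //; lra.
    have kd : 0 <= kap * d ^+ 2 by rewrite mulr_ge0.
    have h6 : (1 - kap) * d ^+ 2 <= (1 + kap) * Y ^+ 2 by lra.
    have k1' : 0 < 1 - kap by lra.
    rewrite -(ler_pM2l k1'); apply: le_trans h6 _; rewrite [leRHS]mulrA ler_wpM2r //.
    have : 0 <= kap * (1 - kap * kap * 2).
      by rewrite mulr_ge0 // subr_ge0; have := ler_pM k0 k0 k1 k1; lra.
    by lra.
  rewrite lee_pmul2l ?lte_fin //; apply: le_trans (hausdorff_line _).
    apply: hausdorffS => _ [p [Ap /= pr] <-]; exists (dotp p v) => //.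
    by rewrite /xsection /= inE; apply: FG; exists p => //; rewrite /F pr.
  exact: measurable_xsection.
- rewrite ge0_integralZl //; last by rewrite lee_fin ltW.
  rewrite iw; apply: (@le_trans _ _ ((1 + 2 * kap)%:E * (((1 + 3 * kap) ^+ 2)%:E * hausdorff 2 A))%E).
    by rewrite lee_pmul2l ?lte_fin.
  rewrite muleA -EFinM lee_wpmul2r ?hausdorff_ge0 // lee_fin.
  have k2 : kap * kap <= 128^-1 * kap by rewrite ler_wpM2r.
  have k3 : kap * kap * kap <= kap * kap by rewrite ler_piMr ?mulr_ge0 //; lra.
  by lra.
Qed.

(** The majorants of the pieces are summed; the null remainder is handled by Eilenberg's inequality,
    which gives a majorant with integral 0. *)
Lemma coarea_majorant (E : set V) (a eta : R) : rectifiable 2 E ->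
  (hausdorff 2 E < +oo)%E -> 0 < a -> (forall x, E x -> a <= enorm x) -> 0 < eta ->
  exists J : MR -> \bar R, [/\ measurable_fun [set: MR] J,
    forall r, (0 <= J r)%E,
    forall r, (hausdorff 1 (E `&` esphere 0%R r) <= J r)%E &
    (\int[leb]_r J r <= (1 + eta)%:E * hausdorff 2 E)%E].
Proof.
move=> rE fE a0 Ea eta0; pose kap := Num.min (128^-1) (eta / 16).
have kap0 : 0 < kap by rewrite lt_min invr_gt0 divr_gt0 // ltr0n.
have kap1 : kap <= 128^-1 by rewrite ge_min lexx.
have kapeta : 16 * kap <= eta by rewrite mulrC -ler_pdivlMr // ge_min lexx orbT.
pose eps := kap / 2; pose rho := kap * a / 4.
have eps0 : 0 < eps by rewrite divr_gt0.
have rho0 : 0 < rho by rewrite divr_gt0 ?mulr_gt0.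
have [A [hA tA NA]] := rectifiable_pieces rE (exprn_gt0 2 eps0) rho0.
pose N := E `\` \bigcup_k A k.
have fin X : X `<=` E -> (hausdorff 2 X < +oo)%E.
  by move=> XE; apply: le_lt_trans fE; exact: hausdorffS.
have [|p q _ _||J0 [mJ0 J00 J0H iJ0]] := @eilenberg R _ N (@enorm R _) 1.
- by [].
- by rewrite mul1r; exact: enorm_lip.
- by apply: fin => x [].
rewrite /N NA mule0 in iJ0.
have exJ k : exists J : MR -> \bar R, [/\ measurable_fun [set: MR] J,
    forall r, (0 <= J r)%E,
    forall r, (hausdorff 1 ((E `&` A k) `&` esphere 0%R r) <= J r)%E &
    (\int[leb]_r J r <= (1 + eta)%:E * hausdorff 2 (E `&` A k))%E].
  have [_ np dA] := hA k.
  have [| | | | | | | | | |J [mJ J1 JH iJ]] := @coarea_piece (E `&` A k) eps rho a kap => //.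
  - exact: ltW.
  - by apply: near_planarS np => x [].
  - by move=> x y [_ Ax] [_ Ay]; exact: dA.
  - by move=> x [Ex _]; exact: Ea.
  - by apply: fin => x [].
  - rewrite /eps /rho le_eqVlt; apply/orP; left; apply/eqP; field; exact: lt0r_neq0.
  - rewrite /eps expr_div_n; have : kap * kap <= kap by rewrite ler_piMl ?(ltW kap0) //; lra.
    by have := ltW kap0; lra.
  - exact: ltW.
  exists J; split => //; apply: le_trans iJ _; rewrite lee_wpmul2r ?hausdorff_ge0 // lee_fin.
  by rewrite lerD2l.
have [J hJ] := choice exJ.
have mJ k : measurable_fun [set: MR] (J k) by have [] := hJ k.
have J1 k r : (0 <= J k r)%E by have [] := hJ k.
pose SJ (r : MR) : \bar R := (\sum_(0 <= k <oo) J k r)%E.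
have mSJ : measurable_fun [set: MR] SJ by apply: ge0_emeasurable_sum => // k r _ _; exact: J1.
have SJ0 r : (0 <= SJ r)%E by apply: nneseries_ge0 => k _ _; exact: J1.
exists (fun r => J0 r + SJ r)%E; split.
- exact: emeasurable_funD.
- by move=> r; rewrite adde_ge0.
- move=> r; apply: (@le_trans _ _ (hausdorff 1 ((N `&` esphere 0 r) `|`
      \bigcup_k ((E `&` A k) `&` esphere 0 r)))).
    apply: hausdorffS => x [Ex xr]; have [[k _ Ak]|nA] := pselect ((\bigcup_k A k) x).
      by right; exists k.
    by left; split.
  apply: le_trans (outer_measureU2 _ _ _) _; apply: leeD.
    apply: le_trans (J0H r); apply: hausdorffS => x [Nx]; rewrite /esphere /= edist0l => xr.
    by split.
  apply: le_trans (hausdorff_subadd _ _) _; apply: lee_nneseries => [k _ _|k _].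
    exact: hausdorff_ge0.
  by have [] := hJ k.
- rewrite ge0_integralD //.
  have -> : (\int[leb]_r J0 r = 0)%E by apply/eqP; rewrite eq_le iJ0 integral_ge0.
  rewrite add0e integral_nneseries //.
  apply: (@le_trans _ _ (\sum_(0 <= k <oo) ((1 + eta)%:E * hausdorff 2 (E `&` A k)))%E).
    apply: lee_nneseries => [k _ _|k _]; first by apply: integral_ge0 => r _; exact: J1.
    by have [] := hJ k.
  rewrite nneseriesZl //; last by move=> k _; exact: hausdorff_ge0.
  rewrite lee_wpmul2l //; first by rewrite lee_fin; lra.
  by apply: hausdorff_pieces => // k; have [] := hA k.
Qed.

End Coarea.

Lemma rectifiableS {R : realType} {n : nat} d (A B : set 'rV[R]_n) :
  A `<=` B -> rectifiable d.+1 B -> rectifiable d.+1 A.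
Proof.
move=> AB [f [lf B0]]; exists f; split => //.
by apply: hausdorff_nullS B0; exact: setSD.
Qed.

(** * The area of E in balls *)

Section Mass.
Context {R : realType} {n : nat}.
Local Notation V := 'rV[R]_n.+2.
Local Notation MR := (measurableTypeR R).
Local Notation leb := (@lebesgue_measure R).
Implicit Types (E : set V) (r s t : R).

Definition mass E r : R := fine (hausdorff 2 (E `&` eball 0 r)).

Lemma eball0E r : eball (0 : V) r = [set x | enorm x < r].
Proof. by apply/seteqP; split => x; rewrite /eball /= edist0l. Qed.

Lemma massE E r : (hausdorff 2 E < +oo)%E ->
  hausdorff 2 (E `&` eball 0 r) = (mass E r)%:E.
Proof.
move=> fE; rewrite fineK // ge0_fin_numE ?hausdorff_ge0 //.
by apply: le_lt_trans fE; apply: hausdorffS => x [].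
Qed.

Lemma mass_ge0 E r : 0 <= mass E r.
Proof. by rewrite fine_ge0 // hausdorff_ge0. Qed.

Lemma mass_le E s t : (hausdorff 2 E < +oo)%E -> s <= t -> mass E s <= mass E t.
Proof.
move=> fE st; rewrite -lee_fin -!massE //; apply: hausdorffS; apply: setIS.
by rewrite !eball0E => x /= /lt_le_trans; apply.
Qed.

Lemma mass_shell E s t : (hausdorff 2 E < +oo)%E -> s <= t ->
  hausdorff 2 (E `&` [set x | s <= enorm x < t]) = (mass E t - mass E s)%:E.
Proof.
move=> fE st.
have cs : (@hausdorff R n.+2 2).-caratheodory [set x | - enorm x <= - s].
  by apply: caratheodory_lip_sublevel => x y; rewrite -opprD normrN enorm_lip.
have := cs (E `&` eball 0 t); rewrite massE // !eball0E.
have -> : E `&` [set x | enorm x < t] `&` [set x | - enorm x <= - s] =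
    E `&` [set x | s <= enorm x < t].
  apply/seteqP; split => x /=; first by move=> [[Ex xt]]; rewrite lerN2 xt => ->.
  by move=> [Ex /andP[sx xt]]; rewrite lerN2.
have -> : E `&` [set x | enorm x < t] `&` ~` [set x | - enorm x <= - s] = E `&` eball 0 s.
  rewrite eball0E; apply/seteqP; split => x /=.
    by move=> [[Ex xt]] /negP; rewrite lerN2 -ltNge.
  move=> [Ex xs]; split; first by split => //; exact: lt_le_trans st.
  by apply/negP; rewrite lerN2 -ltNge.
rewrite massE //; set X := hausdorff 2 _ => h.
have fX : X \is a fin_num.
  rewrite ge0_fin_numE ?hausdorff_ge0 //.
  by apply: le_lt_trans fE; apply: hausdorffS => x [].
by rewrite EFinB h addeK.
Qed.

(** A mean value argument: if the majorant exceeded the stated bound on the whole interval, its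
    integral would be at least D + eta. The relative error eta/(D + 1) keeps the coarea bound
    strictly below that. *)
Lemma coarea_slice E s t eta : rectifiable 2 E -> (hausdorff 2 E < +oo)%E ->
  0 < s -> s < t -> 0 < eta ->
  exists2 r, s < r < t &
    (hausdorff 1 (E `&` esphere 0%R r) <= ((mass E t - mass E s + eta) / (t - s))%:E)%E.
Proof.
move=> rE fE s0 st eta0; set D := mass E t - mass E s.
have D0 : 0 <= D by rewrite subr_ge0 mass_le // ltW.
pose A := E `&` [set x | s <= enorm x < t].
have AE : A `<=` E by move=> x [].
have HA : hausdorff 2 A = D%:E by apply: mass_shell => //; exact: ltW.
have [||x [_ /andP[]]||J [mJ J0 JH iJ]] //:= @coarea_majorant R n A s (eta / (D + 1)) _ _ s0.
- exact: rectifiableS rE.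
- by rewrite HA ltry.
- by rewrite divr_gt0 // ltr_wpDl.
pose M := (D + eta) / (t - s).
have M0 : 0 < M by rewrite divr_gt0 ?subr_gt0 // ltr_wpDl.
have [[r rst rM]|none] := pselect (exists2 r, s < r < t & (J r <= M%:E)%E).
  exists r => //; apply: le_trans rM; apply: le_trans (JH r); apply: hausdorffS => x [Ex xr].
  by split; [split => //=|]; move: xr rst; rewrite /esphere /= ?edist0l // => -> /andP[/ltW -> ->].
have big : ((D + eta)%:E <= \int[leb]_r J r)%E.
  apply: (@le_trans _ _ (\int[leb]_(r in `]s, t[%classic) (M%:E)))%E.
    have lI : leb (`]s, t[%classic : set MR) = (t - s)%:E.
      by rewrite lebesgue_measure_itv /= lte_fin st -EFinB.
    rewrite integral_cst // [X in (_ * X)%E]lI -EFinM lee_fin.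
    by rewrite /M divfK // subr_eq0 gt_eqF.
  apply: (@le_trans _ _ (\int[leb]_(r in `]s, t[%classic) J r)%E).
    apply: ge0_le_integral => //.
    - by move=> r _; rewrite lee_fin ltW.
    - exact: measurable_funTS.
    - move=> r /=; rewrite in_itv /= => rst; rewrite leNgt; apply/negP => rM.
      by apply: none; exists r => //; exact: ltW.
  exact: ge0_subset_integral.
have := le_trans big iJ; rewrite HA -EFinM lee_fin mulrDl mul1r lerD2l => h.
suff : eta / (D + 1) * D < eta by lra.
rewrite mulrAC ltr_pdivrMr ?ltr_pM2l; lra.
Qed.

End Mass.

(** * Sliding competitors *)

Section Competitor.
Context {R : realType}.
Local Notation V := 'rV[R]_3.
Implicit Types (E : set V) (phi : V -> V).

(** The straight homotopy from the identity to phi remains admissible because the half space, its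
    boundary plane and the ball are convex. *)
Lemma linear_sliding_deformation E (b : R) phi : 0 < b -> E `<=` Omega0 ->
  lipschitz_within E phi ->
  (forall x, E x -> [/\ Omega0 (phi x), b <= enorm x -> phi x = x,
     enorm x < b -> enorm (phi x) < b & L0 x -> L0 (phi x)]) ->
  sliding_deformation E (eball 0 b) (fun t x => (1 - t) *: x + t *: phi x).
Proof.
move=> b0 EO [K lphi] hphi; split.
- move=> t x; rewrite /= in_itv /= => /andP[t0 t1] Ex; have [h1 h2 h3 h4] := hphi x Ex.
  rewrite eball0E /Omega0 /L0 /= !mxE; split.
  + apply: addr_ge0; apply: mulr_ge0; rewrite ?subr_ge0 //; exact: EO.
  + by move=> /negP; rewrite -leNgt => /h2 ->; rewrite -scalerDl subrK scale1r.
  + move=> xb; apply: le_lt_trans (enormD _ _) _.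
    rewrite !enormZ !ger0_norm ?subr_ge0 //.
    have [->|tn0] := eqVneq t 0; first by rewrite subr0 mul1r mul0r addr0.
    have tp : 0 < t by rewrite lt0r tn0.
    have := h3 xb; rewrite -(ltr_pM2l tp).
    have : (1 - t) * enorm x <= (1 - t) * b by rewrite ler_wpM2l ?subr_ge0 // ltW.
    lra.
  + by move=> h; rewrite h mulr0 add0r; rewrite h4 ?mulr0.
- apply/subspace_continuousP => -[t x] [/= It Ex].
  apply: cvgD.
    apply: cvgZ; first (apply: cvgB; first exact: cvg_cst).
      by apply: cvg_within_filter; exact: cvg_fst.
    by apply: cvg_within_filter; exact: cvg_snd.
  apply: cvgZ; first by apply: cvg_within_filter; exact: cvg_fst.
  move=> B /nbhs_eball[e e0 eB].
  pose d := e / (`|K| + 1).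
  have K1 : 0 < `|K| + 1 by rewrite ltr_wpDl.
  have d0 : 0 < d by rewrite divr_gt0.
  have nx : nbhs x (eball x d) by apply/nbhs_eball; exists d.
  exists (setT, eball x d); first by split => //; exact: filterT.
  move=> [s y] [_ /= yx] [_ /= Ey]; apply: eB; rewrite /eball /=.
  apply: le_lt_trans (lphi _ _ Ex Ey) _.
  apply: (@le_lt_trans _ _ (`|K| * edist x y)).
    by rewrite ler_wpM2r ?edist_ge0 // ler_norm.
  apply: (@le_lt_trans _ _ ((`|K| + 1) * edist x y)).
    by rewrite ler_wpM2r ?edist_ge0 // lerDl.
  by rewrite mulrC -ltr_pdivlMr.
- exists K => x y Ex Ey; rewrite subrr !scale0r !add0r !scale1r; exact: lphi.
- by move=> x Ex; rewrite subr0 scale1r scale0r addr0.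
Qed.

Lemma almost_minimal_le E (h : R -> \bar R) (b : R) phi : 0 < b -> E `<=` Omega0 ->
  locally_sliding_almost_minimal h E 0 ->
  lipschitz_within E phi ->
  (forall x, E x -> [/\ Omega0 (phi x), b <= enorm x -> phi x = x,
     enorm x < b -> enorm (phi x) < b & L0 x -> L0 (phi x)]) ->
  (hausdorff 2 (E `&` eball 0 b) <=
    hausdorff 2 (phi @` (E `&` eball 0 b)) + h b * (b ^+ 2)%:E)%E.
Proof.
move=> b0 EO [_ am] lphi hphi.
apply: le_trans (am b _ b0 (linear_sliding_deformation b0 EO lphi hphi)) _.
apply: leeD => //; apply: hausdorffS => _ [[x Ex <-]].
rewrite subrr scale0r add0r scale1r eball0E /= => px; exists x => //; split => //=.
by rewrite ltNge; apply/negP => bx; have [_ h2 _ _] := hphi x Ex; move: px; rewrite h2 // ltNge bx.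
Qed.

Lemma radial_map_lip {n : nat} (psi : R -> R) (sigma : R) (p q : 'rV[R]_n) : 1 <= sigma ->
  (forall r, 0 <= r -> 0 <= psi r <= r) ->
  (forall r s, `|psi r - psi s| <= sigma * `|r - s|) ->
  edist (radial_map psi p) (radial_map psi q) <= sigma * edist p q.
Proof.
move=> s1 psib psil.
have rm0 : radial_map psi (0 : 'rV[R]_n) = 0 by rewrite /radial_map scaler0.
have rmn (x : 'rV[R]_n) : x != 0 -> enorm (radial_map psi x) <= sigma * enorm x.
  rewrite -enorm_gt0 => x0; have /andP[h1 h2] := psib _ (enorm_ge0 x).
  rewrite /radial_map enormZ ger0_norm ?divr_ge0 ?enorm_ge0 // divfK ?lt0r_neq0 //.
  by apply: le_trans h2 _; rewrite ler_peMl ?enorm_ge0.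
have [->|p0] := eqVneq p 0.
  rewrite rm0 !edist0l; have [->|q0] := eqVneq q 0; last exact: rmn.
  by rewrite rm0 enorm0 mulr0.
have [->|q0] := eqVneq q 0.
  by rewrite rm0 ![edist _ 0]edistC !edist0l; exact: rmn.
apply: sqrt_le_of_sqr; first by rewrite mulr_ge0 ?edist_ge0 //; lra.
apply: le_trans (@radial_map_le _ _ psi sigma 1 p q _ _ _ _ _ _ _) _; rewrite ?mul1r ?psib ?enorm_ge0 //.
rewrite exprMn expr1n mul1r.
have h1 : (enorm p - enorm q) ^+ 2 <= edist p q ^+ 2.
  by rewrite -[leLHS]real_normK ?num_real // lerXn2r ?nnegrE ?edist_ge0 // enorm_lip.
have st : 0 <= sigma ^+ 2 - 1 by rewrite subr_ge0 exprn_ege1.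
by have := ler_wpM2l st h1; lra.
Qed.

(** The affine part vanishes at a and meets the identity at b. The radial map thus sends the ball of
    radius a to the origin, stretches the shell from a to b over the ball of radius b, and fixes the
    outside. *)
Definition ramp (a b r : R) : R := Num.max 0 (Num.min r (b / (b - a) * (r - a))).

Lemma ramp_bound a b r : 0 <= r -> 0 <= ramp a b r <= r.
Proof. by move=> r0; rewrite /ramp le_max lexx ge_max r0 ge_min lexx. Qed.

Lemma ramp_lip a b r s : 0 <= a < b -> `|ramp a b r - ramp a b s| <= b / (b - a) * `|r - s|.
Proof.
move=> /andP[a0 ab]; wlog rs : r s / r <= s.
  move=> w; have [/w //|/ltW/w] := leP r s.
  by rewrite distrC [`|s - r|]distrC.
have ba : 0 < b - a by rewrite subr_gt0.
have s1 : 1 <= b / (b - a) by rewrite ler_pdivlMr // mul1r; lra.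
rewrite /ramp [`|r - s|]distrC [leLHS]distrC (ger0_norm (_ : 0 <= s - r)) ?subr_ge0 //.
have := ler_wpM2r (_ : 0 <= s - r) s1; rewrite subr_ge0 => /(_ rs).
move: (b / (b - a)) s1 => k k1.
have : k * (s - a) = k * (r - a) + k * (s - r) by ring.
move: (k * (s - a)) (k * (r - a)) (k * (s - r)) => u v w -> h.
rewrite /Num.max /Num.min.
by case: (ltP s (v + w)) => ?; case: (ltP r v) => ?;
  repeat match goal with |- context [if (0 < ?y)%O then _ else _] => case: (ltP 0 y) => ? end;
  rewrite ler_norml; lra.
Qed.

End Competitor.

Lemma hausdorff_set1 {R : realType} {n : nat} d (x : 'rV[R]_n) :
  hausdorff d.+1 [set x] = 0%E.
Proof.
apply/eqP; rewrite eq_le hausdorff_ge0 andbT; apply: hausdorff_le => delta d0.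
have x0 : diam_bounded [set x] 0 by move=> _ _ -> ->; rewrite edistxx.
apply: le_trans (content_le_single _ _) _.
  by move=> y z yx zx; apply: le_trans (x0 _ _ yx zx) (ltW d0).
have -> : ball_volume d.+1 [set x] = 0; last by [].
have -> : ball_volume d.+1 [set x] = unit_ball_volume d.+1 * (diam [set x] / 2) ^+ d.+1 by [].
have -> : diam [set x] = 0 by apply/eqP; rewrite eq_le diam_ge0 andbT diam_le.
by rewrite mul0r expr0n mulr0.
Qed.

(** * Comparison with cones *)

Section ConeCompetitor.
Context {R : realType}.
Local Notation V := 'rV[R]_3.
Variables (E : set V) (h : R -> \bar R).
Hypotheses (EO : E `<=` Omega0) (rE : rectifiable 2 E) (fE : (hausdorff 2 E < +oo)%E).
Hypothesis am : locally_sliding_almost_minimal h E 0.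

Let f := mass E.

(** Cut the shell from a to b into n layers. On the layer of index i the radial stretch is b/(b - a)
    and the angular stretch at most that times (i + 1)(b - a)/(n a); the image of the inner ball is
    a point. *)
Lemma cone_window (a b H : R) (n : nat) : 0 < a < b -> b <= 2 * a -> (0 < n)%N ->
  (h b <= H%:E)%E ->
  f b <= b ^+ 2 / (a * (b - a)) * (\sum_(i < n) i.+1%:R / n%:R *
    (f (a + i.+1%:R * ((b - a) / n%:R)) - f (a + i%:R * ((b - a) / n%:R)))) + H * b ^+ 2.
Proof.
move=> /andP[a0 ab] b2a n0 hH.
have b0 : 0 < b by lra.
have ba : 0 < b - a by lra.
have n0' : 0 < n%:R :> R by rewrite ltr0n.
set l := (b - a) / n%:R; have l0 : 0 < l by rewrite divr_gt0.
have nl : n%:R * l = b - a by rewrite /l mulrC divfK ?lt0r_neq0.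
set sig := b / (b - a).
have sig1 : 1 <= sig by rewrite ler_pdivlMr // mul1r; lra.
have sig0 : 0 < sig by apply: lt_le_trans sig1.
have aab : 0 <= a < b by rewrite (ltW a0).
pose psi := ramp a b; pose phi : V -> V := radial_map psi.
pose t (i : nat) := a + i%:R * l.
have psiE r : psi r = Num.max 0 (Num.min r (sig * (r - a))) by [].
have psil r s : `|psi r - psi s| <= sig * `|r - s| by exact: ramp_lip.
have psib r : 0 <= r -> 0 <= psi r <= r by exact: ramp_bound.
have phil : lipschitz_within E phi.
  by exists sig => x y _ _; exact: radial_map_lip.
have comp := almost_minimal_le b0 EO am phil _.
have {}comp : (hausdorff 2 (E `&` eball 0 b) <=
    hausdorff 2 (phi @` (E `&` eball 0 b)) + h b * (b ^+ 2)%:E)%E.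
  apply: comp => x Ex; have x0 := enorm_ge0 x; have /andP[p0 px] := psib _ x0.
  have c0 : 0 <= psi (enorm x) / enorm x by rewrite divr_ge0.
  split.
  - by rewrite /Omega0 /phi /radial_map /= mxE mulr_ge0 //; exact: EO.
  - move=> bx; rewrite /phi /radial_map psiE.
    have xg : 0 < enorm x by lra.
    have -> : Num.max 0 (Num.min (enorm x) (sig * (enorm x - a))) = enorm x.
      rewrite min_l ?max_r //; rewrite /sig mulrAC ler_pdivlMr //.
      by have := ler_wpM2l (ltW a0) bx; lra.
    by rewrite divff ?scale1r // lt0r_neq0.
  - move=> xb; apply: le_lt_trans xb; rewrite /phi /radial_map enormZ ger0_norm //.
    have [->|] := eqVneq (enorm x) 0; first by rewrite mulr0.
    by move=> xn; rewrite divfK.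
  - by rewrite /L0 /phi /radial_map /= mxE => ->; rewrite mulr0.
rewrite (massE _ fE) in comp.
pose c := b ^+ 2 / (a * (b - a)).
have shells m : (m <= n)%N -> (hausdorff 2 (phi @` (E `&` eball 0 (t m))) <=
    (c * (\sum_(i < m) i.+1%:R / n%:R * (f (t i.+1) - f (t i))))%:E)%E.
  elim: m => [_|m IH mn].
    rewrite big_ord0 mulr0; apply: (@le_trans _ _ (hausdorff 2 [set (0 : V)]));
      last by rewrite hausdorff_set1.
    apply: hausdorffS => y [x [Ex]].
    rewrite /t mul0r addr0 eball0E /= => xa <-; rewrite /phi /radial_map psiE.
    rewrite max_l ?mul0r ?scale0r // ge_min; apply/orP; right.
    by apply: mulr_ge0_le0; lra.
  rewrite big_ord_recr /= mulrDr EFinD.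
  have tm : t m <= t m.+1 by rewrite lerD2l ler_wpM2r ?(ltW l0) // ler_nat.
  have ta : a <= t m by rewrite lerDl mulr_ge0 // ltW.
  apply: (@le_trans _ _ (hausdorff 2 (phi @` (E `&` eball 0 (t m)) `|`
      phi @` (E `&` [set x | t m <= enorm x < t m.+1])))).
    apply: hausdorffS; rewrite -image_setU; apply: image_subset => x [Ex].
    rewrite !eball0E /= => xt; have [xs|xs] := ltP (enorm x) (t m); first by left; split.
    by right; split => //=; rewrite xs xt.
  apply: le_trans (outer_measureU2 _ _ _) _; apply: leeD; first exact: IH (ltnW mn).
  set S := E `&` _; pose tau := sig * (m.+1%:R * l) / a.
  (* The assumption b <= 2 a makes the angular factor at most the radial one, as
     [hausdorff_radial_map] requires. *)
  have ml : m.+1%:R * l <= a.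
    apply: (@le_trans _ _ (n%:R * l)); first by rewrite ler_wpM2r ?(ltW l0) // ler_nat.
    by rewrite nl; lra.
  have m0 : 0 <= m.+1%:R * l by rewrite mulr_ge0 // ltW.
  have -> : c * (m.+1%:R / n%:R * (f (t m.+1) - f (t m))) =
      (sig * tau) * (f (t m.+1) - f (t m)).
    rewrite /c /tau /sig /l; move: (f _ - f _) (m.+1%:R) => D M; field.
    by rewrite !lt0r_neq0.
  rewrite EFinM -(mass_shell fE tm).
  have sS : S `<=` E by move=> x [].
  apply: (@hausdorff_radial_map R 1 S psi sig tau a) => //.
  - exact: rectifiableS rE.
  - by apply: le_lt_trans fE; exact: hausdorffS.
  - by move=> x [_ /= /andP[h1 _]]; exact: le_trans h1.
  - by rewrite divr_ge0 // ?(ltW a0) // mulr_ge0 // ltW.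
  - by rewrite ler_pdivrMr // ler_wpM2l // ltW.
  - move=> x [_ /= /andP[h1 h2]]; rewrite psiE le_max lexx /=.
    have ax : a <= enorm x by exact: le_trans h1.
    rewrite ge_max; apply/andP; split.
      by rewrite mulr_ge0 ?enorm_ge0 // divr_ge0 ?(ltW a0) // mulr_ge0 // ltW.
    rewrite ge_min; apply/orP; right; rewrite /tau.
    have -> : sig * (m.+1%:R * l) / a * enorm x = sig * ((m.+1%:R * l) * (enorm x / a)).
      by field; rewrite lt0r_neq0.
    rewrite ler_wpM2l ?(ltW sig0) //.
    apply: (@le_trans _ _ (m.+1%:R * l)); first by rewrite lerBlDl; exact: ltW.
    by rewrite ler_peMr // ler_pdivlMr // mul1r.
have tn : t n = b by rewrite /t nl addrC subrK.
have := shells n (leqnn n); rewrite tn => sh.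
rewrite -lee_fin EFinD; apply: le_trans comp _; apply: leeD; first exact: sh.
by rewrite [leRHS]EFinM lee_wpmul2r // lee_fin sqr_ge0.
Qed.

(** The integrated form of f <= (r/2) f' + r^2 h. Summing [cone_window] over all positions of a
    sliding window, the increments of each layer telescope to at most f t - f s, and the weights (i
    + 1)/n average to about 1/2. *)
Lemma cone_monotonicity (s t H : R) : 0 < s < t -> 0 <= H ->
  (forall r, 0 < r <= t -> (h r <= H%:E)%E) ->
  (t - s) * f s <= t ^+ 2 / (2 * s) * (f t - f s) + (t - s) * t ^+ 2 * H.
Proof.
move=> /andP[s0 st] H0 hH.
have ts : 0 < t - s by lra.
have f0 r : 0 <= f r by exact: mass_ge0.
have fle r r' : r <= r' -> f r <= f r' by exact: mass_le.
set D := f t - f s; have D0 : 0 <= D by rewrite subr_ge0 fle // ltW.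
suff main (n : nat) : (0 < n)%N -> t - s <= n%:R * s ->
    (t - s) * f s <= t ^+ 2 / (2 * s) * D + (t - s) * t ^+ 2 * H +
      (t ^+ 2 / (2 * s) * D + (t - s) * f s) / n%:R.
  apply/ler_addgt0Pr => e e0.
  set Z := t ^+ 2 / (2 * s) * D + (t - s) * f s in main *.
  have Z0 : 0 <= Z by rewrite addr_ge0 // mulr_ge0 ?divr_ge0 ?mulr_ge0 ?sqr_ge0 //; lra.
  pose n := (Num.truncn ((t - s) / s + Z / e)).+1.
  have hn : (t - s) / s + Z / e <= n%:R by exact/ltW/truncnS_gt.
  have h1 : 0 <= (t - s) / s by rewrite divr_ge0; lra.
  have h2 : 0 <= Z / e by rewrite divr_ge0 // ltW.
  apply: le_trans (main n _ _) _ => //.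
    by rewrite -ler_pdivrMr //; lra.
  rewrite lerD2l ler_pdivrMr ?ltr0n // mulrC -ler_pdivrMr //; lra.
move=> n0 nts.
have n0' : 0 < n%:R :> R by rewrite ltr0n.
(* With n^2 steps, a window of n layers has width (t - s)/n, which tends to 0 while its number of
   layers grows. *)
pose N := (n * n)%N; have N0 : 0 < N%:R :> R by rewrite ltr0n muln_gt0 n0.
pose dl := (t - s) / N%:R; have dl0 : 0 < dl by rewrite divr_gt0.
pose x (i : nat) := s + i%:R * dl.
have xN : x N = t by rewrite /x /dl mulrC divfK ?lt0r_neq0 // addrC subrK.
have x_le i j : (i <= j)%N -> x i <= x j.
  by move=> ij; rewrite lerD2l ler_wpM2r ?(ltW dl0) // ler_nat.
have xs i : s <= x i by rewrite lerDl mulr_ge0 // ltW.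
pose c := t ^+ 2 / (s * (n%:R * dl)).
have c0 : 0 <= c by rewrite divr_ge0 ?sqr_ge0 // !mulr_ge0 // ltW.
have win k : (k + n <= N)%N -> f s <= c * (\sum_(i < n) i.+1%:R / n%:R *
    (f (x (k + i).+1) - f (x (k + i)%N))) + H * t ^+ 2.
  move=> kn; set a := x k; set b := x (k + n)%N.
  have ba : b - a = n%:R * dl by rewrite /a /b /x natrD; ring.
  have nd0 : 0 < n%:R * dl by rewrite mulr_gt0.
  have as_ : s <= a by exact: xs.
  have bt : b <= t by rewrite -xN; exact: x_le.
  have nds : n%:R * dl <= s.
    rewrite /dl /N natrM; have -> : n%:R * ((t - s) / (n%:R * n%:R)) = (t - s) / n%:R.
      by field; rewrite lt0r_neq0.
    by rewrite ler_pdivrMr // mulrC.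
  have := @cone_window a b H n; rewrite ba.
  have -> : n%:R * dl / n%:R = dl by rewrite mulrAC divff ?mul1r // lt0r_neq0.
  have b0 : 0 < b by lra.
  have b2 : b ^+ 2 <= t ^+ 2 by rewrite lerXn2r ?nnegrE //; lra.
  move=> /(_ _ _ n0 (hH b _)) cw; apply: le_trans (fle _ _ (xs (k + n)%N)) _.
  apply: le_trans (cw _ _ _) _; [by apply/andP; split; lra|by lra|by rewrite b0|].
  have aE i : a + i%:R * dl = x (k + i)%N by rewrite /a /x natrD; ring.
  under eq_bigr do rewrite !aE addnS.
  apply: lerD; last by rewrite ler_wpM2l.
  apply: ler_wpM2r.
    apply: sumr_ge0 => i _; rewrite mulr_ge0 ?divr_ge0 //.
    by rewrite subr_ge0 fle // x_le.
  have a0 : 0 < a by lra.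
  rewrite /c; apply: ler_pM => //; rewrite ?sqr_ge0 ?invr_ge0 //.
    by rewrite mulr_ge0 ?(ltW a0) ?(ltW nd0).
  rewrite lef_pV2 ?posrE; [|exact: mulr_gt0|exact: mulr_gt0].
  by rewrite ler_wpM2r // ltW.
have nN : (n <= N)%N by rewrite leq_pmulr.
(* The number of positions of the window; it covers all of t - s except for a part of size at most
   (t - s)/n. *)
pose K := (N - n).+1.
have sumw : K%:R * f s <= c * (\sum_(i < n) i.+1%:R / n%:R * D) + K%:R * (H * t ^+ 2).
  apply: (@le_trans _ _ (\sum_(k < K) (c * (\sum_(i < n) i.+1%:R / n%:R *
    (f (x (k + i).+1) - f (x (k + i)%N))) + H * t ^+ 2))).
    rewrite -[K in leLHS]card_ord mulr_natl -sumr_const; apply: ler_sum => k _.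
    by apply: win; have := ltn_ord k; rewrite /K; lia.
  rewrite big_split /= sumr_const card_ord -[X in _ + X <= _]mulr_natl lerD2r.
  rewrite -mulr_sumr ler_wpM2l // exchange_big /=; apply: ler_sum => i _.
  rewrite -mulr_sumr ler_wpM2l ?divr_ge0 //.
  have -> : \sum_(k < K) (f (x (k + i).+1) - f (x (k + i)%N)) =
      f (x (K + i)%N) - f (x i).
    by rewrite -(big_mkord xpredT (fun k => f (x (k + i).+1) - f (x (k + i)%N)))
      (telescope_sumr (fun k => f (x (k + i)%N))).
  rewrite lerB ?fle //.
  by rewrite -xN x_le // /K; have := ltn_ord i; lia.
have sumi : \sum_(i < n) i.+1%:R / n%:R * D = (n%:R + 1) / 2 * D.
  rewrite -mulr_suml -mulr_suml; congr (_ * _).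
  have -> : \sum_(i < n) i.+1%:R = n%:R * (n%:R + 1) / 2 :> R.
    elim: (n) => [|m IH]; first by rewrite big_ord0 !mul0r.
    by rewrite big_ord_recr IH /= -natr1; field.
  by field; rewrite lt0r_neq0.
rewrite sumi in sumw.
have Kd0 : 0 <= K%:R * dl by rewrite mulr_ge0 // ltW.
have Kd1 : K%:R * dl <= t - s.
  have -> : t - s = N%:R * dl by rewrite /dl mulrC divfK // lt0r_neq0.
  by rewrite ler_wpM2r ?(ltW dl0) // ler_nat /K; lia.
have Kd2 : (t - s) - (t - s) / n%:R <= K%:R * dl.
  have -> : (t - s) / n%:R = n%:R * dl.
    by rewrite /dl /N natrM; field; rewrite lt0r_neq0.
  have -> : t - s = N%:R * dl by rewrite /dl mulrC divfK // lt0r_neq0.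
  rewrite -mulrBl ler_wpM2r ?(ltW dl0) // -natrB // ler_nat /K; lia.
have h1 : K%:R * dl * f s <= t ^+ 2 / (2 * s) * D * (1 + n%:R^-1) + K%:R * dl * (H * t ^+ 2).
  have := ler_wpM2r (ltW dl0) sumw; rewrite mulrDl.
  have -> : c * ((n%:R + 1) / 2 * D) * dl = t ^+ 2 / (2 * s) * D * (1 + n%:R^-1).
    by rewrite /c; field; rewrite !lt0r_neq0.
  lra.
have h2 : K%:R * dl * (H * t ^+ 2) <= (t - s) * (H * t ^+ 2).
  by rewrite ler_wpM2r // mulr_ge0 ?sqr_ge0.
have h3 := ler_wpM2r (f0 s) Kd2.
lra.
Qed.

End ConeCompetitor.

(** * Great circle arcs are shortest *)

Section Meridian.
Context {R : realType} {n : nat}.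
Local Notation V := 'rV[R]_n.
Implicit Types (e v x z p q : V).

(** On the unit sphere with pole e, this keeps the latitude of p and moves p to the meridian through
    v. *)
Definition meridian e v p : V := dotp p e *: e + Num.sqrt (1 - dotp p e ^+ 2) *: v.

Lemma dotp_continuous v : continuous (fun p => dotp p v).
Proof.
move=> p B /nbhs_ballP[e /= e0 eB]; have v1 : 0 < enorm v + 1 by rewrite ltr_wpDl ?enorm_ge0.
apply/nbhs_eball; exists (e / (enorm v + 1)); first by rewrite divr_gt0.
move=> q; rewrite /eball /= ltr_pdivlMr // => h; apply: eB; rewrite /ball /= -dotpBl.
apply: le_lt_trans (dotp_norm_le _ _) _; apply: le_lt_trans h.
by rewrite ler_wpM2l ?enorm_ge0 // lerDl.
Qed.

Lemma sqr_enorm_reject e x : enorm x = 1 -> enorm e = 1 ->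
  enorm (x - dotp x e *: e) ^+ 2 = 1 - dotp x e ^+ 2.
Proof. by move=> x1 e1; rewrite sqr_enorm !dotpE (dotpC e x) -!sqr_enorm x1 e1; ring. Qed.

(** The components along e are kept, and the components orthogonal to e are replaced by parallel
    vectors of the same lengths; by Cauchy-Schwarz this only increases the inner product. *)
Lemma meridian_lip e v p q : enorm e = 1 -> enorm v = 1 -> dotp e v = 0 ->
  enorm p = 1 -> enorm q = 1 ->
  edist (meridian e v p) (meridian e v q) <= edist p q.
Proof.
move=> e1 v1 ev p1 q1.
have dd x : enorm x = 1 -> dotp x x = 1 by move=> x1; rewrite -sqr_enorm x1 expr1n.
have le1 x : enorm x = 1 -> 0 <= 1 - dotp x e ^+ 2.
  move=> x1; rewrite subr_ge0 -(expr1n _ 2) -[leLHS]real_normK ?num_real //.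
  by rewrite lerXn2r ?nnegrE //; have := dotp_norm_le x e; rewrite x1 e1 mulr1.
have pe := le1 _ p1; have qe := le1 _ q1.
apply: sqrt_le_of_sqr; first exact: edist_ge0.
have perp : dotp p q - dotp p e * dotp q e <=
    Num.sqrt (1 - dotp p e ^+ 2) * Num.sqrt (1 - dotp q e ^+ 2).
  have h := dotp_le (p - dotp p e *: e) (q - dotp q e *: e).
  have nn x : enorm x = 1 -> enorm (x - dotp x e *: e) = Num.sqrt (1 - dotp x e ^+ 2).
    move=> x1; rewrite /enorm; congr Num.sqrt.
    by rewrite !dotpE (dotpC e x) (dd _ e1) (dd _ x1); ring.
  rewrite !nn // in h; apply: le_trans h; rewrite le_eqVlt; apply/orP; left; apply/eqP.
  by rewrite !dotpE (dotpC e q) (dd _ e1); ring.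
have a2 : Num.sqrt (1 - dotp p e ^+ 2) ^+ 2 = 1 - dotp p e ^+ 2 by rewrite sqr_sqrtr.
have b2 : Num.sqrt (1 - dotp q e ^+ 2) ^+ 2 = 1 - dotp q e ^+ 2 by rewrite sqr_sqrtr.
rewrite /edist !sqr_enorm /meridian.
move: (Num.sqrt (1 - dotp p e ^+ 2)) (Num.sqrt (1 - dotp q e ^+ 2)) perp a2 b2 => a b perp a2 b2.
rewrite !dotpE (dotpC v e) ev (dd _ e1) (dd _ v1) (dd _ p1) (dd _ q1) (dotpC q p).
lra.
Qed.

(** The arc from x to e is contained in the image of C/r under the 1-Lipschitz retraction to the
    meridian of x: C reaches every latitude between those of x and e. *)
Lemma hausdorff_arc (e x : V) (C : set V) (r : R) : 0 < r ->
  enorm e = 1 -> enorm x = 1 -> dotp x e ^+ 2 < 1 ->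
  (forall p, C p -> enorm p = r) ->
  (forall c, dotp x e <= c <= 1 -> exists2 p, C p & dotp p e = r * c) ->
  (hausdorff 1 [set z | (exists s t : R, [/\ 0 <= s, 0 <= t & z = s *: x + t *: e]) /\ enorm z = 1]%R
    <= (r^-1)%:E * hausdorff 1 C)%E.
Proof.
move=> r0 e1 x1; set a := dotp x e => a1 Cr Civ.
have dd z : enorm z = 1 -> dotp z z = 1 by move=> z1; rewrite -sqr_enorm z1 expr1n.
pose k := Num.sqrt (1 - a ^+ 2).
have a10 : 0 < 1 - a ^+ 2 by rewrite subr_gt0.
have k0 : 0 < k by rewrite sqrtr_gt0.
have k2 : k ^+ 2 = 1 - a ^+ 2 by rewrite sqr_sqrtr // ltW.
pose v := k^-1 *: (x - a *: e).
have ev : dotp e v = 0.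
  by rewrite /v dotpZr dotpDr dotpNr dotpZr (dotpC e x) -/a (dd _ e1) mulr1 subrr mulr0.
have v1 : enorm v = 1.
  rewrite /v enormZ gtr0_norm ?invr_gt0 //.
  have -> : enorm (x - a *: e) = k.
    rewrite /enorm /k; congr Num.sqrt.
    by rewrite !dotpE (dotpC e x) (dd _ e1) (dd _ x1) -/a; ring.
  by rewrite mulVf // lt0r_neq0.
have ri : 0 < r^-1 by rewrite invr_gt0.
pose m p := meridian e v (r^-1 *: p).
have n1 p : C p -> enorm (r^-1 *: p) = 1.
  by move=> Cp; rewrite enormZ gtr0_norm // Cr // mulVf // lt0r_neq0.
apply: (@le_trans _ _ (hausdorff 1 (m @` C))); last first.
  rewrite -{2}(image_id C) -(expr1 r^-1); apply: (@hausdorff_map R _ _ _ 0) => // p q Cp Cq.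
  apply: le_trans (meridian_lip e1 v1 ev (n1 _ Cp) (n1 _ Cq)) _.
  by rewrite edistZZ gtr0_norm.
apply: hausdorffS => z /= [[s [t [s0 t0 zE]]] z1].
have c_e : dotp z e = s * a + t by rewrite zE dotpDl !dotpZl (dd _ e1) mulr1.
have nz : s ^+ 2 + t ^+ 2 + 2 * s * t * a = 1.
  by rewrite -[RHS](dd _ z1) zE !dotpE (dotpC e x) (dd _ e1) (dd _ x1) -/a; ring.
have c2 : 1 - dotp z e ^+ 2 = s ^+ 2 * k ^+ 2 by rewrite c_e k2; lra.
have cle1 : dotp z e <= 1.
  by have := dotp_norm_le z e; rewrite z1 e1 mulr1; apply: le_trans (ler_norm _).
(* By [c2] the part of z orthogonal to e has length s k. If z were below the latitude of x, then s >
   1 would follow for a >= 0 and s < 1 for a < 0, against the bounds on s drawn from |z| = 1. *)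
have acl : a <= dotp z e.
  rewrite leNgt; apply/negP => ca.
  have st0 : 0 <= s * t by rewrite mulr_ge0.
  have [ap|an] := leP 0 a.
    have : 0 <= s * t * a by rewrite mulr_ge0.
    have : s ^+ 2 <= 1 by have := sqr_ge0 t; have : 0 <= s * t * a by [rewrite mulr_ge0|]; lra.
    move=> s2 _; have h1 : s ^+ 2 * k ^+ 2 <= k ^+ 2 by rewrite ler_piMl // sqr_ge0.
    have cz0 : 0 <= dotp z e by rewrite c_e addr_ge0 // mulr_ge0.
    have : dotp z e ^+ 2 < a ^+ 2 by rewrite ltrXn2r // ?nnegrE.
    lra.
  have cn : dotp z e < 0 by lra.
  have h1 : 1 <= s ^+ 2.
    have : 0 <= t * (- (s * a + t) + - (s * a)).
      rewrite mulr_ge0 // addr_ge0 //; first by rewrite -c_e oppr_ge0 ltW.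
      by rewrite -mulrN mulr_ge0 // oppr_ge0 ltW.
    lra.
  have h2 : k ^+ 2 <= s ^+ 2 * k ^+ 2 by rewrite ler_peMl // sqr_ge0.
  have : (- a) ^+ 2 < (- dotp z e) ^+ 2 by rewrite ltrXn2r ?nnegrE ?oppr_ge0 ?ltW ?ltrN2.
  rewrite !sqrrN; lra.
have [|p Cp pe] := Civ (dotp z e); first by rewrite acl.
exists p => //; rewrite /m /meridian dotpZl pe mulrA mulVf ?mul1r ?lt0r_neq0 //.
rewrite c2 -exprMn sqrtr_sqr ger0_norm; last by rewrite mulr_ge0 // ltW.
rewrite /v scalerA -mulrA mulfV ?lt0r_neq0 // mulr1 c_e zE.
by apply/rowP => i; rewrite !mxE; ring.
Qed.

End Meridian.

(** * The length of the cone X(r) on the unit sphere *)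

Section Curves.
Context {R : realType}.
Local Notation V := 'rV[R]_3.
Implicit Types (E : set V) (y : V).

(** The curves overlap only in the point y, which is H^1-null, so their lengths add. *)
Lemma hausdorff_curves (C : nat -> set V) y m :
  (forall i, (i < m)%N -> (@hausdorff R 3 1).-caratheodory (C i)) ->
  (forall i j, (i < m)%N -> (j < i)%N -> C i `&` C j `<=` [set y]) ->
  (\sum_(i < m) hausdorff 1 (C i) <= hausdorff 1 [set x | exists2 i, (i < m)%N & C i x])%E.
Proof.
elim: m => [|m IH] cC dC; first by rewrite big_ord0 hausdorff_ge0.
rewrite big_ord_recr /=; set U := (X in (_ <= hausdorff 1 X)%E).
have {}IH : (\sum_(i < m) hausdorff 1 (C i) <=
    hausdorff 1 [set x | exists2 i, (i < m)%N & C i x])%E.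
  by apply: IH => [i im|i j im ij]; [exact: cC (ltnW im)|exact: dC (ltnW im) ij].
have -> : hausdorff 1 U = (hausdorff 1 (U `&` C m) + hausdorff 1 (U `&` ~` C m))%E.
  exact: cC (ltnSn m) U.
rewrite addeC; apply: leeD; first by apply: hausdorffS => x Cx; split => //; exists m.
apply: le_trans IH _; rewrite -[leRHS]adde0 -(hausdorff_set1 0 y).
apply: le_trans (outer_measureU2 _ _ _); apply: hausdorffS => x [i im Cix].
have [Cmx|nC] := pselect (C m x); first by right; exact: (dC m i).
by left; split => //; exists i => //; exact: ltnW.
Qed.

(** Along each curve the component along y is continuous, so by the intermediate value theorem the
    curve passes through all latitudes between its ends and [hausdorff_arc] applies. *)
Lemma hausdorff_sector ct E (eps r : R) y (Xs : set V) : 0 < r ->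
  selection ct E eps r y Xs ->
  (hausdorff 1 (sector_cone y Xs `&` esphere 0%R 1%R) <=
   (r^-1)%:E * hausdorff 1 (E `&` esphere 0%R r))%E.
Proof.
move=> r0 [[Sy nLy] XsS card [gam [hgam dgam _]]].
have [n {card}[g gX ginj]] : exists n, exists2 g : nat -> V, (forall x, Xs x <-> exists2 i, (i < n)%N & g i = x) &
    (forall i j, (i < n)%N -> (j < i)%N -> g i <> g j).
  have [n card'] : exists n, (Xs #= `I_n)%card by exists (if ct is Pplus then 2 else 3).
  move: card'; rewrite card_eq_sym => /pcard_eqP[g].
  exists n, g => [x|i j im ji gij].
    split; first by move=> /(@surj _ _ _ _ g)[i im gi]; exists i.
    by move=> [i im <-]; exact: (@funS _ _ _ _ g).
  have := @inj _ _ _ g i j; rewrite !inE /= => /(_ im (ltn_trans ji im) gij) ij.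
  by move: ji; rewrite ij ltnn.
pose C i := gam (g i) @` `[0, 1]%classic.
have gXi i : (i < n)%N -> Xs (g i) by move=> im; apply/gX; exists i.
have cC i : (i < n)%N -> (@hausdorff R 3 1).-caratheodory (C i).
  move=> im; apply: caratheodory_closed; apply: compact_closed => //.
  have [cg _ _ _ _] := hgam _ (gXi _ im).
  by apply: continuous_compact => //; exact: segment_compact.
have nS p : (E `&` esphere 0 r) p -> enorm p = r by move=> [_]; rewrite /esphere /= edist0l.
have arc i : (i < n)%N -> (hausdorff 1 [set z | (exists s t : R,
    [/\ 0 <= s, 0 <= t & z = s *: g i + t *: y]) /\ enorm z = 1]%R
    <= (r^-1)%:E * hausdorff 1 (C i))%E.
  move=> im; have [cg _ g0 g1 gS] := hgam _ (gXi _ im).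
  have [Sx Lx] := XsS _ (gXi _ im).
  have ri : 0 < r^-1 by rewrite invr_gt0.
  have y1 : enorm (r^-1 *: y) = 1 by rewrite enormZ gtr0_norm // nS // mulVf // lt0r_neq0.
  have x1 : enorm (r^-1 *: g i) = 1 by rewrite enormZ gtr0_norm // nS // mulVf // lt0r_neq0.
  (* The end point lies in the plane L0 and y does not, so the two are not parallel. *)
  have xy1 : dotp (r^-1 *: g i) (r^-1 *: y) ^+ 2 < 1.
    set e := r^-1 *: y in y1 *; set x := r^-1 *: g i in x1 *.
    have hx := sqr_enorm_reject x1 y1.
    rewrite lt_neqAle -[X in _ && X]subr_ge0 -hx sqr_ge0 andbT; apply/eqP => h1.
    have /eqP : enorm (x - dotp x e *: e) = 0.
      by apply/eqP; rewrite -sqrf_eq0 hx h1 subrr.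
    rewrite enorm_eq0 subr_eq0 => /eqP xe.
    have d0 : dotp x e != 0 by rewrite -sqrf_eq0 h1 oner_eq0.
    apply: nLy; move: Lx; rewrite /L0 /= => Lx.
    have := congr1 (fun v : V => v ord0 ord_max) xe; rewrite /x /e !mxE Lx mulr0 => /esym/eqP.
    by rewrite !mulf_eq0 (negbTE d0) invr_eq0 gt_eqF //= => /eqP.
  apply: le_trans (_ : _ <= hausdorff 1 [set z | (exists s t : R,
    [/\ 0 <= s, 0 <= t & z = s *: (r^-1 *: g i) + t *: (r^-1 *: y)]) /\ enorm z = 1]%R)%E _.
    apply: hausdorffS => z [[s [t [s0 t0 ->]]] z1]; split => //.
    exists (s * r), (t * r); split; rewrite ?mulr_ge0 ?(ltW r0) //.
    by rewrite !scalerA !mulfK // lt0r_neq0.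
  apply: hausdorff_arc => //.
    by move=> _ [t It <-]; apply: nS; apply: gS; exists t.
  move=> c /andP[c1 c2].
  have cf : {within `[0, 1], continuous (fun t => dotp (gam (g i) t) (r^-1 *: y))}.
    move/subspace_continuousP : cg => cg; apply/subspace_continuousP => t It.
    exact: cvg_comp (cg t It) (@dotp_continuous R 3 _ _).
  have [|t t01 tE] := @IVT _ _ 0 1 (r * c) ler01 cf.
    rewrite g0 g1 ge_min le_max; apply/andP; split; apply/orP; [right|left].
      rewrite -ler_pdivrMl //; apply: le_trans c1; by rewrite dotpZl.
    rewrite dotpZr -sqr_enorm nS // expr2 mulrA mulVf ?mul1r ?lt0r_neq0 //.
    by rewrite ler_piMr // ltW.
  by exists (gam (g i) t) => //; exists t.
pose arcs i := [set z : V | (exists s t : R,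
  [/\ 0 <= s, 0 <= t & z = s *: g i + t *: y]) /\ enorm z = 1].
apply: (@le_trans _ _ (\sum_(i < n) hausdorff 1 (arcs i))%E).
  apply: (@le_trans _ _ (hausdorff 1 [set z | exists2 i, (i < n)%N & arcs i z])).
    apply: hausdorffS => z [[x /gX[i im <-] [s [t h]]] z1]; exists i => //; split.
      by exists s, t.
    by move: z1; rewrite /esphere /= edist0l.
  have un m : (hausdorff 1 [set z | exists2 i, (i < m)%N & arcs i z] <=
      \sum_(i < m) hausdorff 1 (arcs i))%E.
    elim: m => [|m IH].
      rewrite big_ord0 -(hausdorff_set0 (n := 3) 0); apply: hausdorffS => z [i].
      by rewrite ltn0.
    rewrite big_ord_recr /=; apply: le_trans (leeD IH (lexx _)).
    apply: le_trans (outer_measureU2 _ _ _); apply: hausdorffS => z [i].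
    by rewrite ltnS leq_eqVlt => /orP[/eqP ->|im] az; [right|left; exists i].
  exact: un.
apply: (@le_trans _ _ (\sum_(i < n) ((r^-1)%:E * hausdorff 1 (C i)))%E).
  by apply: lee_sum => i _; exact: arc.
rewrite -ge0_sume_distrr; last by move=> i _; exact: hausdorff_ge0.
rewrite lee_wpmul2l ?lee_fin ?invr_ge0 ?(ltW r0) //.
apply: le_trans (@hausdorff_curves C y n cC _) _.
  move=> i j im ji; rewrite -(dgam (g i) (g j)) //; [exact: gXi|exact: gXi (ltn_trans ji im)|].
  exact: ginj.
apply: hausdorffS => z [i im Ciz]; have [_ _ _ _ gS] := hgam _ (gXi _ im).
exact: gS.
Qed.

End Curves.

(** * Finite area of the boundary of a half ball *)

Section Screen.
Context {R : realType}.
Local Notation MR := (measurableTypeR R).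
Local Notation RR := (MR * MR)%type.
Local Notation leb := (@lebesgue_measure R).

Lemma hausdorff_square_fin (A : set 'rV[R]_2) :
  (forall y, A y -> forall i, `|y ord0 i| <= 1) -> (hausdorff 2 A < +oo)%E.
Proof.
move=> A1; apply: (@le_lt_trans _ _ (hausdorff 2 (diag 1 1 @` (rect (-2) 1 (-2) 1 : set RR)))).
  apply: hausdorffS => y Ay; exists (y ord0 ord0, y ord0 (lift ord0 ord0)).
    have := A1 y Ay ord0; have := A1 y Ay (lift ord0 ord0).
    rewrite !ler_norml => /andP[h1 h2] /andP[h3 h4].
    by rewrite rectP /=; apply/andP; split; apply/andP; split; lra.
  by rewrite /diag !mul1r vec2K.
have mr : measurable (rect (-2) 1 (-2) 1 : set RR) by exact: measurable_rect.
have := planar_measure1E mr; rewrite /planar_measure /= => ->.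
by rewrite lebesgue_rect -?EFinM ?ltry //; lra.
Qed.

(** A is a Lipschitz graph over a bounded part of the plane of the coordinates other than k. *)
Lemma hausdorff_chart_fin (k : 'I_3) (A : set 'rV[R]_3) (K : R) : 0 < K ->
  (forall p, A p -> forall i, `|p ord0 i| <= 1) ->
  (forall p q, A p -> A q -> (p ord0 k - q ord0 k) ^+ 2 <=
    K * \sum_(i < 2) (p ord0 (lift k i) - q ord0 (lift k i)) ^+ 2) ->
  (hausdorff 2 A < +oo)%E.
Proof.
move=> K0 A1 AK; pose pr (p : 'rV[R]_3) : 'rV[R]_2 := \row_i p ord0 (lift k i).
have fin : (hausdorff 2 (pr @` A) < +oo)%E.
  by apply: hausdorff_square_fin => _ [p Ap <-] i; rewrite mxE A1.
have K1 : 0 < K + 1 by lra.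
apply: (@le_lt_trans _ _ (((K + 1) ^+ 2)%:E * hausdorff 2 (pr @` A))%E); last first.
  have -> : hausdorff 2 (pr @` A) = (fine (hausdorff 2 (pr @` A)))%:E.
    by rewrite fineK // ge0_fin_numE // hausdorff_ge0.
  by rewrite -EFinM ltry.
rewrite -{1}(image_id A); apply: (@hausdorff_map R _ _ _ 1) => // p q Ap Aq.
have d0 := edist_ge0 (pr p) (pr q).
apply: sqrt_le_of_sqr; first by rewrite mulr_ge0 // ltW.
have e3 : edist p q ^+ 2 = (p ord0 k - q ord0 k) ^+ 2 +
    \sum_(i < 2) (p ord0 (lift k i) - q ord0 (lift k i)) ^+ 2.
  rewrite /edist sqr_enorm /dotp (bigD1_ord k) //= !mxE -expr2; congr (_ + _).
  by apply: eq_bigr => i _; rewrite !mxE expr2.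
have e2 : edist (pr p) (pr q) ^+ 2 =
    \sum_(i < 2) (p ord0 (lift k i) - q ord0 (lift k i)) ^+ 2.
  by rewrite /edist sqr_enorm /dotp; apply: eq_bigr => i _; rewrite !mxE expr2.
rewrite exprMn e3 e2; have := AK p q Ap Aq; set S := \sum_(i < 2) _ => h.
have S0 : 0 <= S by apply: sumr_ge0 => i _; exact: sqr_ge0.
apply: (@le_trans _ _ ((K + 1) * S)); first by lra.
by rewrite ler_wpM2r // expr2 ler_peMl ?(ltW K1) //; lra.
Qed.

(** The flat disc together with the whole sphere, which contains the boundary of the half ball. *)
Definition screen (r : R) : set 'rV[R]_3 :=
  [set x | (enorm x <= r /\ L0 x) \/ enorm x = r].

Lemma sqr_enorm_lift (k : 'I_3) (p : 'rV[R]_3) : enorm p ^+ 2 =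
  p ord0 k ^+ 2 + \sum_(i < 2) p ord0 (lift k i) ^+ 2.
Proof.
by rewrite sqr_enorm /dotp (bigD1_ord k).
Qed.

Lemma hausdorff_screen1_fin : (hausdorff 2 (screen 1) < +oo)%E.
Proof.
pose P (k : 'I_3) (b : bool) : set 'rV[R]_3 :=
  [set x | enorm x = 1 /\ 2^-1 <= (-1) ^+ b * x ord0 k].
have fP k b : (hausdorff 2 (P k b) < +oo)%E.
  apply: (@hausdorff_chart_fin k _ 8) => //.
    by move=> p [p1 _] i; rewrite -p1 coord_le_enorm.
  move=> p q [p1 pk] [q1 qk]; rewrite big_ord_recl big_ord1.
  have : p ord0 k ^+ 2 + \sum_(i < 2) p ord0 (lift k i) ^+ 2 =
         q ord0 k ^+ 2 + \sum_(i < 2) q ord0 (lift k i) ^+ 2.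
    by rewrite -!sqr_enorm_lift p1 q1.
  rewrite !big_ord_recl !big_ord0 !addr0.
  have bd (x : 'rV[R]_3) i : enorm x = 1 -> `|x ord0 i| <= 1.
    by move=> <-; exact: coord_le_enorm.
  set i1 := lift k ord0; set i2 := lift k (lift ord0 ord0).
  have := bd p i1 p1; have := bd q i1 q1; have := bd p i2 p1; have := bd q i2 q1.
  move: pk qk; move: (p ord0 k) (q ord0 k) (p ord0 i1) (q ord0 i1) (p ord0 i2) (q ord0 i2).
  move=> a a' u u' v v' ha ha' hv' hv hu' hu e.
  set s := (-1) ^+ b in ha ha'.
  have s2 : s ^+ 2 = 1 by rewrite /s -exprM mulnC exprM sqrrN !expr1n.
  have s1 : 1 <= s * a + s * a' by lra.
  have e2 : (s * a + s * a') * (s * (a - a')) = (u' - u) * (u' + u) + (v' - v) * (v' + v).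
    by transitivity (s ^+ 2 * (a ^+ 2 - a' ^+ 2)); [ring|rewrite s2; lra].
  have h1 : `|s * (a - a')| <= 2 * `|u' - u| + 2 * `|v' - v|.
    apply: (@le_trans _ _ ((s * a + s * a') * `|s * (a - a')|)).
      by rewrite ler_peMl.
    rewrite -{1}(ger0_norm (_ : 0 <= s * a + s * a')); last by lra.
    rewrite -normrM e2; apply: le_trans (ler_normD _ _) _; rewrite !normrM.
    have bb x y : `|x| <= 1 -> `|y| <= 1 -> `|x + y| <= 2 :> R.
      by move=> hx hy; apply: le_trans (ler_normD _ _) _; lra.
    by apply: lerD; rewrite mulrC ler_wpM2r // bb.
  have h2 : (a - a') ^+ 2 = `|s * (a - a')| ^+ 2.
    by rewrite real_normK ?num_real // exprMn s2 mul1r.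
  rewrite h2; apply: (@le_trans _ _ ((2 * `|u' - u| + 2 * `|v' - v|) ^+ 2)).
    by rewrite lerXn2r ?nnegrE // addr_ge0 ?mulr_ge0.
  rewrite -[(u - u') ^+ 2]sqrrN -[(v - v') ^+ 2]sqrrN !opprB.
  rewrite -[(u' - u) ^+ 2]real_normK ?num_real // -[(v' - v) ^+ 2]real_normK ?num_real //.
  by have := sqr_ge0 (`|u' - u| - `|v' - v|); lra.
pose D : set 'rV[R]_3 := [set x | enorm x <= 1 /\ L0 x].
have fD : (hausdorff 2 D < +oo)%E.
  apply: (@hausdorff_chart_fin ord_max _ 1) => //.
    by move=> p [p1 _] i; apply: le_trans p1; exact: coord_le_enorm.
  move=> p q [_ p0] [_ q0]; rewrite p0 q0 subrr expr0n mul1r.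
  by apply: sumr_ge0 => i _; exact: sqr_ge0.
apply: (@le_lt_trans _ _ (hausdorff 2 (D `|` \big[setU/set0]_(k < 3) (P k false `|` P k true)))).
  apply: hausdorffS => x [[x1 x0]|x1]; [by left|right].
  (* Six caps suffice: on the unit sphere some squared coordinate is at least 1/3, so some
     coordinate has absolute value at least 1/2, and there the sphere is a Lipschitz graph. *)
  have [k hk] : exists k : 'I_3, 4^-1 <= x ord0 k ^+ 2.
    apply: contrapT => none; have lt k : x ord0 k ^+ 2 < 4^-1.
      by rewrite ltNge; apply/negP => h; apply: none; exists k.
    have := sqr_enorm_lift ord0 x; rewrite x1 expr1n !big_ord_recl big_ord0 addr0.
    by have := lt ord0; have := lt (lift ord0 ord0); have := lt (lift ord0 (lift ord0 ord0)); lra.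
  rewrite -bigcup_mkord_ord; exists k => //=; rewrite inord_val.
  have {}hk : 2^-1 <= `|x ord0 k|.
    apply: sqrt_le_of_sqr => //; rewrite real_normK ?num_real //.
    by apply: le_trans hk; rewrite le_eqVlt; apply/orP; left; apply/eqP; field.
  have [k0|k0] := leP 0 (x ord0 k); [left|right]; split => //.
    by rewrite expr0 mul1r; rewrite ger0_norm in hk.
  by rewrite expr1 mulN1r; rewrite ltr0_norm in hk.
apply: le_lt_trans (outer_measureU2 _ _ _) _; apply: lte_add_pinfty => //.
apply: (big_ind (fun X : set 'rV[R]_3 => (hausdorff 2 X < +oo)%E)) => [|A B hA hB|k _].
- by rewrite (_ : hausdorff 2 _ = 0%E); [exact: ltry|exact: hausdorff_set0].
- by apply: le_lt_trans (outer_measureU2 _ _ _) _; apply: lte_add_pinfty; [exact: hA|exact: hB].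
- by apply: le_lt_trans (outer_measureU2 _ _ _) _; apply: lte_add_pinfty; exact: fP.
Qed.

Lemma hausdorff_screen (r : R) : 0 < r ->
  (hausdorff 2 (screen r) <= (r ^+ 2)%:E * hausdorff 2 (screen 1))%E.
Proof.
move=> r0; rewrite -[X in (_ <= _ * hausdorff 2 X)%E]image_id.
apply: (@le_trans _ _ (hausdorff 2 ((fun x : 'rV[R]_3 => r *: x) @` screen 1))).
  apply: hausdorffS => x hx; exists (r^-1 *: x); last by rewrite scalerA mulfV ?scale1r // lt0r_neq0.
  rewrite /screen /L0 /= enormZ gtr0_norm ?invr_gt0 //.
  case: hx => [[h1 h2]|->]; [left|right].
    by rewrite ler_pdivrMl // mulr1 mxE h2 mulr0.
  by rewrite mulVf // lt0r_neq0.
apply: (@hausdorff_map R _ _ _ 1) => // x y _ _.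
by rewrite edistZZ gtr0_norm.
Qed.

End Screen.

(** * A point of low density in the half ball *)

Section Density.
Context {R : realType}.
Local Notation V := 'rV[R]_3.
Implicit Types (A E : set V) (p x y : V).

Lemma slab_pigeonhole A (u : V -> R) (a dl : R) (N : nat) (M : R) :
  (forall x y, `|u x - u y| <= edist x y) -> 0 <= dl -> (0 < N)%N ->
  (hausdorff 2 A <= M%:E)%E ->
  exists2 i, (i < N)%N & (hausdorff 2 (A `&` [set x | a + i%:R * dl < u x <= a + i.+1%:R * dl]%R)
    <= (M / N%:R)%:E)%E.
Proof.
move=> lu dl0 N0 AM; apply: contrapT => none.
have N0' : 0 < N%:R :> R by rewrite ltr0n.
pose S i := A `&` [set x | a + i%:R * dl < u x <= a + i.+1%:R * dl].
have big i : (i < N)%N -> ((M / N%:R)%:E < hausdorff 2 (S i))%E.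
  by move=> iN; rewrite ltNge; apply/negP => h; apply: none; exists i.
have sums m : (\sum_(i < m) hausdorff 2 (S i) <=
    hausdorff 2 (A `&` [set x | (u x <= a + m%:R * dl)%R]))%E.
  elim: m => [|m IH]; first by rewrite big_ord0 hausdorff_ge0.
  rewrite big_ord_recr /=.
  have cm := @caratheodory_lip_sublevel R 3 1 u (a + m%:R * dl) lu.
  have mm : a + m%:R * dl <= a + m.+1%:R * dl by rewrite lerD2l ler_wpM2r // ler_nat.
  set T := A `&` _.
  have -> : hausdorff 2 T = (hausdorff 2 (T `&` [set x | (u x <= a + m%:R * dl)%R]) +
      hausdorff 2 (T `&` ~` [set x | (u x <= a + m%:R * dl)%R]))%E by exact: cm T.
  apply: leeD.
    apply: le_trans IH _; apply: hausdorffS => x [Ax /= h]; do 2 split => //.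
    exact: le_trans mm.
  apply: hausdorffS => x [Ax /= /andP[h1 h2]]; split => //.
  by apply/negP; rewrite -ltNge.
have : (M%:E < \sum_(i < N) hausdorff 2 (S i))%E.
  have -> : M%:E = (\sum_(i < N) (M / N%:R)%:E)%E.
    rewrite sumEFin sumr_const card_ord -[_ *+ N]mulr_natr divfK //.
    by rewrite lt0r_neq0.
  move: N0 big; case: (N) => // k _ big.
  rewrite !big_ord_recl; apply: lte_leD; rewrite ?sumEFin //; first exact: big.
  by rewrite -sumEFin; apply: lee_sum => i _; apply: ltW; exact: big (ltn_ord (lift ord0 i)).
rewrite ltNge; move/negP; apply; apply: le_trans (sums N) _.
by apply: le_trans AM; apply: hausdorffS => x [].
Qed.

(** One pigeonhole per coordinate selects a cube of side r/(4N) with area at most M/N^3, and p is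
    its centre. The cubes lie in [0, r/4] x [0, r/4] x [r/4, r/2], which keeps p away from L0 and
    from the sphere. The power N^3 beats the factor N^2 by which the projection enlarges area near
    p. *)
Lemma low_density E (r : R) (N : nat) (M : R) : 0 < r -> (0 < N)%N ->
  (hausdorff 2 E <= M%:E)%E ->
  exists p, [/\ enorm p ^+ 2 <= 3 / 8 * r ^+ 2, r / 4 <= p ord0 ord_max &
    (hausdorff 2 (E `&` eball p (r / (8 * N%:R))) <= (M / N%:R ^+ 3)%:E)%E].
Proof.
move=> r0 N0 EM; have N0' : 0 < N%:R :> R by rewrite ltr0n.
set dl := r / (4 * N%:R); have dl0 : 0 < dl by rewrite divr_gt0 ?mulr_gt0.
have lc i x y : `|x ord0 i - y ord0 i| <= edist x y.
  by have := coord_le_enorm (x - y) i; rewrite !mxE.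
pose i0 : 'I_3 := ord0; pose i1 : 'I_3 := lift ord0 ord0; pose i2 : 'I_3 := ord_max.
have [j0 j0N h0] := @slab_pigeonhole E (fun x => x ord0 i0) 0 dl N M (lc i0) (ltW dl0) N0 EM.
have [j1 j1N h1] := slab_pigeonhole 0 (lc i1) (ltW dl0) N0 h0.
have [j2 j2N h2] := slab_pigeonhole (r / 4) (lc i2) (ltW dl0) N0 h1.
pose c (a : R) (j : nat) := a + j%:R * dl + dl / 2.
have Nd : N%:R * dl = r / 4 by rewrite /dl; field; rewrite lt0r_neq0.
have cj a j : (j < N)%N -> a <= c a j <= a + r / 4.
  move=> jN; rewrite /c -Nd.
  have h3 : 0 <= j%:R * dl by rewrite mulr_ge0 // ltW.
  have h4 : j.+1%:R * dl <= N%:R * dl by rewrite ler_wpM2r ?(ltW dl0) // ler_nat.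
  by rewrite -natr1 mulrDl mul1r in h4; apply/andP; split; lra.
pose p : V := \row_i (if i == i0 then c 0 j0 else if i == i1 then c 0 j1 else c (r / 4) j2).
have p0 : p ord0 i0 = c 0 j0 by rewrite mxE.
have p1 : p ord0 i1 = c 0 j1 by rewrite mxE.
have p2 : p ord0 i2 = c (r / 4) j2 by rewrite mxE.
exists p; split.
- rewrite (sqr_enorm_lift ord0) p0 !big_ord_recl big_ord0 addr0.
  rewrite -[lift ord0 ord0]/i1 p1.
  have -> : lift ord0 (lift ord0 ord0) = i2 by apply: val_inj.
  rewrite p2; have /andP[a1 a2] := cj 0 _ j0N; have /andP[b1 b2] := cj 0 _ j1N.
  have /andP[c1 c2] := cj (r / 4) _ j2N; rewrite add0r in a2 b2.
  have sq (x y : R) : 0 <= x -> x <= y -> x ^+ 2 <= y ^+ 2.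
    by move=> x0 xy; rewrite lerXn2r ?nnegrE //; lra.
  have := sq _ _ a1 a2; have := sq _ _ b1 b2.
  by have := sq _ _ (le_trans (ltW (divr_gt0 r0 _)) c1) c2; lra.
- by have /andP[] := cj (r / 4) _ j2N; rewrite -/i2 p2.
- have -> : M / N%:R ^+ 3 = M / N%:R / N%:R / N%:R by field; rewrite lt0r_neq0.
  apply: le_trans h2; apply: hausdorffS => x [Ex]; rewrite /eball /=.
  have -> : r / (8 * N%:R) = dl / 2 by rewrite /dl; field; rewrite lt0r_neq0.
  move=> xp; have near i : `|p ord0 i - x ord0 i| < dl / 2 by apply: le_lt_trans xp; exact: lc.
  have := near i0; have := near i1; have := near i2; rewrite p0 p1 p2 /c !ltr_norml.
  move=> /andP[a1 a2] /andP[b1 b2] /andP[c1 c2].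
  have e j : j.+1%:R * dl = j%:R * dl + dl by rewrite -natr1 mulrDl mul1r.
  by split; [split; [split => //|]|]; rewrite /= e; apply/andP; split; lra.
Qed.

End Density.

(** * The Minkowski functional of a ball seen from an interior point *)

Section Gauge.
Context {R : realType} {n : nat}.
Local Notation V := 'rV[R]_n.
Variables (p : V) (r : R).
Hypotheses (r0 : 0 < r) (pr : enorm p < r).
Implicit Types (u v : V) (c : R).

Let A := r ^+ 2 - enorm p ^+ 2.

Let A0 : 0 < A.
Proof. by rewrite subr_gt0 ltrXn2r ?nnegrE ?enorm_ge0 // ltW. Qed.

(** The least c >= 0 with |u + c p| <= c r, that is, with p + u/c in the closed ball of radius r; it
    is the nonnegative root of a quadratic equation in c. *)
Definition ball_gauge u : R :=
  (dotp p u + Num.sqrt (dotp p u ^+ 2 + A * enorm u ^+ 2)) / A.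

Let D u := dotp p u ^+ 2 + A * enorm u ^+ 2.

Let D0 u : 0 <= D u.
Proof. by rewrite addr_ge0 ?sqr_ge0 // mulr_ge0 ?sqr_ge0 // ltW. Qed.

Let sqr_shift u c : enorm (u + c *: p) ^+ 2 =
  enorm u ^+ 2 + 2 * c * dotp p u + c ^+ 2 * enorm p ^+ 2.
Proof. by rewrite !sqr_enorm !dotpE (dotpC u p); ring. Qed.

Lemma ball_gaugeP u c : 0 <= c ->
  (enorm (u + c *: p) <= c * r) = (ball_gauge u <= c).
Proof.
move=> c0; have cr : 0 <= c * r by rewrite mulr_ge0 // ltW.
have -> : (enorm (u + c *: p) <= c * r) = (D u <= (c * A - dotp p u) ^+ 2).
  rewrite -(@ler_sqr _ (enorm _)) ?nnegrE ?enorm_ge0 // sqr_shift exprMn.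
  have e : (c * A - dotp p u) ^+ 2 - D u =
     A * (c ^+ 2 * r ^+ 2 - (enorm u ^+ 2 + 2 * c * dotp p u + c ^+ 2 * enorm p ^+ 2)).
    by rewrite /D /A; ring.
  by rewrite -[RHS]subr_ge0 e pmulr_rge0 // subr_ge0.
rewrite /ball_gauge -/(D u) ler_pdivrMr // (addrC (dotp p u)) -[RHS]lerBrDr.
have [h|h] := leP 0 (c * A - dotp p u).
  by rewrite -[in RHS](ger0_norm h) -sqrtr_sqr ler_psqrt ?nnegrE ?sqr_ge0.
have -> : (Num.sqrt (D u) <= c * A - dotp p u) = false.
  by apply/negbTE; rewrite -ltNge; apply: lt_le_trans h (sqrtr_ge0 _).
apply/negbTE; rewrite -ltNge.
have cA : 0 <= c * A by rewrite mulr_ge0 // ltW.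
have pu : 0 < dotp p u by lra.
have u0 : 0 < enorm u by rewrite enorm_gt0; apply: contraTneq pu => ->; rewrite dotp0r ltxx.
have h1 : (c * A - dotp p u) ^+ 2 <= dotp p u ^+ 2.
  by rewrite -sqrrN lerXn2r ?nnegrE; lra.
by apply: le_lt_trans h1 _; rewrite ltrDl mulr_gt0 // exprn_gt0.
Qed.

Lemma ball_gauge_ge0 u : 0 <= ball_gauge u.
Proof.
rewrite /ball_gauge divr_ge0 ?(ltW A0) //.
have h : `|dotp p u| <= Num.sqrt (D u).
  rewrite -sqrtr_sqr ler_psqrt ?nnegrE ?sqr_ge0 // lerDl mulr_ge0 ?sqr_ge0 //.
  exact: ltW.
have := ler_norm (- dotp p u); rewrite normrN -/(D u); lra.
Qed.

Lemma ball_gaugeE u : enorm (u + ball_gauge u *: p) = ball_gauge u * r.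
Proof.
have h : ball_gauge u * A - dotp p u = Num.sqrt (D u).
  by rewrite /ball_gauge divfK ?lt0r_neq0 // addrC addrA addNr add0r.
have gr : 0 <= ball_gauge u * r by rewrite mulr_ge0 ?ball_gauge_ge0 // ltW.
have h2 : (ball_gauge u * A - dotp p u) ^+ 2 = D u by rewrite h sqr_sqrtr.
move: (ball_gauge u) h2 gr => g h2 gr {h}.
apply/eqP; rewrite -(@eqrXn2 _ 2) ?enorm_ge0 // sqr_shift exprMn; apply/eqP.
apply: (mulfI (lt0r_neq0 A0)); move: h2; rewrite /D /A => h2.
lra.
Qed.

Lemma ball_gaugeD u v : ball_gauge (u + v) <= ball_gauge u + ball_gauge v.
Proof.
rewrite -ball_gaugeP ?addr_ge0 ?ball_gauge_ge0 // scalerDl addrACA.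
by apply: le_trans (enormD _ _) _; rewrite !ball_gaugeE mulrDl.
Qed.

Lemma ball_gauge_le u : ball_gauge u <= (r - enorm p)^-1 * enorm u.
Proof.
have rp : 0 < r - enorm p by rewrite subr_gt0.
set c := _ * _; have c0 : 0 <= c by rewrite mulr_ge0 ?invr_ge0 ?enorm_ge0 // ltW.
rewrite -ball_gaugeP //; apply: le_trans (enormD _ _) _; rewrite enormZ ger0_norm //.
have : enorm u = c * (r - enorm p) by rewrite /c mulrAC mulVf ?mul1r // lt0r_neq0.
lra.
Qed.

Lemma ball_gauge_lip u v :
  `|ball_gauge u - ball_gauge v| <= (r - enorm p)^-1 * edist u v.
Proof.
have h x y : ball_gauge x - ball_gauge y <= (r - enorm p)^-1 * edist x y.
  rewrite lerBlDr; apply: le_trans (_ : _ <= ball_gauge (x - y) + ball_gauge y) _.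
    by rewrite -{1}(subrK y x) ball_gaugeD.
  by rewrite lerD2r ball_gauge_le.
by rewrite ler_norml lerNl opprB h andbT {1}edistC h.
Qed.

Lemma enorm_le_ball_gauge u : enorm u <= 2 * r * ball_gauge u.
Proof.
have := enormD (u + ball_gauge u *: p) (- (ball_gauge u *: p)).
rewrite addrK enormN ball_gaugeE enormZ ger0_norm ?ball_gauge_ge0 //.
have := ler_wpM2l (ball_gauge_ge0 u) (ltW pr); lra.
Qed.

End Gauge.

(** * Projection of the half ball to its boundary *)

Section UniformBound.
Context {R : realType}.
Local Notation V := 'rV[R]_3.

Definition screen_area : R := fine (hausdorff 2 (@screen R 1)).

Lemma hausdorff_screen_le (r : R) : 0 < r ->
  (hausdorff 2 (screen r) <= (screen_area * r ^+ 2)%:E)%E.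
Proof.
move=> r0; apply: le_trans (hausdorff_screen r0) _.
rewrite -(fineK (_ : hausdorff 2 (screen 1) \is a fin_num)) -?EFinM ?lee_fin 1?mulrC //.
by rewrite ge0_fin_numE ?hausdorff_ge0 // hausdorff_screen1_fin.
Qed.

Lemma screen_area_ge0 : 0 <= screen_area.
Proof. by rewrite fine_ge0 // hausdorff_ge0. Qed.

Section Projection.
Variables (p : V) (r s : R).
Hypotheses (r0 : 0 < r) (pr : enorm p < r) (p3 : 0 < p ord0 ord_max).
Hypotheses (s0 : 0 < s) (s1 : s <= 1).

Let G := ball_gauge p r.

(** The Minkowski functional of the half ball about p: the first term expresses that p + u/c has
    nonnegative height. *)
Definition half_gauge (u : V) : R := Num.max (- u ord0 ord_max / p ord0 ord_max) (G u).

(** The upper cut makes [projection] the identity outside the half ball; the lower cut makes it a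
    dilation by 1/s near p, which keeps it Lipschitz. In between, it is the central projection from
    p onto the boundary of the half ball. *)
Definition clamp (x : V) : R := Num.min 1 (Num.max s (half_gauge (x - p))).

Definition projection (x : V) : V := p + (clamp x)^-1 *: (x - p).

Lemma clamp_bound x : s <= clamp x <= 1.
Proof. by rewrite /clamp le_min s1 le_max lexx ge_min lexx. Qed.

Let L := (p ord0 ord_max)^-1 + (r - enorm p)^-1.

Let L0' : 0 <= L.
Proof. by rewrite addr_ge0 // invr_ge0 ?(ltW p3) // subr_ge0 ltW. Qed.

Lemma clamp_lip x y : `|clamp x - clamp y| <= L * edist x y.
Proof.
have h1 : `|G (x - p) - G (y - p)| <= L * edist x y.
  apply: le_trans (ball_gauge_lip r0 pr _ _) _; rewrite edistBB.
  by rewrite ler_wpM2r ?edist_ge0 // lerDr invr_ge0 ltW.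
have h2 : `|- (x - p) ord0 ord_max / p ord0 ord_max - - (y - p) ord0 ord_max / p ord0 ord_max|
    <= L * edist x y.
  rewrite -mulrBl normrM (gtr0_norm (_ : 0 < (p ord0 ord_max)^-1)) ?invr_gt0 // mulrC.
  apply: (@le_trans _ _ ((p ord0 ord_max)^-1 * edist x y)).
    rewrite ler_wpM2l ?invr_ge0 ?(ltW p3) //; apply: le_trans (coord_le_enorm (x - y) ord_max).
    by rewrite !mxE -normrN le_eqVlt; apply/orP; left; apply/eqP; congr `|_|; ring.
  by rewrite ler_wpM2r ?edist_ge0 // lerDl invr_ge0 subr_ge0 ltW.
rewrite /clamp /half_gauge; move: (L * edist x y) h1 h2 => w.
move: (G _) (G _) (_ / _) (_ / _) => a a' c c'; rewrite !ler_norml => /andP[h1 h2] /andP[h3 h4].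
have w0 : 0 <= w by lra.
have mx (a1 b1 a2 b2 : R) : - w <= a1 - a2 <= w -> - w <= b1 - b2 <= w ->
    - w <= Num.max a1 b1 - Num.max a2 b2 <= w.
  move=> /andP[k1 k2] /andP[k3 k4]; rewrite /Num.max.
  by case: (ltP a1 b1) => ?; case: (ltP a2 b2) => ?; apply/andP; split; lra.
have mn (a1 b1 a2 b2 : R) : - w <= a1 - a2 <= w -> - w <= b1 - b2 <= w ->
    - w <= Num.min a1 b1 - Num.min a2 b2 <= w.
  move=> /andP[k1 k2] /andP[k3 k4]; rewrite /Num.min.
  by case: (ltP a1 b1) => ?; case: (ltP a2 b2) => ?; apply/andP; split; lra.
have c0 (z : R) : - w <= z - z <= w by rewrite subrr oppr_le0 w0.
apply: (mn _ _ _ _) => //; apply: (mx _ _ _ _) => //.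
by apply: (mx _ _ _ _); apply/andP; split; lra.
Qed.

Lemma projection_id x : 1 <= half_gauge (x - p) -> projection x = x.
Proof.
move=> h; rewrite /projection /clamp min_l; last by rewrite le_max h orbT.
by rewrite invr1 scale1r addrC subrK.
Qed.

Lemma half_gauge_ball x : half_gauge (x - p) < 1 -> enorm x < r.
Proof.
rewrite gt_max => /andP[_ h].
have G0 : 0 <= G (x - p) by exact: ball_gauge_ge0.
have -> : x = (x - p + G (x - p) *: p) + (1 - G (x - p)) *: p.
  by apply/rowP => i; rewrite !mxE; ring.
apply: le_lt_trans (enormD _ _) _; rewrite (ball_gaugeE r0 pr) enormZ ger0_norm ?subr_ge0 ?(ltW h) //.
have h' : 0 < 1 - ball_gauge p r (x - p) by rewrite subr_gt0.
have := pr; rewrite -(ltr_pM2l h') -/(G (x - p)); lra.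
Qed.

Lemma half_gauge_lt1 x : enorm x < r -> 0 < x ord0 ord_max -> half_gauge (x - p) < 1.
Proof.
move=> xr x3; rewrite gt_max; apply/andP; split.
  by rewrite ltr_pdivrMr // mul1r !mxE; lra.
have : G (x - p) <= 1 by rewrite -(ball_gaugeP r0 pr) // scale1r subrK mul1r ltW.
rewrite le_eqVlt => /predU1P[e|//].
by have := ball_gaugeE r0 pr (x - p); rewrite -/G e scale1r subrK mul1r => xe; lra.
Qed.

Lemma projection_in x : half_gauge (x - p) < 1 ->
  [/\ enorm (projection x) <= r, Omega0 (projection x) &
   s <= half_gauge (x - p) -> screen r (projection x)].
Proof.
move=> h; pose c := clamp x; have /andP[cs c1] := clamp_bound x.
have c0 : 0 < c by exact: lt_le_trans cs.
have hc : half_gauge (x - p) <= c by rewrite /c /clamp le_min (ltW h) le_max lexx orbT.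
have /andP[h3 hG] : (- (x - p) ord0 ord_max / p ord0 ord_max <= c) && (G (x - p) <= c).
  by rewrite -ge_max.
have sc : projection x = c^-1 *: (x - p + c *: p).
  by rewrite /projection -/c [RHS]scalerDr scalerA mulVf ?lt0r_neq0 // scale1r [RHS]addrC.
have ns : enorm (projection x) = c^-1 * enorm (x - p + c *: p).
  by rewrite sc enormZ gtr0_norm // invr_gt0.
have nr : enorm (projection x) <= r.
  by rewrite ns ler_pdivrMl // (ball_gaugeP r0 pr) // ltW.
have x3 : projection x ord0 ord_max = c^-1 * ((x - p) ord0 ord_max + c * p ord0 ord_max).
  by rewrite sc !mxE.
split => //.
  rewrite /Omega0 /= x3 mulr_ge0 ?invr_ge0 ?(ltW c0) //.
  by rewrite ler_pdivrMr // in h3; lra.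
move=> hs; have cE : c = half_gauge (x - p).
  by rewrite /c /clamp (max_r hs) min_r // ltW.
rewrite /screen /=; move: cE; rewrite /half_gauge; case: (leP _ (G (x - p))) => _ cE.
  by right; rewrite ns cE (ball_gaugeE r0 pr) mulKf // -cE lt0r_neq0.
left; split => //; rewrite /L0 /= x3.
have -> : c * p ord0 ord_max = - (x - p) ord0 ord_max by rewrite cE divfK // lt0r_neq0.
by rewrite subrr mulr0.
Qed.

Lemma projection_lip (E : set V) : lipschitz_within E projection.
Proof.
exists (s^-1 + 2 * r * L / s ^+ 2) => x y _ _.
have half x' y' : half_gauge (x' - p) < 1 ->
    edist (projection x') (projection y') <= (s^-1 + 2 * r * L / s ^+ 2) * edist x' y'.
  move=> hx; have /andP[cx _] := clamp_bound x'; have /andP[cy _] := clamp_bound y'.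
  have cx0 : 0 < clamp x' by exact: lt_le_trans cx.
  have cy0 : 0 < clamp y' by exact: lt_le_trans cy.
  have -> : edist (projection x') (projection y') = enorm ((clamp y')^-1 *: (x' - y') +
      ((clamp x')^-1 - (clamp y')^-1) *: (x' - p)).
    by rewrite /edist /projection; congr enorm; apply/rowP => i; rewrite !mxE; ring.
  apply: le_trans (enormD _ _) _; rewrite !enormZ mulrDl; apply: lerD.
    rewrite gtr0_norm ?invr_gt0 // ler_wpM2r ?enorm_ge0 //.
    by rewrite lef_pV2 ?posrE.
  have -> : (clamp x')^-1 - (clamp y')^-1 = (clamp y' - clamp x') / (clamp x' * clamp y').
    by field; rewrite !lt0r_neq0.
  have xp : enorm (x' - p) <= 2 * r.
    by apply: le_trans (enormD _ _) _; rewrite enormN; have := half_gauge_ball hx; have := pr; lra.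
  rewrite normrM (gtr0_norm (_ : 0 < (clamp x' * clamp y')^-1)) ?invr_gt0 ?mulr_gt0 //.
  apply: (@le_trans _ _ (L * edist x' y' / s ^+ 2 * (2 * r))).
    have cc0 : 0 <= (clamp x' * clamp y')^-1 by rewrite invr_ge0 ltW // mulr_gt0.
    apply: (ler_pM _ (enorm_ge0 _) _ xp); first exact: mulr_ge0.
    apply: (ler_pM (normr_ge0 _) cc0); first by rewrite distrC; exact: clamp_lip.
    rewrite lef_pV2 ?posrE ?mulr_gt0 ?exprn_gt0 // expr2.
    by apply: ler_pM => //; exact: ltW.
  by rewrite le_eqVlt; apply/orP; left; apply/eqP; ring.
have [hx|hx] := ltP (half_gauge (x - p)) 1; first exact: half.
have [hy|hy] := ltP (half_gauge (y - p)) 1; first by rewrite edistC [edist x y]edistC; exact: half.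
rewrite !projection_id // ler_peMl ?edist_ge0 //.
apply: (@le_trans _ _ s^-1); first by rewrite invf_ge1.
by rewrite lerDl divr_ge0 ?sqr_ge0 // !mulr_ge0 // ltW.
Qed.

Lemma projection_small (E : set V) :
  (hausdorff 2 (projection @` (E `&` [set x | (half_gauge (x - p) <= s)%R])) <=
    (s^-1 ^+ 2)%:E * hausdorff 2 (E `&` [set x | (edist p x <= 2 * r * s)%R]))%E.
Proof.
set A := E `&` _; have si : 0 < s^-1 by rewrite invr_gt0.
apply: (@le_trans _ _ ((s^-1 ^+ 2)%:E * hausdorff 2 (id @` A))%E).
  apply: (@hausdorff_map R _ _ _ 1) => // x y [_ /= hx] [_ /= hy].
  have cs z : half_gauge (z - p) <= s -> clamp z = s.
    by move=> hz; rewrite /clamp (max_l hz) min_r.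
  by rewrite /projection !cs // !(addrC p) edistDD edistZZ edistBB gtr0_norm.
rewrite image_id lee_pmul2l ?lte_fin ?exprn_gt0 //; apply: hausdorffS => x [Ex /= hx].
split => //=; rewrite edistC; apply: le_trans (enorm_le_ball_gauge r0 pr (x - p)) _.
have : G (x - p) <= s by apply: le_trans hx; rewrite le_max lexx orbT.
by move=> h; rewrite ler_wpM2l // mulr_ge0 // ltW.
Qed.

End Projection.
End UniformBound.

(** * A bound for the area of E that does not depend on E *)

Section MassBound.
Context {R : realType}.
Local Notation V := 'rV[R]_3.

(** Projecting from a point of low density replaces the part of E in the open half ball by a part of
    the screen, plus the image of the core near p, whose area is O(1/N). Letting N grow bounds the
    part off L0; the part in L0 lies in the screen itself, hence the factor 2. *)
Lemma mass_bound (E : set V) (h : R -> \bar R) (r b H : R) :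
  E `<=` Omega0 -> (hausdorff 2 E < +oo)%E ->
  locally_sliding_almost_minimal h E 0 -> 0 < r < b -> (h b <= H%:E)%E ->
  mass E r <= 2 * screen_area * r ^+ 2 + H * b ^+ 2.
Proof.
move=> EO fE am /andP[r0 rb] hH; have b0 : 0 < b by lra.
have finE X : X `<=` E -> hausdorff 2 X \is a fin_num.
  move=> XE; rewrite ge0_fin_numE ?hausdorff_ge0 //.
  by apply: le_lt_trans fE; exact: hausdorffS.
set M := fine (hausdorff 2 E).
have ME : hausdorff 2 E = M%:E by rewrite fineK // finE.
have M0 : 0 <= M by rewrite fine_ge0 // hausdorff_ge0.
pose W : set V := [set x | enorm x < r] `&` [set x | 0 < x ord0 ord_max].
have cW : (@hausdorff R 3 2).-caratheodory W.
  apply: caratheodory_measurable_setI.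
    have -> : [set x : V | enorm x < r] = ~` [set x | - enorm x <= - r].
      apply/seteqP; split => x /=; first by move=> xr; apply/negP; rewrite lerN2 -ltNge.
      by move=> /negP; rewrite lerN2 -ltNge.
    apply: caratheodory_measurable_setC; apply: caratheodory_lip_sublevel => x y.
    by rewrite -opprD normrN enorm_lip.
  rewrite -/([set x : V | 0 < x ord0 ord_max]).
  have -> : [set x : V | 0 < x ord0 ord_max] = ~` [set x | x ord0 ord_max <= 0].
    apply/seteqP; split => x /=; first by move=> x0; apply/negP; rewrite -ltNge.
    by move=> /negP; rewrite -ltNge.
  apply: caratheodory_measurable_setC; apply: caratheodory_lip_sublevel => x y.
  by have := coord_le_enorm (x - y) ord_max; rewrite !mxE.
have WE : E `&` eball 0 b `&` W = E `&` W.
  apply/seteqP; split => x; first by move=> [[Ex _] Wx].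
  move=> [Ex [Wx1 Wx2]]; do 2 split => //; rewrite eball0E /=; exact: lt_trans rb.
set m := fine (hausdorff 2 (E `&` W)).
have mE : hausdorff 2 (E `&` W) = m%:E by rewrite fineK // finE // => x [].
have main (N : nat) : (0 < N)%N ->
    m <= screen_area * r ^+ 2 + H * b ^+ 2 + 1024 * M / N%:R.
  move=> N0; have N0' : 0 < N%:R :> R by rewrite ltr0n.
  have N1 : 1 <= N%:R :> R by rewrite ler1n.
  have EM : (hausdorff 2 E <= M%:E)%E by rewrite ME.
  have [p [pr p3 pM]] := low_density r0 N0 EM; have {}p3 : 0 < p ord0 ord_max by lra.
  have {}pr : enorm p < r.
    rewrite -(@ltr_sqr _ (enorm p)) ?nnegrE ?enorm_ge0 ?(ltW r0) //.
    by have := exprn_gt0 2 r0; lra.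
  (* The core lies within 2 r s = r/(16 N) of p, inside the ball of low density, and is enlarged in
     area by s^-2 = 1024 N^2. *)
  pose s : R := (32 * N%:R)^-1.
  have s0 : 0 < s by rewrite invr_gt0 mulr_gt0.
  have s1 : s <= 1 by rewrite invf_le1 ?mulr_gt0 //; lra.
  pose g x := half_gauge p r (x - p).
  pose phi := projection p r s.
  have comp := almost_minimal_le b0 EO am (projection_lip r0 pr p3 s0 s1 E) _.
  have {}comp : (hausdorff 2 (E `&` eball 0 b) <=
      hausdorff 2 (phi @` (E `&` eball 0 b)) + h b * (b ^+ 2)%:E)%E.
    apply: comp => x Ex; have [gx|gx] := ltP (g x) 1; last first.
      by rewrite projection_id //; split => //; exact: EO.
    have [nr O _] := projection_in r0 pr p3 s0 s1 gx; split => //.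
    - by move=> bx; exfalso; have := half_gauge_ball r0 pr gx; lra.
    - by move=> _; exact: le_lt_trans rb.
    - move=> x0; rewrite projection_id // /half_gauge le_max; apply/orP; left.
      by rewrite ler_pdivlMr // mul1r !mxE x0; lra.
  have split1 : hausdorff 2 (E `&` eball 0 b) =
      (m%:E + hausdorff 2 ((E `&` eball 0 b) `&` ~` W))%E.
    by rewrite -mE -WE; exact: cW.
  set Q := hausdorff 2 ((E `&` eball 0 b) `&` ~` W) in split1.
  have fQ : Q \is a fin_num by apply: finE => x [[]].
  (* Points that are left fixed lie outside W; their measure is finite and cancels from both sides
     of the comparison. *)
  have im : phi @` (E `&` eball 0 b) `<=` ((phi @` (E `&` [set x | (g x <= s)%R])) `|` screen r) `|`
      ((E `&` eball 0 b) `&` ~` W).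
    move=> _ [x [Ex xb] <-]; have [gx|gx] := leP 1 (g x).
      right; rewrite /phi projection_id //; split => // -[W1 W2].
      by have := half_gauge_lt1 r0 pr p3 W1 W2; rewrite ltNge gx.
    left; have [gs|/ltW gs] := leP (g x) s; first by left; exists x.
    by right; have [_ _] := projection_in r0 pr p3 s0 s1 gx; apply.
  have small : (hausdorff 2 (phi @` (E `&` [set x | (g x <= s)%R])) <= (1024 * M / N%:R)%:E)%E.
    apply: le_trans (projection_small r0 pr s0 s1 E) _.
    apply: (@le_trans _ _ ((s^-1 ^+ 2)%:E * (M / N%:R ^+ 3)%:E)%E).
      apply: lee_wpmul2l; first by rewrite lee_fin sqr_ge0.
      apply: le_trans pM.
      apply: hausdorffS => x [Ex /= px]; split => //; rewrite /eball /=.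
      apply: le_lt_trans px _; rewrite /s.
      have -> : 2 * r / (32 * N%:R) = r / (8 * N%:R) / 2 by field; rewrite lt0r_neq0.
      have : 0 < r / (8 * N%:R) by rewrite divr_gt0 ?mulr_gt0.
      lra.
    rewrite -EFinM lee_fin /s invrK le_eqVlt; apply/orP; left; apply/eqP.
    by field; rewrite lt0r_neq0.
  have : (m%:E + Q <= (1024 * M / N%:R)%:E + (screen_area * r ^+ 2)%:E + Q + (H * b ^+ 2)%:E)%E.
    rewrite -split1; apply: le_trans comp _; apply: leeD; last first.
      by rewrite [leRHS]EFinM lee_wpmul2r // lee_fin sqr_ge0.
    apply: le_trans (hausdorffS _ im) _; apply: le_trans (outer_measureU2 _ _ _) _.
    apply: leeD => //; apply: le_trans (outer_measureU2 _ _ _) _; apply: leeD => //.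
    exact: hausdorff_screen_le.
  rewrite -(fineK fQ) -!EFinD lee_fin; lra.
have m_le : m <= screen_area * r ^+ 2 + H * b ^+ 2.
  apply/ler_addgt0Pr => e e0; pose N := (Num.truncn (1024 * M / e)).+1.
  have hN : 1024 * M / e <= N%:R by exact/ltW/truncnS_gt.
  apply: le_trans (main N _) _ => //; rewrite lerD2l ler_pdivrMr ?ltr0n // [leRHS]mulrC.
  by rewrite -ler_pdivrMr.
rewrite -lee_fin -(massE _ fE).
apply: (@le_trans _ _ (hausdorff 2 ((E `&` W) `|` screen r))).
  apply: hausdorffS => x [Ex]; rewrite eball0E /= => xr.
  have [x0|x0] := ltP 0 (x ord0 ord_max); first by left.
  right; left; split; first exact: ltW.
  by apply/eqP; rewrite eq_le x0; exact: EO.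
apply: le_trans (outer_measureU2 _ _ _) _.
apply: le_trans (leeD (_ : hausdorff 2 (E `&` W) <= (screen_area * r ^+ 2 + H * b ^+ 2)%:E)%E
  (hausdorff_screen_le r0)) _; first by rewrite mE lee_fin.
by rewrite -EFinD lee_fin; lra.
Qed.

End MassBound.

(** * Finite-difference inequalities for the density ratio *)

Section DensityRatio.
Context {R : realType}.
Implicit Types (a b d e s t : R).

(** Over N equal steps the quadratic errors add up to O(1/N). This replaces integrating a
    differential inequality for a function with no known regularity. *)
Lemma mono_of_quadratic (G : R -> R) a b K : 0 < a -> a < b -> 0 <= K ->
  (forall s t, a <= s -> s < t -> t <= b -> G s <= G t + K * (1 - s / t) ^+ 2) ->
  G a <= G b.
Proof.
move=> a0 ab K0 h; apply/ler_addgt0Pr => e e0.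
pose Z := K * ((b - a) / a) ^+ 2.
have Z0 : 0 <= Z by rewrite mulr_ge0 ?sqr_ge0.
have [N N0 hN] : exists2 N : nat, 0 < N%:R :> R & Z / e <= N%:R.
  by exists (Num.truncn (Z / e)).+1; rewrite ?ltr0n // ltW // truncnS_gt.
have [l l0 lE] : exists2 l, 0 < l & l = (b - a) / N%:R.
  by exists ((b - a) / N%:R); rewrite // divr_gt0 // subr_gt0.
have Nl : N%:R * l = b - a by rewrite lE mulrC divfK // lt0r_neq0.
have main (i : nat) : (i <= N)%N -> G a <= G (a + i%:R * l) + i%:R * (K * (l / a) ^+ 2).
  elim: i => [_|i IH iN]; first by rewrite !mul0r !addr0.
  apply: le_trans (IH (ltnW iN)) _.
  set s := a + i%:R * l; set t := a + i.+1%:R * l.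
  have st : t = s + l by rewrite /t /s -natr1; ring.
  have as_ : a <= s by rewrite lerDl mulr_ge0 // ltW.
  have tb : t <= b.
    have : i.+1%:R * l <= N%:R * l by rewrite ler_wpM2r ?(ltW l0) // ler_nat.
    by rewrite Nl /t; lra.
  have t0 : 0 < t by lra.
  have := h s t as_; rewrite {1}st ltrDl => /(_ l0 tb) hs.
  have d1 : 1 - s / t = l / t by rewrite st; field; rewrite lt0r_neq0 // -st.
  have h2 : (l / t) ^+ 2 <= (l / a) ^+ 2.
    apply: lerXn2r; rewrite ?nnegrE ?mulr_ge0 ?invr_ge0 ?(ltW l0) ?(ltW t0) ?(ltW a0) //.
    by rewrite ler_wpM2l ?(ltW l0) // lef_pV2 ?posrE //; lra.
  have := ler_wpM2l K0 h2; rewrite d1 in hs.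
  rewrite -natr1 mulrDl mul1r; lra.
apply: le_trans (main N (leqnn N)) _; rewrite Nl [a + _]addrC subrK lerD2l.
have -> : N%:R * (K * (l / a) ^+ 2) = Z / N%:R.
  by rewrite /Z lE; field; rewrite !lt0r_neq0.
by rewrite ler_pdivrMr // [leRHS]mulrC -ler_pdivrMr.
Qed.

(** The derivative of a power with a second order error, from ln(1 + x) <= x and exp(-x) <= 1 - x +
    x^2 for x >= 0. *)
Lemma powR_increment e s t : 0 < e -> 0 < s -> s <= t ->
  t `^ e * (e * (1 - s / t) - (e * (1 - s / t)) ^+ 2) <= t `^ e - s `^ e.
Proof.
move=> e0 s0 st; have t0 : 0 < t by lra.
have q0 : 0 < s / t by rewrite divr_gt0.
have q1 : s / t <= 1 by rewrite ler_pdivrMr // mul1r.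
have sE : s `^ e = t `^ e * (s / t) `^ e.
  by rewrite -powRM ?(ltW t0) ?(ltW q0) // mulrC divfK // lt0r_neq0.
set x := e * (1 - s / t); have x0 : 0 <= x by rewrite mulr_ge0 ?(ltW e0) // subr_ge0.
have hq : (s / t) `^ e <= 1 - x + x ^+ 2.
  apply: (@le_trans _ _ (expR (- x))).
    rewrite /powR gt_eqF // ler_expR /x -mulrN ler_wpM2l ?(ltW e0) //.
    have := @le_ln1Dx R (s / t - 1); rewrite (_ : 1 + (s / t - 1) = s / t); last by ring.
    by rewrite ltrBDl subrr => /(_ q0); lra.
  have x1 : 0 < 1 + x by lra.
  have h := expR_ge1Dx x; have ex := expR_gt0 x.
  rewrite expRN -[leLHS]mul1r ler_pdivrMr //.
  have x3 : 0 <= x ^+ 3 by rewrite exprn_ge0.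
  have y0 : 0 <= 1 - x + x ^+ 2 by have := sqr_ge0 (x - 2^-1); lra.
  by have := ler_wpM2l y0 h; lra.
by have := ler_wpM2l (powR_ge0 t e) hq; rewrite sE; lra.
Qed.

Lemma powR_decrement b s t : 0 <= b -> 0 < s -> s <= t ->
  s `^ (- b) * (1 - b * (t / s - 1)) <= t `^ (- b).
Proof.
move=> b0 s0 st; have t0 : 0 < t by lra.
have q0 : 0 < t / s by rewrite divr_gt0.
have -> : t `^ (- b) = s `^ (- b) * (t / s) `^ (- b).
  by rewrite -powRM ?(ltW s0) ?(ltW q0) // mulrC divfK // lt0r_neq0.
rewrite ler_wpM2l ?powR_ge0 // /powR gt_eqF //.
apply: le_trans (expR_ge1Dx _); rewrite lerD2l mulNr lerN2 ler_wpM2l //.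
have := @le_ln1Dx R (t / s - 1); rewrite (_ : 1 + (t / s - 1) = t / s); last by ring.
by rewrite ltrBDl subrr => /(_ q0).
Qed.

Variables (T : R -> R) (r1 Ch alpha : R).
Hypotheses (r10 : 0 < r1) (Ch0 : 0 < Ch) (al0 : 0 < alpha).
Hypothesis T_ge0 : forall t, 0 <= T t.
Hypothesis T_bounded : forall a, 0 < a -> exists M, forall t, a <= t <= r1 -> T t <= M.
Hypothesis T_cone : forall s t, 0 < s -> s < t -> t <= r1 ->
  (1 - s / t) * (s / t) ^+ 2 * T s <=
    (T t - (s / t) ^+ 2 * T s) / (2 * (s / t)) + (1 - s / t) * (Ch * t `^ alpha).

Let C1 := 2 * Ch / alpha.

(** In the limit the cone inequality says r T' >= -2 Ch r^alpha, and C1 alpha = 2 Ch makes the added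
    power absorb the right-hand side. *)
Lemma ratio_mono s t : 0 < s -> s < t -> t <= r1 ->
  T s + C1 * s `^ alpha <= T t + C1 * t `^ alpha.
Proof.
move=> s0 st tr; have [M TM] := T_bounded s0.
have M0 : 0 <= M by apply: le_trans (TM s _); rewrite ?T_ge0 // lexx; lra.
have C10 : 0 < C1 by rewrite divr_gt0 ?mulr_gt0.
pose K := 5 * M + 2 * Ch * alpha * t `^ alpha.
apply: (@mono_of_quadratic (fun r => T r + C1 * r `^ alpha) s t K s0 st).
  by rewrite addr_ge0 // !mulr_ge0 ?powR_ge0 // ltW.
move=> x y sx xy yt; have x0 : 0 < x by lra.
have y0 : 0 < y by lra.
have yr : y <= r1 by lra.
have := T_cone x0 xy yr; have := powR_increment al0 x0 (ltW xy).
have q0 : 0 < x / y by rewrite divr_gt0.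
have q1 : x / y < 1 by rewrite ltr_pdivrMr // mul1r.
have xM : T x <= M by apply: TM; lra.
have Tx0 := T_ge0 x.
have yp : y `^ alpha <= t `^ alpha.
  by apply: ge0_ler_powR; rewrite ?nnegrE ?(ltW al0) //; lra.
have yp0 := powR_ge0 y alpha.
move: (x / y) q0 q1 => q q0 q1.
move: (y `^ alpha) (x `^ alpha) yp yp0 => Y X yp yp0 hinc hcone.
pose d := 1 - q; have dE : q = 1 - d by rewrite /d; ring.
have d0 : 0 < d by rewrite /d; lra.
have d1 : d < 1 by rewrite /d; lra.
rewrite {}/K; move: hinc hcone; rewrite dE; move: d d0 d1 {dE q0 q1} => d d0 d1 hinc hcone.
have q0 : 0 < 1 - d by lra.
have h1 : T x * ((1 - d) ^+ 2 + 2 * d * (1 - d) ^+ 3) <= T y + 2 * d * (1 - d) * (Ch * Y).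
  have dd : 1 - (1 - d) = d by ring.
  have q2 : 0 <= 2 * (1 - d) by rewrite mulr_ge0 // ltW.
  rewrite dd in hcone; have := ler_wpM2r q2 hcone.
  have -> : ((T y - (1 - d) ^+ 2 * T x) / (2 * (1 - d)) + d * (Ch * Y)) * (2 * (1 - d)) =
      T y - (1 - d) ^+ 2 * T x + 2 * d * (1 - d) * (Ch * Y) by field; rewrite lt0r_neq0.
  lra.
(* The terms of first order in d cancel, which is the scale invariance of the cone comparison. *)
have h2 : 1 - 5 * d ^+ 2 <= (1 - d) ^+ 2 + 2 * d * (1 - d) ^+ 3.
  have : 0 <= d ^+ 3 * (6 - 2 * d) by rewrite mulr_ge0 ?exprn_ge0 //; lra.
  lra.
have h3 := ler_wpM2l Tx0 h2.
have h4 : T x * d ^+ 2 <= M * d ^+ 2 by rewrite ler_wpM2r ?sqr_ge0.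
have ChY : 0 <= Ch * Y by rewrite mulr_ge0 // ltW.
have h5 : d * (1 - d) * (Ch * Y) <= d * (Ch * Y).
  by rewrite ler_wpM2r // ler_piMr ?(ltW d0) //; lra.
have h6 : 2 * Ch * d * Y - 2 * Ch * alpha * d ^+ 2 * Y <= C1 * (Y - X).
  have := ler_wpM2l (ltW C10) hinc; rewrite /C1 => h7; apply: le_trans h7.
  rewrite le_eqVlt; apply/orP; left; apply/eqP; field.
  by apply: lt0r_neq0; exact: al0.
have h7 : 2 * Ch * alpha * d ^+ 2 * Y <= 2 * Ch * alpha * d ^+ 2 * t `^ alpha.
  by rewrite ler_wpM2l // !mulr_ge0 ?(ltW d0) ?(ltW Ch0) ?(ltW al0).
lra.
Qed.

Lemma powR_small e : 0 < e -> exists2 t, 0 < t & forall s, 0 < s -> s <= t -> s `^ alpha <= e.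
Proof.
move=> e0; exists (e `^ alpha^-1); first exact: powR_gt0.
move=> s s0 st; apply: (@le_trans _ _ ((e `^ alpha^-1) `^ alpha)).
  by apply: ge0_ler_powR; rewrite ?nnegrE ?powR_ge0 ?(ltW al0) ?(ltW s0).
by rewrite -powRrM mulVf ?lt0r_neq0 // powRr1 // ltW.
Qed.

(** L is the infimum over (0, r1] of the nondecreasing function T t + C1 t^alpha, whose second term
    tends to 0. *)
Lemma ratio_cvg : exists L, [/\ T t @[t --> 0^'+] --> L, 0 <= L &
  forall t, 0 < t -> t <= r1 -> L <= T t + C1 * t `^ alpha].
Proof.
have C10 : 0 < C1 by rewrite divr_gt0 ?mulr_gt0.
pose G t := T t + C1 * t `^ alpha.
have G0 t : 0 <= G t by rewrite addr_ge0 // mulr_ge0 ?powR_ge0 // ltW.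
pose S : set R := [set G t | t in [set t | 0 < t <= r1]].
have hlb : has_lbound S by exists 0 => _ [t _ <-]; exact: G0.
have ne : S !=set0 by exists (G r1), r1 => //=; rewrite r10 lexx.
exists (inf S); split.
- apply/cvgrPdist_le => e e0.
  have [_ [t0 /= /andP[t00 t0r] <-] ht0] : exists2 y, S y & y < inf S + e.
    by apply: inf_lt => //; rewrite ltrDl.
  have [t2 t20 ht2] := powR_small (divr_gt0 e0 C10).
  exists (Num.min t0 t2); first by rewrite /= lt_min t00 t20.
  move=> t /=; rewrite sub0r normrN => tb t1.
  have {}tb : t < t0 /\ t < t2 by move: tb; rewrite gtr0_norm // lt_min => /andP[].
  have [tb0 tb2] := tb.
  have := ratio_mono t1 tb0 t0r; rewrite -/(G t) -/(G t0) => hG.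
  have hS : inf S <= G t by apply: ge_inf => //; exists t => //=; rewrite t1 /= (le_trans (ltW tb0)).
  have := ht2 t t1 (ltW tb2); rewrite ler_pdivlMr // mulrC => hp.
  have pp : 0 <= C1 * t `^ alpha by rewrite mulr_ge0 ?powR_ge0 // ltW.
  rewrite /G in hG hS ht0; rewrite ler_norml; rewrite /G in hG; lra.
- by apply: lb_le_inf => // _ [t _ <-]; exact: G0.
- by move=> t t0 tr; apply: ge_inf => //; exists t => //=; rewrite t0.
Qed.

Variables (T0 lambda beta r2 C2 : R).
Hypotheses (T00 : 0 <= T0) (la0 : 0 < lambda) (la1 : lambda < 1) (be0 : 0 < beta).
Hypotheses (be_al : beta < alpha) (be_la : beta < 2 * (lambda / (1 - lambda))).
Hypotheses (r20 : 0 < r2) (r2r1 : r2 <= r1) (C20 : 0 <= C2).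
Hypothesis T_slice : forall s t, 0 < s -> s < t -> t <= r2 ->
  (1 - s / t) * (s / t) ^+ 2 * T s <=
    (1 - lambda) / 2 * (T t - (s / t) ^+ 2 * T s) +
    (1 - s / t) * (lambda * T0 + C2 * t `^ alpha).

(** This equals 2 + 2 lambda0, so that kap - 2 is the critical exponent 2 lambda0. *)
Let kap := 2 / (1 - lambda).
Let C4 := kap * C2 / (alpha - beta).
Let g t := Num.max 0 (T t - T0).

(** In the limit the slice inequality reads r g' >= 2 lambda0 g - kap C2 r^alpha wherever T > T0.
    The weight r^(-beta) costs beta g, which is less than 2 lambda0 g, and C4 (alpha - beta) = kap
    C2 absorbs the power. *)
Lemma ratio_decay s t : 0 < s -> s < t -> t <= r2 ->
  s `^ (- beta) * g s + C4 * s `^ (alpha - beta) <=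
  t `^ (- beta) * g t + C4 * t `^ (alpha - beta).
Proof.
move=> s0 st tr; have [M TM] := T_bounded s0.
have sr1 : s <= r1 by have := r2r1; lra.
have M0 : 0 <= M by apply: le_trans (TM s _); rewrite ?T_ge0 // lexx sr1.
have l1 : 0 < 1 - lambda by have := la1; lra.
have k0 : 0 < kap by rewrite divr_gt0.
have ab0 : 0 < alpha - beta by have := be_al; lra.
have C40 : 0 <= C4 by apply: divr_ge0; [exact: mulr_ge0 (ltW k0) C20|exact: ltW].
have t0 : 0 < t by lra.
pose gam := kap - 2; have gamD : gam = kap - 2 by [].
have gamE : gam = 2 * (lambda / (1 - lambda)) by rewrite /gam /kap; field; exact: lt0r_neq0.
have gb : beta < gam by rewrite gamE.
(* K1, K2 and K3 bound the second order errors coming from the weight, from the growth of g and from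
   the added power. *)
pose K1 := s `^ (- beta) * M * (beta * gam + beta * (t / s) * (1 + gam)).
pose K2 := s `^ (- beta) * (2 * kap * (M + T0)).
pose K3 := C4 * t `^ (alpha - beta) * (alpha - beta) ^+ 2.
have gam0 : 0 <= gam by apply: ltW; apply: lt_trans gb.
have ts0 : 0 <= t / s by rewrite divr_ge0 // ltW.
clearbody gam.
have B0 : 0 <= beta * gam + beta * (t / s) * (1 + gam).
  have be0' := ltW be0; apply: addr_ge0; first exact: mulr_ge0.
  by apply: mulr_ge0; [exact: mulr_ge0|exact: addr_ge0].
have K10 : 0 <= K1 by apply: mulr_ge0 B0; exact: mulr_ge0 (powR_ge0 _ _) M0.
have kMT : 0 <= 2 * kap * (M + T0).
  by apply: mulr_ge0; [exact: mulr_ge0 (ltW k0)|exact: addr_ge0].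
have K20 : 0 <= K2 by exact: mulr_ge0 (powR_ge0 _ _) kMT.
have K30 : 0 <= K3 by apply: mulr_ge0 (sqr_ge0 _); exact: mulr_ge0 (powR_ge0 _ _).
apply: (@mono_of_quadratic (fun r => r `^ (- beta) * g r + C4 * r `^ (alpha - beta)) s t
  (K1 + K2 + K3) s0 st); first by rewrite !addr_ge0.
move=> x y sx xy yt; have x0 : 0 < x by lra.
have y0 : 0 < y by lra.
have yr : y <= r2 by lra.
have hsl := T_slice x0 xy yr.
have hinc := powR_increment ab0 x0 (ltW xy).
have hdec := powR_decrement (ltW be0) x0 (ltW xy).
have q0 : 0 < x / y by rewrite divr_gt0.
have q1 : x / y < 1 by rewrite ltr_pdivrMr // mul1r.
have xM : T x <= M by apply: TM; rewrite sx /=; have := r2r1; lra.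
have Tx0 := T_ge0 x.
pose d := 1 - x / y; have dE : x / y = 1 - d by rewrite /d; ring.
have d0 : 0 < d by rewrite /d; lra.
have d1 : d < 1 by rewrite /d; lra.
have yxE : y / x - 1 = d + d ^+ 2 * (y / x) by rewrite /d; field; rewrite !lt0r_neq0.
have yx : y / x <= t / s.
  by rewrite ler_pM ?invr_ge0 ?(ltW y0) ?(ltW x0) // lef_pV2 ?posrE.
have yx0 : 0 <= y / x by rewrite divr_ge0 ?ltW.
have gx0 : 0 <= g x by rewrite le_max lexx.
have gy0 : 0 <= g y by rewrite le_max lexx.
have gxM : g x <= M by rewrite /g ge_max M0; have := T00; lra.
have Yal := powR_ge0 y alpha.
(* One step of relative size d makes g grow by the factor 1 + 2 lambda0 d, up to the gauge term and
   a quadratic error. *)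
have main : g x * (1 + gam * d) <= g y + kap * C2 * d * y `^ alpha + 2 * kap * (M + T0) * d ^+ 2.
  have r0 : 0 <= kap * C2 * d * y `^ alpha.
    by do 2 apply: mulr_ge0 => //; [exact: mulr_ge0 (ltW k0) C20|exact: ltW].
  have rr : 0 <= 2 * kap * (M + T0) * d ^+ 2 by exact: mulr_ge0 kMT (sqr_ge0 _).
  have [xn|xp] := leP (T x - T0) 0.
    by have -> : g x = 0 by [rewrite /g max_l]; rewrite mul0r; lra.
  have gxE : g x = T x - T0 by rewrite /g max_r // ltW.
  have gyE : T y - T0 <= g y by rewrite /g le_max lexx orbT.
  have h1 : kap * (d * (1 - d) ^+ 2 * T x) <= (T y - (1 - d) ^+ 2 * T x) +
      kap * d * (lambda * T0) + kap * C2 * d * y `^ alpha.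
    have := ler_wpM2l (ltW k0) hsl; rewrite -/d dE => h; apply: le_trans h _.
    by rewrite le_eqVlt; apply/orP; left; apply/eqP; rewrite /kap; field; exact: lt0r_neq0.
  have kl : kap * lambda = kap - 2.
    by rewrite /kap; field; exact: lt0r_neq0.
  have h2 : (1 - d) ^+ 2 * (1 + kap * d) * g x <= g y + 2 * kap * T0 * d ^+ 2 +
      kap * C2 * d * y `^ alpha.
    have e : kap * d * (lambda * T0) = (kap - 2) * d * T0 by rewrite -kl; ring.
    have : 0 <= T0 * d ^+ 2 by rewrite mulr_ge0 ?sqr_ge0.
    have : 0 <= T0 * kap * (d ^+ 2 * d).
      apply: mulr_ge0; first exact: mulr_ge0 T00 (ltW k0).
      by rewrite mulr_ge0 ?sqr_ge0 // ltW.
    rewrite e in h1; rewrite gxE; lra.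
  have h3 : 1 + gam * d - 2 * kap * d ^+ 2 <= (1 - d) ^+ 2 * (1 + kap * d).
    have : 0 <= kap * d ^+ 3 by apply: mulr_ge0 (ltW k0) _; rewrite exprn_ge0 // ltW.
    by have := sqr_ge0 d; rewrite gamD; lra.
  have h4 := ler_wpM2r gx0 h3.
  have h5 : 2 * kap * d ^+ 2 * g x <= 2 * kap * d ^+ 2 * M.
    apply: ler_wpM2l gxM; apply: mulr_ge0 (sqr_ge0 _); exact: mulr_ge0 (ltW k0).
  lra.
have yb0 := powR_ge0 y (- beta).
have ybs : y `^ (- beta) <= s `^ (- beta).
  rewrite !powRN lef_pV2 ?posrE ?powR_gt0 //.
  by apply: ge0_ler_powR; rewrite ?nnegrE ?(ltW be0) //; lra.
have xbs : x `^ (- beta) <= s `^ (- beta).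
  rewrite !powRN lef_pV2 ?posrE ?powR_gt0 //.
  by apply: ge0_ler_powR; rewrite ?nnegrE ?(ltW be0) //; lra.
have xb0 := powR_ge0 x (- beta).
have yab : y `^ (- beta) * y `^ alpha = y `^ (alpha - beta).
  by rewrite -powRD ?lt0r_neq0 ?implybT // addrC.
have yt' : y `^ (alpha - beta) <= t `^ (alpha - beta).
  by apply: ge0_ler_powR; rewrite ?nnegrE ?(ltW ab0) //; lra.
have main2 := ler_wpM2l yb0 main.
rewrite -/d in hinc *.
have hinc2 := ler_wpM2l C40 hinc.
have C4E : C4 * (alpha - beta) = kap * C2 by rewrite /C4 divfK // lt0r_neq0.
(* The first order gain (gam - beta) d is nonnegative and dropped; here beta < 2 lambda0 is used. *)
have b1 : x `^ (- beta) * g x * (1 - (beta * gam + beta * (t / s) * (1 + gam)) * d ^+ 2) <=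
    y `^ (- beta) * (g x * (1 + gam * d)).
  have gd : 0 <= 1 + gam * d by rewrite addr_ge0 // mulr_ge0; lra.
  have := ler_wpM2r gd hdec; rewrite yxE => h.
  have {}h := ler_wpM2r gx0 h.
  apply: le_trans (_ : _ <= x `^ (- beta) * (1 - beta * (d + d ^+ 2 * (y / x))) * (1 + gam * d) * g x) _;
    last by apply: le_trans h _; rewrite le_eqVlt; apply/orP; left; apply/eqP; ring.
  rewrite [leRHS]mulrAC [x `^ _ * _ * _ in leRHS]mulrAC -[leRHS]mulrA ler_wpM2l ?mulr_ge0 //.
  have u1 : y / x * (1 + gam * d) <= t / s * (1 + gam).
    apply: ler_pM => //; rewrite lerD2l ler_piMr //; lra.
  have u2 : beta * d ^+ 2 * (y / x * (1 + gam * d)) <= beta * d ^+ 2 * (t / s * (1 + gam)).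
    by rewrite ler_wpM2l // mulr_ge0 ?sqr_ge0 // ltW.
  have : 0 <= (gam - beta) * d by rewrite mulr_ge0 //; lra.
  lra.
have b2 : x `^ (- beta) * g x * ((beta * gam + beta * (t / s) * (1 + gam)) * d ^+ 2) <= K1 * d ^+ 2.
  have h := ler_wpM2r (mulr_ge0 B0 (sqr_ge0 d)) (ler_pM xb0 gx0 xbs gxM).
  by apply: le_trans h _; rewrite /K1 mulrA.
have b3 : y `^ (- beta) * (2 * kap * (M + T0) * d ^+ 2) <= K2 * d ^+ 2.
  by rewrite /K2 mulrA ler_wpM2r ?sqr_ge0 //; exact: ler_wpM2r kMT _ _ ybs.
have b4 : C4 * (y `^ (alpha - beta) * ((alpha - beta) * d) ^+ 2) <= K3 * d ^+ 2.
  have h := ler_wpM2l (mulr_ge0 C40 (mulr_ge0 (sqr_ge0 (alpha - beta)) (sqr_ge0 d))) yt'.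
  rewrite /K3; lra.
have b5 : y `^ (- beta) * (kap * C2 * d * y `^ alpha) = C4 * (y `^ (alpha - beta) * ((alpha - beta) * d)).
  by rewrite -C4E -yab; ring.
lra.
Qed.

End DensityRatio.

(** * Application to the set E *)

Section Assembly.
Context {R : realType}.
Local Notation V := 'rV[R]_3.

(** Balls are open, so the ball of radius r is a countable union of shells inside it. This reaches
    r1 itself, since [mass_bound] needs a strictly larger radius at which the gauge function is
    controlled. *)
Lemma mass_left (E : set V) (r K : R) : (hausdorff 2 E < +oo)%E -> 0 < r ->
  (forall s, 0 < s -> s < r -> mass E s <= K) -> mass E r <= K.
Proof.
move=> fE r0 hK; rewrite -lee_fin -(massE _ fE).
pose t (k : nat) : R := r - r / k.+1%:R.
have t_le i j : (i <= j)%N -> t i <= t j.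
  move=> ij; rewrite lerD2l lerN2 ler_wpM2l ?(ltW r0) //.
  by rewrite lef_pV2 ?posrE ?ltr0n // ler_nat ltnS.
have tr k : t k < r by rewrite gtrBl divr_gt0 // ltr0n.
have t0 : t 0%N = 0 by rewrite /t divr1 subrr.
pose S k := E `&` [set x | t k <= enorm x < t k.+1].
apply: (@le_trans _ _ (hausdorff 2 (\bigcup_k S k))).
  apply: hausdorffS => x [Ex]; rewrite eball0E /= => xr.
  have ex : exists k, enorm x < t k.
    have rx : 0 < (r - enorm x) / r by rewrite divr_gt0 // subr_gt0.
    have [k] := @ltr_add_invr R 0 ((r - enorm x) / r) rx; rewrite add0r => hk.
    exists k; rewrite /t ltrBrDl -ltrBrDr; move: hk; rewrite ltr_pdivlMr // mulrC => hk.
    exact: hk.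
  case: (ex_minnP ex) => -[|k] xk kmin.
    by move: xk; rewrite t0 ltNge enorm_ge0.
  exists k => //; split => //=; rewrite xk andbT leNgt; apply/negP => /kmin.
  by rewrite ltnn.
apply: le_trans (hausdorff_subadd _ _) _; apply: lime_le.
  by apply: is_cvg_nneseries => k _ _; exact: hausdorff_ge0.
near=> n.
have -> : (\sum_(0 <= k < n) hausdorff 2 (S k) = (mass E (t n) - mass E (t 0%N))%:E)%E.
  rewrite -(telescope_sumr (fun k => mass E (t k)) (leq0n n)) -sumEFin.
  by apply: eq_bigr => k _; apply: mass_shell => //; exact: t_le.
have m0 := mass_ge0 E (t 0%N); rewrite lee_fin.
suff : mass E (t n) <= K by lra.
have [n0|] := eqVneq n 0%N; last first.
  rewrite -lt0n => n0; apply: hK => //; apply: (@lt_le_trans _ _ (t 1%N)); last exact: t_le.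
  by rewrite /t; lra.
apply: le_trans (hK (r / 2) _ _); [apply: mass_le => // | | ]; rewrite ?n0 ?t0; lra.
Unshelve. all: by end_near. Qed.

Section Slice.
Variables (E : set V) (h : R -> \bar R) (ct : cone_type) (y : R -> V) (Xs : R -> set V).
Variables (lambda mu alpha r1 Ch T0 : R).
Hypotheses (rE : rectifiable 2 E) (fE : (hausdorff 2 E < +oo)%E).
Hypotheses (la0 : 0 < lambda) (la1 : lambda < 1) (mu0 : 0 < mu) (al0 : 0 < alpha) (Ch0 : 0 < Ch).
Hypothesis T00 : 0 <= T0.
Hypothesis sel : forall r, 0 < r -> r < r1 -> exists eps, selection ct E eps r (y r) (Xs r).
Hypothesis ineq : forall r, 0 < r < r1 ->
    (hausdorff 2 (E `&` eball 0%R r) <=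
       ((1 - mu - lambda) * (r / 2))%:E * hausdorff 1 (E `&` esphere 0%R r) +
       (mu * (r ^+ 2 / 2))%:E *
         hausdorff 1 (sector_cone (y r) (Xs r) `&` esphere 0%R 1%R) +
       (lambda * T0 * r ^+ 2)%:E +
       (4 * r ^+ 2)%:E * h (2 * r)%R)%E.
Hypothesis h_le : forall t, 0 < t <= r1 -> (h t <= (Ch * t `^ alpha)%:E)%E.

(** The assumed inequality is used at one radius r in (s, t) whose slice is no longer than average.
    By [hausdorff_sector] the mu terms cancel, and t <= r1/2 keeps 2 r in the range where h is
    controlled. *)
Lemma mass_slice (s t : R) : 0 < s -> s < t -> t <= r1 / 2 ->
  mass E s <= (1 - lambda) * (t / 2) * ((mass E t - mass E s) / (t - s)) +
    lambda * T0 * t ^+ 2 + 4 * Ch * 2 `^ alpha * t ^+ 2 * t `^ alpha.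
Proof.
move=> s0 st tr; apply/ler_addgt0Pr => e e0.
have t0 : 0 < t by lra.
have ts : 0 < t - s by lra.
have l1 : 0 < 1 - lambda by have := la1; lra.
(* Chosen so that the slack in [coarea_slice] contributes exactly e. *)
pose eta := e * (t - s) / ((1 - lambda) * (t / 2)).
have c0 : 0 < (1 - lambda) * (t / 2) by rewrite mulr_gt0 // divr_gt0.
have eta0 : 0 < eta by rewrite divr_gt0 // mulr_gt0.
have [r /andP[sr rt] hx] := coarea_slice rE fE s0 st eta0.
have r0 : 0 < r by lra.
have rr1 : r < r1 by lra.
set X := hausdorff 1 _ in hx.
have X0 : (0 <= X)%E by exact: hausdorff_ge0.
have fX : X \is a fin_num by rewrite ge0_fin_numE //; exact: le_lt_trans hx (ltry _).
pose x := fine X; have XE : X = x%:E by rewrite fineK.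
have x0 : 0 <= x by rewrite fine_ge0.
have hxr : x <= (mass E t - mass E s + eta) / (t - s) by rewrite -lee_fin -XE.
have [eps hsel] := sel r0 rr1.
have hsec := hausdorff_sector r0 hsel.
have r2 : 0 < 2 * r <= r1 by apply/andP; split; lra.
have p2 : (2 * r) `^ alpha <= 2 `^ alpha * t `^ alpha.
  rewrite -powRM ?(ltW t0) //; apply: ge0_ler_powR; rewrite ?nnegrE ?(ltW al0) //; lra.
have rt2 : r ^+ 2 <= t ^+ 2 by rewrite lerXn2r ?nnegrE //; lra.
have : ((mass E r)%:E <= ((1 - mu - lambda) * (r / 2) * x + mu * (r ^+ 2 / 2) * (r^-1 * x) +
    lambda * T0 * r ^+ 2 + 4 * r ^+ 2 * (Ch * (2 * r) `^ alpha))%R%:E)%E.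
  rewrite -massE //; apply: le_trans (ineq _) _; first by rewrite r0.
  rewrite -/X XE !EFinD; apply: leeD; first (apply: leeD => //; apply: leeD).
  - by rewrite -EFinM.
  - rewrite [leRHS]EFinM lee_wpmul2l //.
      by rewrite lee_fin mulr_ge0 ?(ltW mu0) // divr_ge0 // sqr_ge0.
    by rewrite EFinM -XE.
  - rewrite [leRHS]EFinM lee_wpmul2l //; last exact: h_le.
    by rewrite lee_fin mulr_ge0 // sqr_ge0.
rewrite lee_fin; have -> : (1 - mu - lambda) * (r / 2) * x + mu * (r ^+ 2 / 2) * (r^-1 * x) =
    (1 - lambda) * (r / 2) * x by field; exact: lt0r_neq0.
move=> hr.
have k1 : (1 - lambda) * (r / 2) * x <= (1 - lambda) * (t / 2) * ((mass E t - mass E s + eta) / (t - s)).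
  apply: ler_pM => //; first by rewrite mulr_ge0 ?divr_ge0 ?(ltW l1) ?(ltW r0).
  by rewrite ler_wpM2l ?(ltW l1) //; lra.
have k2 : (1 - lambda) * (t / 2) * ((mass E t - mass E s + eta) / (t - s)) =
    (1 - lambda) * (t / 2) * ((mass E t - mass E s) / (t - s)) + e.
  by rewrite /eta; field; rewrite !lt0r_neq0.
have k3 : lambda * T0 * r ^+ 2 <= lambda * T0 * t ^+ 2.
  by rewrite ler_wpM2l // mulr_ge0 // ltW.
have k4 : 4 * r ^+ 2 * (Ch * (2 * r) `^ alpha) <= 4 * t ^+ 2 * (Ch * (2 `^ alpha * t `^ alpha)).
  have c4 : 0 <= 4 * Ch by exact: mulr_ge0 (ltW Ch0).
  have := ler_wpM2l c4 (ler_pM (sqr_ge0 r) (powR_ge0 _ _) rt2 p2); lra.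
have := mass_le fE (ltW sr); lra.
Qed.

End Slice.
End Assembly.

Theorem corollary3p16 (R : realType) (lambda alpha beta r1 Ch : R) :
  0 < lambda < 10 ^- 3 ->
  0 < alpha -> 0 < Ch -> 0 < r1 ->
  0 < beta < Num.min alpha (2 * (lambda / (1 - lambda))) ->
  exists2 C : R, 0 < C &
  forall (ct : cone_type) (E : set 'rV[R]_3) (h : R -> \bar R) (rr mu : R)
    (y : R -> 'rV[R]_3) (Xs : R -> set 'rV[R]_3),
  E `<=` Omega0 ->
  rectifiable 2 E ->
  (hausdorff 2 E < +oo)%E ->
  E 0 ->
  gauge_function h -> dini h ->
  locally_sliding_almost_minimal h E 0 ->
  locally_C0_equivalent ct E ->
  C0_scale ct E rr ->
  (forall r, 0 < r < rr ->
    exists2 eps, cone_distance ct E r < eps &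
      selection ct E eps r (y r) (Xs r)) ->
  0 < mu < 10 ^- 3 ->
  r1 < rr ->
  (forall r, 0 < r < r1 ->
    (hausdorff 2 (E `&` eball 0%R r) <=
       ((1 - mu - lambda) * (r / 2))%:E * hausdorff 1 (E `&` esphere 0%R r) +
       (mu * (r ^+ 2 / 2))%:E *
         hausdorff 1 (sector_cone (y r) (Xs r) `&` esphere 0%R 1%R) +
       (lambda * Theta0 E * r ^+ 2)%:E +
       (4 * r ^+ 2)%:E * h (2 * r)%R)%E) ->
  (forall t, 0 < t <= r1 -> (h t <= (Ch * t `^ alpha)%:E)%E) ->
  forall rho, 0 < rho <= r1 ->
    `|Theta E rho - Theta0 E| <= C * rho `^ beta.
Proof.
move=> /andP[la0 la1'] al0 Ch0 r10 /andP[be0]; rewrite lt_min => /andP[be_al be_la].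
have la1 : lambda < 1.
  by apply: lt_trans la1' _; rewrite invf_lt1 ?exprn_gt0 // exprn_egt1 // ltr1n.
have l1 : 0 < 1 - lambda by lra.
pose r2 := r1 / 2; have r20 : 0 < r2 by rewrite divr_gt0.
have r2r1 : r2 <= r1 by rewrite /r2; lra.
(* M bounds T on [r1/2, r1]; the factor 4 is the square of r1/(r1/2). *)
pose M := 4 * (2 * @screen_area R + Ch * r1 `^ alpha).
pose C1 := 2 * Ch / alpha.
pose C2 := 4 * Ch * 2 `^ alpha.
pose C4 := 2 / (1 - lambda) * C2 / (alpha - beta).
have C10 : 0 < C1 by rewrite divr_gt0 ?mulr_gt0.
have C20 : 0 <= C2 by rewrite mulr_ge0 ?powR_ge0 // mulr_ge0 // ltW.
have ab0 : 0 < alpha - beta by rewrite subr_gt0.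
have C40 : 0 <= C4 by rewrite divr_ge0 ?(ltW ab0) // mulr_ge0 // divr_ge0 // ltW.
have M0 : 0 <= M.
  by rewrite mulr_ge0 // addr_ge0 // ?mulr_ge0 ?powR_ge0 ?screen_area_ge0 // ltW.
(* The first two terms serve the upper bound and the last one the lower bound; none involves E. *)
pose C := r2 `^ (- beta) * M + C4 * r2 `^ (alpha - beta) + C1 * r1 `^ (alpha - beta).
have p1 : 0 <= r2 `^ (- beta) * M by rewrite mulr_ge0 ?powR_ge0.
have p2 : 0 <= C4 * r2 `^ (alpha - beta) by rewrite mulr_ge0 ?powR_ge0.
have p3 : 0 < C1 * r1 `^ (alpha - beta) by rewrite mulr_gt0 ?powR_gt0.
exists C; first by rewrite /C; lra.
move=> ct E h rr mu y Xs EO rE fE E0 [h_ge0 h_mono _] _ am _ _ sel0 /andP[mu0 _] r1rr ineq h_le.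
pose f := mass E; pose T := Theta E.
have f0 t : 0 <= f t by exact: mass_ge0.
have fle s t : s <= t -> f s <= f t by exact: mass_le.
have TE t : T t = f t / t ^+ 2 by [].
have fT (t : R) : 0 < t -> f t = T t * t ^+ 2.
  by move=> t0; rewrite TE divfK // sqrf_eq0 lt0r_neq0.
have T_ge0 t : 0 <= T t by rewrite TE divr_ge0 ?sqr_ge0.
have T_le (a t : R) : 0 < a -> a <= t <= r1 -> T t <= f r1 / a ^+ 2.
  move=> a0 /andP[at_ tr]; rewrite TE; apply: ler_pM; rewrite ?f0 ?invr_ge0 ?sqr_ge0 ?fle //.
  by rewrite lef_pV2 ?posrE ?exprn_gt0 ?lerXn2r ?nnegrE //; lra.
have h_le' (r t : R) : 0 < r -> r <= t -> t <= r1 -> (h r <= (Ch * t `^ alpha)%:E)%E.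
  move=> r0 rt tr; apply: le_trans (h_le r _) _; first by apply/andP; split; lra.
  rewrite lee_fin ler_wpM2l ?(ltW Ch0) //.
  by apply: ge0_ler_powR; rewrite ?nnegrE ?(ltW al0) //; lra.
have f_r1 : f r1 <= (2 * @screen_area R + Ch * r1 `^ alpha) * r1 ^+ 2.
  apply: (mass_left fE r10) => s s0 sr.
  have sr' : 0 < s < r1 by rewrite s0.
  apply: le_trans (mass_bound EO fE am sr' (h_le' _ _ r10 (lexx _) (lexx _))) _.
  have ss : s ^+ 2 <= r1 ^+ 2 by rewrite lerXn2r ?nnegrE //; lra.
  by have := ler_wpM2l (@screen_area_ge0 R) ss; lra.
have TM t : r2 <= t <= r1 -> T t <= M.
  move=> ht; apply: le_trans (T_le _ _ r20 ht) _.
  rewrite ler_pdivrMr ?exprn_gt0 //; apply: le_trans f_r1 _.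
  by rewrite le_eqVlt; apply/orP; left; apply/eqP; rewrite /M /r2; field.
have T_bounded a : 0 < a -> exists M, forall t, a <= t <= r1 -> T t <= M.
  by move=> a0; exists (f r1 / a ^+ 2) => t; exact: T_le.
have T_cone (s t : R) : 0 < s -> s < t -> t <= r1 ->
    (1 - s / t) * (s / t) ^+ 2 * T s <=
    (T t - (s / t) ^+ 2 * T s) / (2 * (s / t)) + (1 - s / t) * (Ch * t `^ alpha).
  move=> s0 st tr; have t0 : 0 < t by lra.
  have st' : 0 < s < t by rewrite s0.
  have H0 : 0 <= Ch * t `^ alpha by rewrite mulr_ge0 ?powR_ge0 // ltW.
  have hr (r : R) : 0 < r <= t -> (h r <= (Ch * t `^ alpha)%:E)%E.
    by move=> /andP[r0 rt]; exact: h_le'.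
  have := cone_monotonicity EO rE fE am st' H0 hr; rewrite -/f !fT //.
  (* Dividing by t^3 turns areas into density ratios and leaves only s/t and the gauge term. *)
  have t3 : 0 <= (t ^+ 3)^-1 by rewrite invr_ge0 exprn_ge0 // ltW.
  move=> /(ler_wpM2l t3) hc.
  have e1 : (t ^+ 3)^-1 * ((t - s) * (T s * s ^+ 2)) = (1 - s / t) * (s / t) ^+ 2 * T s.
    by field; rewrite lt0r_neq0.
  have e2 : (t ^+ 3)^-1 * (t ^+ 2 / (2 * s) * (T t * t ^+ 2 - T s * s ^+ 2) +
      (t - s) * t ^+ 2 * (Ch * t `^ alpha)) =
    (T t - (s / t) ^+ 2 * T s) / (2 * (s / t)) + (1 - s / t) * (Ch * t `^ alpha).
    by field; rewrite !lt0r_neq0.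
  by rewrite -e1 -e2.
have [L [cvL L0' hL]] := ratio_cvg r10 Ch0 al0 T_ge0 T_bounded T_cone.
have T0E : Theta0 E = L by exact: cvg_lim.
rewrite T0E in ineq *.
have sel r : 0 < r -> r < r1 -> exists eps, selection ct E eps r (y r) (Xs r).
  move=> r0 rr1; have [|eps _ hs] := sel0 r; first by rewrite r0 (lt_trans rr1).
  by exists eps.
have T_slice (s t : R) : 0 < s -> s < t -> t <= r2 ->
    (1 - s / t) * (s / t) ^+ 2 * T s <=
    (1 - lambda) / 2 * (T t - (s / t) ^+ 2 * T s) + (1 - s / t) * (lambda * L + C2 * t `^ alpha).
  move=> s0 st tr; have t0 : 0 < t by lra.
  have := mass_slice rE fE la0 la1 mu0 al0 Ch0 L0' sel ineq h_le s0 st tr.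
  rewrite -/f !fT // => hs.
  have ts : 0 < t - s by lra.
  have c0 : 0 <= (1 - s / t) / t ^+ 2.
    by rewrite divr_ge0 ?sqr_ge0 // subr_ge0 ler_pdivrMr // mul1r ltW.
  have := ler_wpM2l c0 hs.
  have -> : (1 - s / t) / t ^+ 2 * (T s * s ^+ 2) = (1 - s / t) * (s / t) ^+ 2 * T s.
    by field; rewrite lt0r_neq0.
  move/le_trans; apply; rewrite le_eqVlt; apply/orP; left; apply/eqP.
  by rewrite /C2; field; rewrite !lt0r_neq0.
move=> rho /andP[rho0 rho1].
have rb0 := powR_ge0 rho beta.
have rbb : rho `^ beta * rho `^ (- beta) = 1.
  by rewrite powRN mulfV // lt0r_neq0 // powR_gt0.
have low : L - T rho <= C1 * r1 `^ (alpha - beta) * rho `^ beta.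
  have := hL rho rho0 rho1; rewrite -/C1.
  have : rho `^ alpha <= r1 `^ (alpha - beta) * rho `^ beta.
    have -> : rho `^ alpha = rho `^ (alpha - beta) * rho `^ beta.
      by rewrite -powRD ?subrK // lt0r_neq0 // implybT.
    rewrite ler_wpM2r //; apply: ge0_ler_powR; rewrite ?nnegrE ?(ltW ab0) //; lra.
  by move=> /(ler_wpM2l (ltW C10)); lra.
have up : T rho - L <= (r2 `^ (- beta) * M + C4 * r2 `^ (alpha - beta)) * rho `^ beta.
  (* Below r1/2 the monotone quantity of [ratio_decay] is compared with its value at r1/2; above, T
     <= M suffices, since rho^beta is at least r2^beta. *)
  have [rr2|r2r] := ltP rho r2.
    have := ratio_decay T_ge0 T_bounded L0' la1 be0 be_al be_la r2r1 C20 T_slice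
      rho0 rr2 (lexx _).
    rewrite -/C4; set g1 := Num.max 0 (T rho - L); set g2 := Num.max 0 (T r2 - L) => hd.
    have hg1 : T rho - L <= g1 by rewrite le_max lexx orbT.
    have hg2 : g2 <= M.
      by rewrite ge_max M0; have := TM r2; rewrite lexx r2r1 => /(_ isT); lra.
    have h1 : r2 `^ (- beta) * g2 <= r2 `^ (- beta) * M by rewrite ler_wpM2l ?powR_ge0.
    have h2 : 0 <= C4 * rho `^ (alpha - beta) by rewrite mulr_ge0 ?powR_ge0.
    have h3 : rho `^ (- beta) * g1 <= r2 `^ (- beta) * M + C4 * r2 `^ (alpha - beta) by lra.
    have := ler_wpM2l rb0 h3; rewrite mulrA rbb mul1r; lra.
  have hT : T rho <= M by apply: TM; rewrite r2r rho1.
  have h1 : 1 <= r2 `^ (- beta) * rho `^ beta.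
    rewrite powRN mulrC ler_pdivlMr ?powR_gt0 // mul1r.
    by apply: ge0_ler_powR; rewrite ?nnegrE ?(ltW be0) //; lra.
  have h2 := ler_wpM2l M0 h1.
  have h3 : 0 <= C4 * r2 `^ (alpha - beta) * rho `^ beta by exact: mulr_ge0.
  lra.
have q1 : 0 <= (r2 `^ (- beta) * M + C4 * r2 `^ (alpha - beta)) * rho `^ beta.
  by rewrite mulr_ge0 // addr_ge0.
have q3 : 0 <= C1 * r1 `^ (alpha - beta) * rho `^ beta by rewrite mulr_ge0 // ltW.
rewrite -/(T rho) ler_norml /C; apply/andP; split; lra.
Qed.
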